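(* Let $d\ge 1$, $m>0$, $\tau>0$, $\beta>0$, $t_\iota\in\mathbb{R}$, and let $U\colon[t_\iota,\infty)\times\mathbb{R}^d\to\mathbb{R}_+$, $(t,q)\mapsto U_t(q)$, be a sufficiently regular and confining time-dependent potential (in the sense of the standing assumptions in the context). Write $x=(q,p)\in\mathbb{R}^d\times\mathbb{R}^d$. Let $\rho_t(x)$ be the solution, for $t\ge t_\iota$, of the Fokker-Planck equation $$\Big(\partial_t+\Big\langle\frac{p}{m},\partial_q\Big\rangle-\big\langle(\partial U_t)(q),\partial_p\big\rangle-\Big\langle\partial_p,\frac{p}{\tau}\Big\rangle-\frac{m}{\beta\tau}\,\partial_p^2\Big)\rho_t(x)=0$$ with Maxwell-Boltzmann initial datum $$\rho_{t_\iota}(x)=\frac1Z\,e^{-\frac{\beta\|p\|^2}{2m}-\beta U_\iota(q)},$$ where $U_\iota\colon\mathbb{R}^d\to\mathbb{R}$ is a given potential and $Z$ is the normalizing constant. Then for every $t\ge t_\iota$ and $x=(q,p)\in\mathbb{R}^{2d}$, $$\rho_t(x)=\mathrm{E}_{\mathcal{I}}\!\left(\frac1Z\exp\Big(-\beta U_\iota(\mathscr{q}_{t_\iota})-\frac{\beta\|\mathscr{p}_{t_\iota}\|^2}{2m}-\int_{t_\iota}^t\Big(\sqrt{\frac{\beta\tau}{2m}}\,\Big\langle dw_s,\frac{\mathscr{p}_s}{\tau}\Big\rangle+\frac{\tau\beta}{4m}\Big\|\frac{\mathscr{p}_s}{\tau}\Big\|^2ds\Big)\Big)\ \Big|\ \mathscr{x}_t=x\right),$$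 where $\mathcal{I}$ is the path measure of the process $\mathscr{x}_s=(\mathscr{q}_s,\mathscr{p}_s)$ evolved backward in time from $\mathscr{x}_t=x$ according to $$d\mathscr{q}_s=\frac{\mathscr{p}_s}{m}\,ds,\qquad d\mathscr{p}_s=-(\partial U_s)(\mathscr{q}_s)\,ds+\sqrt{\frac{2m}{\tau\beta}}\,dw_s$$ (with backward differentials), and the stochastic integral is in the pre-point discretization.
   Context: Notation: $\partial U_t$ is the gradient of $U_t$ in $q$; $\partial_q,\partial_p$ are gradients in $q$ and $p$; $\langle\cdot,\cdot\rangle$ and $\|\cdot\|$ are the Euclidean inner product and norm; $\langle\partial_p,\frac{p}{\tau}\rangle$ acts on a function $\rho$ as the divergence $\langle\partial_p,\frac{p}{\tau}\rho\rangle$; $\partial_p^2$ is the Laplacian in $p$. Process under $\mathcal{I}$: $w$ is a standard $d$-dimensional Wiener process. Conditioned on $\mathscr{x}_t=x=(q,p)$, for $s\in[t_\iota,t]$, $$\mathscr{q}_s=q-\int_s^t\frac{\mathscr{p}_r}{m}\,dr,\qquad \mathscr{p}_s=p+\int_s^t(\partial U_r)(\mathscr{q}_r)\,dr-\sqrt{\frac{2m}{\tau\beta}}\,(w_t-w_s),$$ adapted to the backward filtration in which the $\sigma$-algebra at time $s$ is generated by $\{w_t-w_r : s\le r\le t\}$. Pre-point stochastic integral: over partitions $t_\iota=s_0<\dots<s_N=t$ with mesh tending to $0$, $$\int_{t_\iota}^t\Big\langle dw_s,\frac{\mathscr{p}_s}{\tau}\Big\rangle=\lim\sum_{i=0}^{N-1}\Big\langle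 w_{s_{i+1}}-w_{s_i},\frac{\mathscr{p}_{s_i}}{\tau}\Big\rangle$$ (integrand evaluated at the earlier time of each subinterval; limit in probability). Standing assumptions: $U$ is sufficiently regular and confining. This is understood to guarantee that the Fokker-Planck equation has a (sufficiently regular) solution fully specified by its initial datum and integrable over $\mathbb{R}^{2d}$; that the backward process with path measure $\mathcal{I}$, i.e. $d^\flat\mathscr{p}_s=-(\partial U_s)(\mathscr{q}_s)ds+\sqrt{2m/(\tau\beta)}\,dw_s$ with $d^\flat\mathscr{q}_s=\mathscr{p}_s\,ds/m$ (where $d^\flat$ denotes the backward differential, $d^\flat\mathscr{q}_s=\mathscr{q}_s-\mathscr{q}_{s-ds}$), and the backward process with the additional drift $\mathscr{p}_s/\tau$ in the momentum equation, i.e. $d^\flat\mathscr{p}_s=(\mathscr{p}_s/\tau-(\partial U_s)(\mathscr{q}_s))ds+\sqrt{2m/(\tau\beta)}\,dw_s$ with $d^\flat\mathscr{q}_s=\mathscr{p}_s\,ds/m$, are well posed, the path measure $\mathcal{P}^\flat$ of the latter being absolutely continuous with respect to $\mathcal{I}$ with Radon-Nikodym derivative given by Girsanov's formula; and the integrability needed for $s\mapsto e^{-\frac{\beta}{m}\int_s^t\langle(\partial U_r)(\mathscr{q}_r),\mathscr{p}_r\rangle dr}\,e^{\frac{\beta\|\mathscr{p}_s\|^2}{2m}}\,\rho_s(\mathscr{x}_s)$ to be a true martingale under $\mathcal{P}^\flat$ with respect to the backward filtration. The initial potential $U_\iota$ is such that $Z<\infty$. *)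

(* Defs.v *)
(* MathComp-Analysis, over an arbitrary R : realType. *)
From HB Require Import structures.
From mathcomp Require Import all_boot all_order all_algebra.
From mathcomp Require Import all_classical all_reals all_analysis.
Set Implicit Arguments.
Unset Strict Implicit.
Unset Printing Implicit Defensive.
Import Order.TTheory GRing.Theory Num.Theory.
Import numFieldTopology.Exports numFieldNormedType.Exports.
Local Open Scope classical_set_scope.
Local Open Scope ring_scope.

(** * Vector calculus on R^d = 'rV[R]_d *)

(* The library norm on 'rV[R]_d is the sup norm: the Euclidean structure is
   spelled out here.  The topologies agree. *)
Definition dotp (R : realType) (d : nat) (u v : 'rV[R]_d) : R :=
  \sum_(i < d) u 0 i * v 0 i.

Definition normsq (R : realType) (d : nat) (u : 'rV[R]_d) : R := dotp u u.

Definition basis_vec (R : realType) (d : nat) (i : 'I_d) : 'rV[R]_d :=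
  delta_mx 0 i.

Definition partial (R : realType) (d : nat) (i : 'I_d) (f : 'rV[R]_d -> R)
  (x : 'rV[R]_d) : R := 'D_(basis_vec R i) f x.

Definition grad (R : realType) (d : nat) (f : 'rV[R]_d -> R) (x : 'rV[R]_d)
  : 'rV[R]_d := \row_i partial i f x.

Definition divergence (R : realType) (d : nat) (F : 'rV[R]_d -> 'rV[R]_d)
  (x : 'rV[R]_d) : R := \sum_(i < d) partial i (fun y => F y 0 i) x.

Definition laplacian (R : realType) (d : nat) (f : 'rV[R]_d -> R)
  (x : 'rV[R]_d) : R := \sum_(i < d) partial i (partial i f) x.

(* Lebesgue integral over R^n of a nonnegative function, as an iterated
   integral over the coordinates; by Tonelli this is the integral against
   n-dimensional Lebesgue measure when f is Borel.  Only used for nonnegative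
   f. *)
Fixpoint integral_Rn (R : realType) (n : nat) : ('rV[R]_n -> \bar R) -> \bar R :=
  match n return ('rV[R]_n -> \bar R) -> \bar R with
  | 0%N => fun f => f 0
  | n'.+1 => fun f => (\int[@lebesgue_measure R]_x
      integral_Rn (fun v : 'rV[R]_n' => f (row_mx (x%:M : 'rV[R]_1) v)))%E
  end.

Definition integral_phase (R : realType) (d : nat)
  (f : 'rV[R]_d -> 'rV[R]_d -> R) : \bar R :=
  integral_Rn (fun q => integral_Rn (fun p => (f q p)%:E)).

(** * Potential, initial datum, Fokker-Planck equation *)

Definition regular_potential (R : realType) (d : nat) (a : R)
  (U : R -> 'rV[R]_d -> R) : Prop :=
  [/\ forall t q, a <= t -> 0 <= U t q,
      forall t q (i : 'I_d), a <= t -> derivable (U t) q (basis_vec R i)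
    & {within [set z : R * 'rV[R]_d | a <= z.1],
        continuous (fun z : R * 'rV[R]_d => grad (U z.1) z.2)}].

(* The normalizing constant Z, possibly infinite. *)
Definition partition_function (R : realType) (d : nat) (m beta : R)
  (Uini : 'rV[R]_d -> R) : \bar R :=
  integral_phase (fun q p : 'rV[R]_d =>
    expR (- (beta * normsq p / (2 * m)) - beta * Uini q)).

(* Left-hand side of the equation.  The friction term is the divergence in p of
   (p / tau) rho. *)
Definition fokker_planck (R : realType) (d : nat) (m tau beta : R)
  (U : R -> 'rV[R]_d -> R) (rho : R -> 'rV[R]_d -> 'rV[R]_d -> R)
  (t : R) (q p : 'rV[R]_d) : R :=
  derive1 (fun s : R => rho s q p) t
  + dotp (m^-1 *: p) (grad (fun y => rho t y p) q)
  - dotp (grad (U t) q) (grad (rho t q) p)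
  - divergence (fun y => rho t q y *: (tau^-1 *: y)) p
  - m / (beta * tau) * laplacian (rho t q) p.

(* Joint continuity of f(t,q,p) on t > a. *)
Definition continuous_after (R : realType) (d : nat) (a : R)
  (f : R -> 'rV[R]_d -> 'rV[R]_d -> R) : Prop :=
  forall z : R * 'rV[R]_d * 'rV[R]_d, a < z.1.1 ->
    {for z, continuous (fun z : R * 'rV[R]_d * 'rV[R]_d => f z.1.1 z.1.2 z.2)}.

(* Class C^{1,1,2} in (t,q,p) for t > a. *)
Definition C112_after (R : realType) (d : nat) (a : R)
  (rho : R -> 'rV[R]_d -> 'rV[R]_d -> R) : Prop :=
  [/\ forall t q p, a < t -> derivable (fun s : R => rho s q p) t 1,
      forall t q p (i : 'I_d), a < t ->
        [/\ derivable (fun y => rho t y p) q (basis_vec R i),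
            derivable (rho t q) p (basis_vec R i)
          & forall j : 'I_d,
              derivable (partial j (rho t q)) p (basis_vec R i)],
      continuous_after a (fun t q p => derive1 (fun s : R => rho s q p) t)
    & forall i : 'I_d,
        [/\ continuous_after a (fun t q p => partial i (fun y => rho t y p) q),
            continuous_after a (fun t q p => partial i (rho t q) p)
          & forall j : 'I_d, continuous_after a
              (fun t q p => partial i (partial j (rho t q)) p)]].

(* Classical solution of the Cauchy problem, continuous up to the initial time
   and integrable over phase space at all times. *)
Definition fokker_planck_solution (R : realType) (d : nat) (m tau beta a : R)
  (U : R -> 'rV[R]_d -> R) (rho : R -> 'rV[R]_d -> 'rV[R]_d -> R) : Prop :=
  [/\ C112_after a rho,
      {within [set z : R * 'rV[R]_d * 'rV[R]_d | a <= z.1.1],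
        continuous (fun z : R * 'rV[R]_d * 'rV[R]_d => rho z.1.1 z.1.2 z.2)},
      forall t, a <= t ->
        (integral_phase (fun q p => `|rho t q p|%R) < +oo)%E
    & forall t q p, a < t -> fokker_planck m tau beta U rho t q p = 0].

(** * Processes on a time interval [a, t] *)

Definition continuous_paths (R : realType) (d : nat) (Omega : Type) (a t : R)
  (X : R -> Omega -> 'rV[R]_d) : Prop :=
  forall omega, {within `[a, t], continuous (fun s : R => X s omega)}.

(* Standard d-dimensional Wiener process on [a, t]: the increments over
   consecutive intervals are independent, with independent coordinates of law
   N(0, length).  The second parameter of normal_prob is the standard
   deviation. *)
Definition wiener (R : realType) (d : nat) (disp : measure_display)
  (Omega : measurableType disp) (P : probability Omega R) (a t : R)
  (w : R -> Omega -> 'rV[R]_d) : Prop :=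
  [/\ forall s (k : 'I_d), s \in `[a, t] ->
        measurable_fun setT (fun omega => w s omega 0 k),
      forall omega, w a omega = 0,
      continuous_paths a t w
    & forall (n : nat) (u : nat -> R) (A : nat -> 'I_d -> set R),
        (forall i, (i <= n)%N -> u i \in `[a, t]) ->
        (forall i, (i < n)%N -> u i < u i.+1) ->
        (forall i k, measurable (A i k)) ->
        P [set omega | forall i (k : 'I_d), (i < n)%N ->
             A i k (w (u i.+1) omega 0 k - w (u i) omega 0 k)]
        = (\prod_(i < n) \prod_(k < d)
             normal_prob 0 (Num.sqrt (u i.+1 - u i)%R) (A i k))%E].

(* Backward filtration of w: the sigma-algebra at time s is generated by
   w_t - w_r, s <= r <= t; it grows as s decreases. *)
Definition backward_filtration (R : realType) (d : nat) (Omega : Type) (t : R)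
  (w : R -> Omega -> 'rV[R]_d) (s : R) : set (set Omega) :=
  <<s [set B | exists r (k : 'I_d) (A : set R),
         [/\ s <= r <= t, measurable A
           & B = [set omega | A (w t omega 0 k - w r omega 0 k)]] ]>>.

Definition adapted (R : realType) (d : nat) (Omega : Type) (a t : R)
  (F : R -> set (set Omega)) (X : R -> Omega -> 'rV[R]_d) : Prop :=
  forall s (k : 'I_d) (A : set R), s \in `[a, t] -> measurable A ->
    F s [set omega | A (X s omega 0 k)].

(* Wiener process relative to a backward filtration F: when time runs backward
   from t, the increments w_t - w_s are adapted and w_s - w_r, r < s, is
   independent of F_s. *)
Definition backward_wiener (R : realType) (d : nat) (disp : measure_display)
  (Omega : measurableType disp) (P : probability Omega R) (a t : R)
  (F : R -> set (set Omega)) (w : R -> Omega -> 'rV[R]_d) : Prop :=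
  [/\ wiener P a t w,
      adapted a t F (fun s omega => w t omega - w s omega)
    & forall r s (B : set Omega) (A : 'I_d -> set R),
        a <= r -> r < s -> s <= t -> F s B -> (forall k, measurable (A k)) ->
        let E := [set omega | forall k : 'I_d,
                    A k (w s omega 0 k - w r omega 0 k)] in
        P (B `&` E) = (P B * P E)%E].

Definition vec_integral (R : realType) (d : nat) (s t : R) (f : R -> 'rV[R]_d)
  : 'rV[R]_d :=
  \row_k (\int[@lebesgue_measure R]_(r in `[s, t]) (f r 0 k))%R.

Definition noise_amplitude (R : realType) (m tau beta : R) : R :=
  Num.sqrt (2 * m / (tau * beta)).

(* Process run backward from (q, p) at time t, with momentum drift b:
   dq_s = (p_s / m) ds, dp_s = b_s(q_s, p_s) ds + noise_amplitude dw_s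
   in integrated form.  The noise is additive, hence the equation is pathwise. *)
Definition backward_process (R : realType) (d : nat) (Omega : Type)
  (m tau beta a t : R) (F : R -> set (set Omega))
  (b : R -> 'rV[R]_d -> 'rV[R]_d -> 'rV[R]_d)
  (w : R -> Omega -> 'rV[R]_d) (q p : 'rV[R]_d)
  (qs ps : R -> Omega -> 'rV[R]_d) : Prop :=
  [/\ continuous_paths a t qs /\ continuous_paths a t ps,
      adapted a t F qs /\ adapted a t F ps,
      forall omega s, s \in `[a, t] ->
        qs s omega = q - vec_integral s t (fun r => m^-1 *: ps r omega)
    & forall omega s, s \in `[a, t] ->
        ps s omega = p
          - vec_integral s t (fun r => b r (qs r omega) (ps r omega))
          - noise_amplitude m tau beta *: (w t omega - w s omega)].

(* Drifts under the reference path measure and under the dissipative backward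
   path measure. *)
Definition drift_ref (R : realType) (d : nat) (U : R -> 'rV[R]_d -> R)
  (s : R) (q p : 'rV[R]_d) : 'rV[R]_d := - grad (U s) q.

Definition drift_flat (R : realType) (d : nat) (tau : R)
  (U : R -> 'rV[R]_d -> R) (s : R) (q p : 'rV[R]_d) : 'rV[R]_d :=
  tau^-1 *: p - grad (U s) q.

(** * Stochastic integrals *)

(* A partition a = s_0 < ... < s_N = t is the sequence [:: s_1; ...; s_N] with
   itv_partition a t. *)
Definition prepoint_sum (R : realType) (d : nat) (Omega : Type) (a t : R)
  (w Y : R -> Omega -> 'rV[R]_d) (s : seq R) (omega : Omega) : R :=
  let x := nth t (a :: s) in
  \sum_(0 <= i < size s)
    dotp (w (x i.+1) omega - w (x i) omega) (Y (x i) omega).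

Definition postpoint_sum (R : realType) (d : nat) (Omega : Type) (a t : R)
  (w Y : R -> Omega -> 'rV[R]_d) (s : seq R) (omega : Omega) : R :=
  let x := nth t (a :: s) in
  \sum_(0 <= i < size s)
    dotp (w (x i.+1) omega - w (x i) omega) (Y (x i.+1) omega).

(* L is the limit in probability of the sums S as the mesh of the partition
   tends to 0. *)
Definition limit_in_probability (R : realType) (disp : measure_display)
  (Omega : measurableType disp) (P : probability Omega R) (a t : R)
  (S : seq R -> Omega -> R) (L : Omega -> R) : Prop :=
  measurable_fun setT L /\
  forall eps delta : R, 0 < eps -> 0 < delta ->
    exists2 eta : R, 0 < eta &
      forall s : seq R, itv_partition a t s ->
        (forall i, (i < size s)%N ->
           nth t (a :: s) i.+1 - nth t (a :: s) i < eta) ->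
        (P [set omega | (eps <= `|S s omega - L omega|)%R] <= delta%:E)%E.

Definition prepoint_integral (R : realType) (d : nat) (disp : measure_display)
  (Omega : measurableType disp) (P : probability Omega R) (a t : R)
  (w Y : R -> Omega -> 'rV[R]_d) (L : Omega -> R) : Prop :=
  limit_in_probability P a t (prepoint_sum a t w Y) L.

(* With respect to the backward filtration, the post-point integral is the Ito
   integral. *)
Definition postpoint_integral (R : realType) (d : nat) (disp : measure_display)
  (Omega : measurableType disp) (P : probability Omega R) (a t : R)
  (w Y : R -> Omega -> 'rV[R]_d) (L : Omega -> R) : Prop :=
  limit_in_probability P a t (postpoint_sum a t w Y) L.

(** * Girsanov's formula and integrability *)

(* Pflat << I, with Radon-Nikodym derivative
   exp (int <theta_s, dw_s> - 1/2 int |theta_s|^2 ds), Ito integral in the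
   backward filtration, where theta_s = (p_s / tau) / noise_amplitude is the
   additional drift in units of the noise amplitude. *)
Definition girsanov_formula (R : realType) (d : nat) (disp : measure_display)
  (Omega : measurableType disp) (I Pflat : probability Omega R)
  (m tau beta a t : R) (w ps : R -> Omega -> 'rV[R]_d) : Prop :=
  Pflat `<< I /\
  exists2 L : Omega -> R,
    postpoint_integral I a t w (fun s omega => tau^-1 *: ps s omega) L &
    ae_eq I setT (Radon_Nikodym (charge_of_finite_measure Pflat) I)
      (fun omega => (expR (Num.sqrt (beta * tau / (2 * m)) * L omega
         - \int[@lebesgue_measure R]_(s in `[a, t])
             (tau * beta / (4 * m) * normsq (tau^-1 *: ps s omega))))%:E).

Definition backward_stopping_time (R : realType) (Omega : Type) (a t : R)
  (F : R -> set (set Omega)) (T : Omega -> R) : Prop :=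
  (forall omega, T omega \in `[a, t]) /\
  (forall s, s \in `[a, t] -> F s [set omega | s <= T omega]).

(* Class (D): {M_T : T stopping time} is uniformly integrable.  On a compact
   time interval this is exactly the integrability that makes a continuous
   local martingale a true martingale. *)
Definition class_D (R : realType) (disp : measure_display)
  (Omega : measurableType disp) (P : probability Omega R) (a t : R)
  (F : R -> set (set Omega)) (M : R -> Omega -> R) : Prop :=
  forall eps : R, 0 < eps -> exists K : R,
    forall T : Omega -> R, backward_stopping_time a t F T ->
      (\int[P]_(omega in [set omega | (K < `|M (T omega) omega|)%R])
         `|M (T omega) omega|%:E <= eps%:E)%E.

Definition martingale_candidate (R : realType) (d : nat) (Omega : Type)
  (m beta t : R) (U : R -> 'rV[R]_d -> R)
  (rho : R -> 'rV[R]_d -> 'rV[R]_d -> R)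
  (qs ps : R -> Omega -> 'rV[R]_d) (s : R) (omega : Omega) : R :=
  expR (- (beta / m * \int[@lebesgue_measure R]_(r in `[s, t])
                        (dotp (grad (U r) (qs r omega)) (ps r omega))))
  * expR (beta * normsq (ps s omega) / (2 * m))
  * rho s (qs s omega) (ps s omega).

(* Main.v *)
(* Let M_s = exp(-(beta/m) int_s^t <dU_r, p_r> dr) exp(beta |p_s|^2 / 2m) rho_s(x_s).
   By the Fokker-Planck equation the drift of M cancels in the backward Ito formula
   under Pflat, so that the mean of M_ti is M_t = exp(beta |p|^2 / 2m) rho_t(x).

   No stochastic integral is needed.  The noise being additive, Taylor expansion along
   each path gives M_r - M_s = (coefficients at time s) . (dw_k, dw_k^2 - (s - r),
   dw_j dw_k) + o((s - r) + |dw|^2).  On a grid, stopped when a coefficient exceeds n,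
   the first term is an L^2-bounded martingale sum and the remainders add up to a
   quantity tending to 0 in probability; since M is of class (D), that quantity is
   uniformly integrable and disappears from the mean.  Then the mesh tends to 0,
   n to infinity and the final time to ti.

   Under I, the momentum equation expresses the noise increments through those of p, and
   the sum of the pre-point and post-point sums converges path by path.  Hence the
   pre-point integral exists and is determined by the post-point one in Girsanov's
   formula, and M_ti dPflat/dI is almost everywhere exp(beta |p|^2 / 2m) times the
   integrand of the theorem. *)
Require Import Defs.
From HB Require Import structures.
From mathcomp Require Import all_boot all_order all_algebra.
From mathcomp Require Import all_classical all_reals all_analysis.
From mathcomp Require Import measurable_realfun.
From mathcomp Require Import ring lra.
Set Implicit Arguments.
Unset Strict Implicit.
Unset Printing Implicit Defensive.
Import Order.TTheory GRing.Theory Num.Theory.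
Import numFieldTopology.Exports numFieldNormedType.Exports.
Local Open Scope classical_set_scope.
Local Open Scope ring_scope.

(** * Gaussian moments *)

(** No growth bound on the derivatives of [rho] or on the force is available, and these derivatives
    are continuous only after [ti]. Along one path on [a, t] with a > ti they are bounded, but by a
    constant that depends on the path: hence the stopping at level n and the separate limit in the
    final time.

    The modulus in the remainders also depends on the path. Divided by 1 plus the sum of (s - r) +
    |dw|^2 over the grid, the total remainder tends to 0 at each point; the divisor is bounded in
    mean, so the product tends to 0 in probability.

    Multiplication by exp(beta |p|^2 / 2m) turns the Fokker-Planck equation into the backward
    equation of the drift p / tau - dU, up to a potential (beta / m) <dU, p>, which the exponential
    of the work in M removes. The same two factors reappear in the change of discretization: (p' -
    p)(p' + p) telescopes in the sum of pre-point and post-point sums and leaves the kinetic energy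
    at both ends and the work of the force. *)

Lemma integral_normal_prob (R : realType) (m s : R) (f : R -> \bar R) :
  (forall x, (0 <= f x)%E) -> measurable_fun setT f ->
  (\int[normal_prob m s]_x f x =
   \int[@lebesgue_measure R]_x (f x * (normal_pdf m s x)%:E))%E.
Proof.
move=> f0 mf.
have dom := @normal_prob_dominates R m s.
rewrite -(Radon_Nikodym_SigmaFinite.change_of_variables dom f0 measurableT mf).
apply: ae_eq_integral => //.
- apply: emeasurable_funM => //.
  exact: measurable_int (Radon_Nikodym_SigmaFinite.f_integrable dom).
- apply: emeasurable_funM => //; apply/measurable_EFinP.
  exact: measurable_normal_pdf.
- apply: ae_eqe_mul2l; apply: integral_ae_eq => //.
  + exact: Radon_Nikodym_SigmaFinite.f_integrable.
  + by apply/measurable_EFinP; exact: measurable_normal_pdf.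
  + by move=> A _ mA; rewrite -Radon_Nikodym_SigmaFinite.f_integral.
Qed.

(** Completing the square: exp(l x) times the N(0, s^2) density is exp(l^2 s^2 / 2) times the N(l
    s^2, s^2) density. Every Gaussian moment below is extracted from this formula. *)
Lemma normal_prob_mgf (R : realType) (s l : R) : s != 0 ->
  (\int[normal_prob 0 s]_x (expR (l * x))%:E = (expR (l ^+ 2 * s ^+ 2 / 2))%:E)%E.
Proof.
move=> s0; rewrite integral_normal_prob; last 2 first.
- by move=> x; rewrite lee_fin expR_ge0.
- by apply/measurable_EFinP; apply: measurableT_comp => //; exact: mulrl_measurable.
transitivity (\int[@lebesgue_measure R]_x
    ((expR (l ^+ 2 * s ^+ 2 / 2))%:E * (normal_pdf (l * s ^+ 2) s x)%:E))%E.
  apply: eq_integral => x _; rewrite -!EFinM; congr EFin.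
  rewrite !normal_pdfE// /normal_fun mulrCA [RHS]mulrCA -!expRD; congr (_ * expR _).
  by field.
rewrite integralZl//; last exact: integrable_normal_pdf.
by rewrite integral_normal_pdf mule1.
Qed.

Lemma integral_law (R : realType) d d' (T : measurableType d) (U : measurableType d')
    (P : {measure set T -> \bar R}) (nu : {measure set U -> \bar R}) (X : T -> U) :
  measurable_fun setT X ->
  (forall A, measurable A -> P (X @^-1` A) = nu A) ->
  forall f : U -> \bar R, measurable_fun setT f -> (forall y, (0 <= f y)%E) ->
  (\int[P]_x f (X x) = \int[nu]_y f y)%E.
Proof.
move=> mX PX f mf f0; pose X' : {mfun T >-> U} := mfun_Sub (mem_set mX).
transitivity (\int[pushforward P X']_y f y)%E.
  by rewrite ge0_integral_pushforward.
by apply: eq_measure_integral => A mA _; exact: PX.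
Qed.

Definition gaussian_rv (R : realType) (disp : measure_display)
    (T : measurableType disp) (P : probability T R) (s : R) (X : T -> R) : Prop :=
  measurable_fun setT X /\
  forall A, measurable A -> P (X @^-1` A) = normal_prob 0 s A.

Lemma expR_sub1_le (R : realType) (y : R) : `|expR y - 1| <= `|y| * expR `|y|.
Proof.
have [y0|y0] := leP 0 y.
  rewrite ger0_norm ?(ger0_norm y0); last by rewrite subr_ge0 -expR0 ler_expR.
  have h := expR_ge1Dx (- y); have := expRxMexpNx_1 y; have := expR_gt0 y.
  by nra.
rewrite (ltr0_norm y0) ler0_norm; last by rewrite subr_le0 -expR0 ler_expR ltW.
have h := expR_ge1Dx y; have : 1 <= expR (- y).
  by rewrite -expR0 ler_expR oppr_ge0 ltW.
by nra.
Qed.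

(** The factor exp|y| makes the bound valid for both signs of y. It controls the difference
    quotients behind the Gaussian moments and, later, the exponential weight along a path. *)
Lemma expR_sub1sub_le (R : realType) (y : R) :
  `|expR y - 1 - y| <= y ^+ 2 * expR `|y|.
Proof.
rewrite ger0_norm; last by have := expR_ge1Dx y; lra.
have h1 := expR_ge1Dx y; have h2 := expR_ge1Dx (- y).
have h3 := expRxMexpNx_1 y; have h4 := expR_gt0 y; have h5 := expR_gt0 (- y).
have [y0|y0] := leP 0 y.
  rewrite ger0_norm//.
  have a1 : expR y - 1 <= y * expR y by nra.
  have a2 : y * (expR y - 1) <= y * (y * expR y) by rewrite ler_wpM2l.
  by nra.
rewrite ltr0_norm//.
have a1 : - y * expR y <= 1 - expR y by nra.
have a3 : expR y - 1 - y <= - y * (1 - expR y) by nra.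
have a2 : - y * (1 - expR y) <= - y * - y by apply: ler_wpM2l; lra.
have a4 : 1 <= expR (- y) by lra.
by nra.
Qed.

Section gaussian_moments.
Context (R : realType) (disp : measure_display) (T : measurableType disp).
Variables (P : probability T R) (s : R) (X : T -> R).
Hypothesis s_gt0 : 0 < s.
Hypothesis gX : gaussian_rv P s X.

Let mX : measurable_fun setT X := gX.1.

Lemma gaussian_mgf l :
  (\int[P]_x (expR (l * X x))%:E = (expR (l ^+ 2 * s ^+ 2 / 2))%:E)%E.
Proof.
rewrite -normal_prob_mgf ?gt_eqF//.
have mexp : measurable_fun setT (fun y : R => (expR (l * y))%:E).
  by apply/measurable_EFinP; apply: measurableT_comp => //; exact: mulrl_measurable.
by apply: (integral_law (U := measurableTypeR R) mX gX.2) => // y;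
  rewrite lee_fin expR_ge0.
Qed.

Lemma gaussian_exp_integrable l :
  P.-integrable setT (EFin \o (fun x => expR (l * X x))).
Proof.
apply/integrableP; split.
  apply/measurable_EFinP; apply: measurableT_comp => //.
  exact: measurable_funM.
under eq_integral do rewrite /= ger0_norm ?expR_ge0//.
by rewrite gaussian_mgf ltry.
Qed.

Lemma gaussian_cosh_integrable l : P.-integrable setT
  (EFin \o (fun x => expR (l * X x) + expR (- l * X x))).
Proof.
rewrite (_ : _ \o _ = (EFin \o (fun x => expR (l * X x))) \+
  (EFin \o (fun x => expR (- l * X x))))%E//.
by apply: integrableD => //; exact: gaussian_exp_integrable.
Qed.

Lemma expR_abs_le (x : R) : expR `|x| <= expR x + expR (- x).
Proof.
by case: (ger0P x) => _; rewrite ?lerDl ?lerDr expR_ge0.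
Qed.

Lemma abs_le_expR (x : R) : `|x| <= expR `|x|.
Proof. by rewrite (le_trans _ (expR_ge1Dx _))// lerDr. Qed.

(** Fourth power of y <= exp y at y = |x| / 4, whence 256 = 4^4. *)
Lemma pow4_le_cosh (x : R) : x ^+ 4 <= 256 * (expR x + expR (- x)).
Proof.
apply: (le_trans _ (ler_wpM2l _ (expR_abs_le x))) => //.
have -> : x ^+ 4 = 256 * (`|x / 4| ^+ 4).
  by rewrite -normrX ger0_norm ?exprn_even_ge0//; field.
rewrite ler_wpM2l//.
have -> : expR `|x| = expR `|x / 4| ^+ 4.
  by rewrite -expRM_natl; congr expR; rewrite normrM (ger0_norm (_ : 0 <= 4^-1))//; field.
by rewrite lerXn2r ?nnegrE ?expR_ge0// abs_le_expR.
Qed.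

(** The previous bound at X / s: both exponentials have mean exp(1/2), and 512 is twice 256. What
    counts later is the order s^4, that is, the square of the time step. *)
Lemma gaussian_pow4_le :
  (\int[P]_x ((X x) ^+ 4)%:E <= (512 * expR (1 / 2) * s ^+ 4)%:E)%E.
Proof.
have sn0 : s != 0 by rewrite gt_eqF.
apply: (@le_trans _ _ (\int[P]_x ((256 * s ^+ 4)%:E * 
    (expR (s^-1 * X x) + expR (- s^-1 * X x))%:E))%E).
  apply: ge0_le_integral => //.
  - by move=> x _; rewrite lee_fin exprn_even_ge0.
  - by apply/measurable_EFinP; exact: measurable_funX.
  - apply: measurable_funeM; exact: measurable_int (gaussian_cosh_integrable _).
  - move=> x _; rewrite -EFinM lee_fin mulrAC.
    rewrite (_ : X x ^+ 4 = (s^-1 * X x) ^+ 4 * s ^+ 4); last by field.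
    by rewrite mulNr ler_wpM2r ?pow4_le_cosh// exprn_ge0// ltW.
rewrite integralZl//; last exact: gaussian_cosh_integrable.
under eq_integral do rewrite EFinD.
rewrite ge0_integralD//; try by move=> ? _; rewrite lee_fin expR_ge0.
all: try exact: measurable_int (gaussian_exp_integrable _).
rewrite !gaussian_mgf -EFinD -EFinM lee_fin sqrrN exprVn mulVf ?sqrf_eq0//.
by rewrite le_eqVlt; apply/orP; left; apply/eqP; ring.
Qed.


Lemma gaussian_pow4_integrable :
  P.-integrable setT (EFin \o (fun x => X x ^+ 4)).
Proof.
apply/integrableP; split; first by apply/measurable_EFinP; exact: measurable_funX.
under eq_integral do rewrite /= ger0_norm ?exprn_even_ge0//.
exact: (le_lt_trans gaussian_pow4_le (ltry _)).
Qed.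

Lemma integrable_of_pow4 (f : T -> R) (C : R) : measurable_fun setT f ->
  (forall x, `|f x| <= C + X x ^+ 4) -> P.-integrable setT (EFin \o f).
Proof.
move=> mf fC.
have iC : P.-integrable setT (EFin \o (fun x => C + X x ^+ 4)).
  rewrite (_ : _ \o _ = (EFin \o cst C) \+ (EFin \o (fun x => (X x ^+ 4)%R)))%E//.
  apply: integrableD => //; last exact: gaussian_pow4_integrable.
  exact: finite_measure_integrable_cst.
apply: le_integrable iC => //; first exact/measurable_EFinP.
by move=> x _ /=; rewrite lee_fin (le_trans (fC x))// ler_norm.
Qed.

Lemma abs_le_1pow4 (x : R) : `|x| <= 1 + x ^+ 4.
Proof.
have := sqr_ge0 (x ^+ 2 - 1 / 2); have := sqr_ge0 (x - 1 / 2).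
have := sqr_ge0 (x + 1 / 2).
by case: (ger0P x) => h; rewrite (_ : x ^+ 4 = (x ^+ 2) ^+ 2) ?exprM//; lra.
Qed.

Lemma gaussian_integrable : P.-integrable setT (EFin \o X).
Proof. by apply: integrable_of_pow4 => // x; exact: abs_le_1pow4. Qed.

Lemma sqr_le_1pow4 (x : R) : `|x ^+ 2| <= 1 + x ^+ 4.
Proof.
rewrite ger0_norm ?sqr_ge0//.
have := sqr_ge0 (x ^+ 2 - 1); have := sqr_ge0 x.
have -> : x ^+ 4 = (x ^+ 2) ^+ 2 by ring.
by set y := x ^+ 2; lra.
Qed.

Lemma gaussian_sqr_integrable : P.-integrable setT (EFin \o (fun x => X x ^+ 2)).
Proof.
apply: (@integrable_of_pow4 _ 1); first exact: measurable_funX.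
by move=> x; exact: sqr_le_1pow4.
Qed.

(** Symmetric difference quotient of l -> exp(l x) at 0. Its mean and its mean square are explicit
    by the moment generating function; dominated convergence as l = 1/(n+1) tends to 0 gives those
    of X. *)
Let sh (l x : R) := (expR (l * x) - expR (- l * x)) / (2 * l).

Let sh_bound (l x : R) : 0 < l <= 1 -> `|sh l x| <= expR (2 * `|x|).
Proof.
move=> /andP[l0 l1]; rewrite /sh.
rewrite normrM normfV (gtr0_norm (_ : 0 < 2 * l)) ?mulr_gt0// ler_pdivrMr ?mulr_gt0//.
have e1 := expR_sub1_le (l * x); have e2 := expR_sub1_le (- l * x).
rewrite mulNr normrN normrM (gtr0_norm l0) in e1 e2.
have ll : expR (l * `|x|) <= expR `|x| by rewrite ler_expR ler_piMl.
have xx := abs_le_expR x.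
have -> : expR (l * x) - expR (- l * x) = (expR (l * x) - 1) - (expR (- l * x) - 1) by ring.
apply: (le_trans (ler_normB _ _)); rewrite mulNr.
have -> : expR (2 * `|x|) = expR `|x| * expR `|x| by rewrite -expRD; congr expR; ring.
have : `|x| * expR (l * `|x|) <= expR `|x| * expR `|x|.
  by rewrite ler_pM ?expR_ge0.
move=> h.
apply: (le_trans (lerD e1 e2)).
have -> : l * `|x| * expR (l * `|x|) + l * `|x| * expR (l * `|x|) =
  `|x| * expR (l * `|x|) * (2 * l) by ring.
by rewrite ler_wpM2r// mulr_ge0// ltW.
Qed.

Let sh_dist (l x : R) : 0 < l <= 1 -> `|sh l x - x| <= l * (x ^+ 2 * expR `|x|).
Proof.
move=> /andP[l0 l1]; rewrite /sh.
have e1 := expR_sub1sub_le (l * x); have e2 := expR_sub1sub_le (- l * x).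
rewrite !mulNr !normrN !sqrrN normrM (gtr0_norm l0) in e1 e2 *.
have ll : expR (l * `|x|) <= expR `|x| by rewrite ler_expR ler_piMl.
have -> : (expR (l * x) - expR (- (l * x))) / (2 * l) - x =
  ((expR (l * x) - 1 - l * x) - (expR (- (l * x)) - 1 - - (l * x))) / (2 * l).
  by field; rewrite gt_eqF.
rewrite normrM normfV (gtr0_norm (_ : 0 < 2 * l)) ?mulr_gt0// ler_pdivrMr ?mulr_gt0//.
apply: (le_trans (ler_normB _ _)).
apply: (le_trans (lerD e1 e2)).
have : (l * x) ^+ 2 * expR (l * `|x|) <= (l * x) ^+ 2 * expR `|x|.
  by rewrite ler_wpM2l// sqr_ge0.
move=> h; apply: (le_trans (lerD h h)).
by rewrite le_eqVlt; apply/orP; left; apply/eqP; ring.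
Qed.

Let ln_ (n : nat) : R := n.+1%:R^-1.

Let ln_01 n : 0 < ln_ n <= 1.
Proof. by rewrite invr_gt0 ltr0n/= invf_le1 ?ler1n ?ltr0n. Qed.

Let cvg_of_dist (u : nat -> R) (l C : R) :
  (forall n, `|u n - l| <= ln_ n * C) -> u @ \oo --> l.
Proof.
move=> h; apply/cvgrPdist_le => e e0.
have C0 : (fun n => ln_ n * C) @ \oo --> (0 : R).
  rewrite -[X in _ --> X](mul0r C); apply: cvgM; last exact: cvg_cst.
  exact: cvg_harmonic.
have /cvgrPdist_le/(_ _ e0) := C0; apply: filterS => n; rewrite sub0r normrN => hn.
by rewrite distrC (le_trans (h n))// (le_trans (ler_norm _)).
Qed.

Let sh_cvg x : (fun n => sh (ln_ n) x) @ \oo --> x.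
Proof. by apply: cvg_of_dist => n; exact: sh_dist. Qed.

Let msh l : measurable_fun setT (fun x => sh l (X x)).
Proof.
apply: measurable_funM => //; apply: measurable_funB;
  by apply: measurableT_comp => //; exact: measurable_funM.
Qed.

Lemma gaussian_mean : (\int[P]_x (X x)%:E = 0)%E.
Proof.
have i2 := gaussian_cosh_integrable 2.
have : (\int[P]_x (sh (ln_ n) (X x))%:E @[n --> \oo] --> \int[P]_x (X x)%:E)%E.
  apply: (@dominated_cvg _ _ _ P setT measurableT _ _
    (EFin \o (fun x => expR (2 * X x) + expR (- 2 * X x)))) => //.
  - by move=> n; apply/measurable_EFinP; exact: msh.
  - move=> x _; apply: cvg_EFin; last exact: sh_cvg.
    by near=> n.
  - move=> n x _; rewrite /= lee_fin (le_trans (sh_bound _ (ln_01 n)))//.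
    have -> : 2 * `|X x| = `|2 * X x| by rewrite normrM gtr0_norm.
    by rewrite mulNr expR_abs_le.
have z k : (\int[P]_x (sh (ln_ k) (X x))%:E = 0)%E.
  rewrite /sh; under eq_integral do rewrite EFinM EFinB.
  have iE := gaussian_exp_integrable.
  rewrite integralZr//; last by apply: integrableB => //; exact: iE.
  rewrite integralB//; try exact: iE.
  by rewrite !gaussian_mgf sqrrN subee// mul0e.
under eq_fun do rewrite z.
by move/cvg_lim => <-//; apply/cvg_lim => //; exact: cvg_cst.
Unshelve. all: by end_near. Qed.

Lemma gaussian_variance : (\int[P]_x (X x ^+ 2)%:E = (s ^+ 2)%:E)%E.
Proof.
have i4 := gaussian_cosh_integrable 4.
have : (\int[P]_x (sh (ln_ n) (X x) ^+ 2)%:E @[n --> \oo] --> \int[P]_x (X x ^+ 2)%:E)%E.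
  apply: (@dominated_cvg _ _ _ P setT measurableT _ _
    (EFin \o (fun x => expR (4 * X x) + expR (- 4 * X x)))) => //.
  - by move=> n; apply/measurable_EFinP; apply: measurable_funX; exact: msh.
  - move=> x _; apply: cvg_EFin; last first.
      by rewrite expr2; under eq_fun do rewrite expr2; apply: cvgM; exact: sh_cvg.
    by near=> n.
  - move=> n x _; rewrite /= lee_fin normrX.
    apply: (@le_trans _ _ (expR (2 * `|X x|) ^+ 2)).
      by rewrite lerXn2r ?nnegrE ?expR_ge0// sh_bound.
    have -> : expR (2 * `|X x|) ^+ 2 = expR `|4 * X x|.
      by rewrite -expRM_natl normrM gtr0_norm//; congr expR; ring.
    by rewrite mulNr expR_abs_le.
have z k : (\int[P]_x (sh (ln_ k) (X x) ^+ 2)%:E =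
    ((expR (2 * ln_ k ^+ 2 * s ^+ 2) - 1) / (2 * ln_ k ^+ 2))%:E)%E.
  have ln0 : ln_ k != 0 by case/andP: (ln_01 k) => h _; rewrite gt_eqF.
  have iE := gaussian_exp_integrable.
  (* In the square of the quotient the cross term is the constant 2, since exp(l x) exp(-l x) =
     1. *)
  transitivity (\int[P]_x (((expR (2 * ln_ k * X x))%:E +
     (expR (- (2 * ln_ k) * X x))%:E - 2%:E) * ((4 * ln_ k ^+ 2)^-1)%:E))%E.
    apply: eq_integral => x _; rewrite -!(EFinD, EFinN, EFinM); congr EFin.
    have -> : expR (2 * ln_ k * X x) = expR (ln_ k * X x) ^+ 2.
      by rewrite -expRM_natl; congr expR; ring.
    have -> : expR (- (2 * ln_ k) * X x) = expR (- ln_ k * X x) ^+ 2.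
      by rewrite -expRM_natl; congr expR; ring.
    have := expRxMexpNx_1 (ln_ k * X x); rewrite -mulNr => h.
    rewrite /sh; move: h; set a := expR _; set b := expR _ => h.
    have -> : a ^+ 2 + b ^+ 2 - 2 = (a - b) ^+ 2 by rewrite sqrrB h; ring.
    by field.
  have i1 : P.-integrable setT (fun x => (expR (2 * ln_ k * X x))%:E +
     (expR (- (2 * ln_ k) * X x))%:E)%E by exact: integrableD (iE _) (iE _).
  have i3 : P.-integrable setT (fun=> 2%:E : \bar R).
    exact: finite_measure_integrable_cst.
  rewrite integralZr//; last exact: integrableB.
  rewrite integralB// integralD//; try exact: iE.
  rewrite integral_cst//.
  rewrite [X in (_ - _ * X)%E]probability_setT mule1 !gaussian_mgf -!(EFinD, EFinN, EFinM).
  congr EFin; rewrite sqrrN.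
  have -> : (2 * ln_ k) ^+ 2 * s ^+ 2 / 2 = 2 * ln_ k ^+ 2 * s ^+ 2 by field.
  by field.
under eq_fun do rewrite z.
move/cvg_lim => <-//; apply/cvg_lim => //; apply: cvg_EFin; first by near=> n.
(* The quadratic remainder at y = 2 l^2 s^2, divided by 2 l^2, is at most 2 l^2 s^4 exp(2 s^2); one
   factor l <= 1 is then dropped. *)
apply: (@cvg_of_dist _ _ (2 * s ^+ 4 * expR (2 * s ^+ 2))) => n.
have /andP[l0 l1] := ln_01 n.
have -> : (expR (2 * ln_ n ^+ 2 * s ^+ 2) - 1) / (2 * ln_ n ^+ 2) - s ^+ 2 =
   (expR (2 * ln_ n ^+ 2 * s ^+ 2) - 1 - 2 * ln_ n ^+ 2 * s ^+ 2) / (2 * ln_ n ^+ 2).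
  by field; rewrite gt_eqF.
have l2 : 0 < 2 * ln_ n ^+ 2 by rewrite mulr_gt0// exprn_gt0.
rewrite normrM normfV (gtr0_norm l2) ler_pdivrMr//.
apply: (le_trans (expR_sub1sub_le _)).
rewrite ger0_norm; last by rewrite mulr_ge0 ?ltW// exprn_gt0.
have ss : expR (2 * ln_ n ^+ 2 * s ^+ 2) <= expR (2 * s ^+ 2).
  rewrite ler_expR ler_wpM2r ?sqr_ge0//; nra.
apply: (@le_trans _ _ ((2 * ln_ n ^+ 2 * s ^+ 2) ^+ 2 * expR (2 * s ^+ 2))).
  by rewrite ler_wpM2l// sqr_ge0.
have -> : (2 * ln_ n ^+ 2 * s ^+ 2) ^+ 2 * expR (2 * s ^+ 2) =
  (4 * s ^+ 4 * ln_ n ^+ 3 * expR (2 * s ^+ 2)) * ln_ n by ring.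
have -> : ln_ n * (2 * s ^+ 4 * expR (2 * s ^+ 2)) * (2 * ln_ n ^+ 2) =
  (4 * s ^+ 4 * ln_ n ^+ 3 * expR (2 * s ^+ 2)) * 1 by ring.
rewrite ler_wpM2l// !mulr_ge0 ?expR_ge0 ?exprn_ge0 ?ltW//.
Unshelve. all: by end_near. Qed.

End gaussian_moments.

(** * Independence *)

Definition indep_sets (R : realType) d (T : measurableType d) (P : probability T R)
    d1 d2 (T1 : measurableType d1) (T2 : measurableType d2) (X : T -> T1) (Y : T -> T2) :=
  forall A B, measurable A -> measurable B ->
    P (X @^-1` A `&` Y @^-1` B) = (P (X @^-1` A) * P (Y @^-1` B))%E.

Section independence.
Context (R : realType) d (T : measurableType d) (P : probability T R).

(** Rectangles determine a product measure, and independence is the product formula on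
    rectangles. *)
Lemma indep_pair_law (d1 d2 : measure_display) (T1 : measurableType d1)
    (T2 : measurableType d2) (X : {mfun T >-> T1}) (Y : {mfun T >-> T2}) :
  indep_sets P X Y ->
  forall A, measurable A ->
    P ((fun x => (X x, Y x)) @^-1` A) = (distribution P X \x distribution P Y)%E A.
Proof.
move=> XY A mA.
have mXY : measurable_fun setT (fun x => (X x, Y x)).
  by apply/measurable_fun_pairP; split; exact: measurable_funP.
pose Z : {mfun T >-> (T1 * T2)%type} := mfun_Sub (mem_set mXY).
rewrite (@product_measure_unique _ _ T1 T2 R (distribution P X) (distribution P Y)
  (distribution P Z)) => // B C mB mC; exact: XY.
Qed.

(** Under the product law, Tonelli for |x y| gives integrability and Fubini then factors the
    mean. *)
Lemma indep_integrable_mul (X Y : T -> R) :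
  measurable_fun setT X -> measurable_fun setT Y -> indep_sets P X Y ->
  P.-integrable setT (EFin \o X) -> P.-integrable setT (EFin \o Y) ->
  P.-integrable setT (EFin \o (fun x => X x * Y x)) /\
  (\int[P]_x (X x * Y x)%:E = \int[P]_x (X x)%:E * \int[P]_x (Y x)%:E)%E.
Proof.
move=> mX mY XY iX iY.
pose X' : {mfun T >-> R} := mfun_Sub (mem_set mX).
pose Y' : {mfun T >-> R} := mfun_Sub (mem_set mY).
have law := @indep_pair_law _ _ _ _ X' Y' XY.
have mXY : measurable_fun setT (fun x => (X x, Y x)).
  by apply/measurable_fun_pairP; split.
pose Z : {mfun T >-> (R * R)%type} := mfun_Sub (mem_set mXY).
have mf : measurable_fun setT (fun z : R * R => (z.1 * z.2)%:E).
  by apply/measurable_EFinP; apply: measurable_funM.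
have mabs : measurable_fun setT (fun y : R => `|y|%:E).
  by apply/measurable_EFinP; exact: normr_measurable.
have finabs (V : {mfun T >-> R}) : P.-integrable setT (EFin \o V) ->
    (\int[distribution P V]_y `|y|%:E < +oo)%E.
  move=> /integrableP[_]; rewrite ge0_integral_distribution//.
have mid : measurable_fun setT (fun y : R => y%:E) by exact/measurable_EFinP.
have fini (V : {mfun T >-> R}) : P.-integrable setT (EFin \o V) ->
    (distribution P V).-integrable setT (fun y : R => y%:E).
  by move=> iV; apply/integrableP; split=> //; exact: finabs.
have iprod : (distribution P X' \x distribution P Y')%E.-integrable setT
    (fun z : R * R => (z.1 * z.2)%:E).
  apply/integrable12ltyP => //=.
  under eq_integral => x _.
    under eq_integral do rewrite normrM EFinM.
    rewrite ge0_integralZl//.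
    over.
  rewrite ge0_integralZr//; last by apply: integral_ge0 => y _; rewrite lee_fin.
  by rewrite lte_mul_pinfty// ?finabs//; [exact: integral_ge0 | 
     rewrite ge0_fin_numE ?finabs//; exact: integral_ge0].
have iXY : P.-integrable setT (EFin \o (fun x => X x * Y x)).
  apply/integrableP; split; first by apply/measurable_EFinP; exact: measurable_funM.
  have /integrableP[_] := iprod.
  rewrite -(integral_law mXY law); first by [].
    exact: measurableT_comp.
  by move=> y; exact: abse_ge0.
split=> //.
transitivity (\int[distribution P X' \x distribution P Y']_z (z.1 * z.2)%:E)%E.
  rewrite -(integral_distribution (X := Z) mf iXY).
  by apply: eq_measure_integral => A mA _; exact: law.
rewrite -integral12_prod_meas1//= /fubini_F/=.
under eq_integral => x _.
  under eq_integral do rewrite EFinM.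
  rewrite integralZl//; last exact: fini.
  over.
have fn : (\int[distribution P Y']_y y%:E)%E \is a fin_num.
  by apply: integrable_fin_num => //; exact: fini.
rewrite -(fineK fn) integralZr//; last exact: fini.
by rewrite fineK// !integral_distribution.
Qed.

(** For a fixed event {Z in C}, consider two finite measures on pairs: the law of (X, Y) restricted
    to the event, and that law scaled by the probability of the event. They agree on rectangles with
    the product of the law of X and the scaled law of Y, hence everywhere, in particular on {x y in
    A}. Used for a variable of the past times one coordinate of the noise, against another
    coordinate. *)
Lemma indep_mul3 (X Y Z : T -> R) :
  measurable_fun setT X -> measurable_fun setT Y -> measurable_fun setT Z ->
  (forall A B C, measurable A -> measurable B -> measurable C ->
     P (X @^-1` A `&` (Y @^-1` B `&` Z @^-1` C)) =
     (P (X @^-1` A) * (P (Y @^-1` B) * P (Z @^-1` C)))%E) ->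
  indep_sets P (fun x => X x * Y x) Z.
Proof.
move=> mX mY mZ XYZ A C mA mC.
have XY : indep_sets P X Y.
  move=> A' B' mA' mB'; have := XYZ A' B' setT mA' mB' measurableT.
  by rewrite preimage_setT setIT probability_setT mule1.
pose X' : {mfun T >-> R} := mfun_Sub (mem_set mX).
pose Y' : {mfun T >-> R} := mfun_Sub (mem_set mY).
have mXY : measurable_fun setT (fun x => (X x, Y x)).
  by apply/measurable_fun_pairP; split.
have mD : measurable (Z @^-1` C) by rewrite -[_ @^-1` _]setTI; exact: mZ.
have mprod : measurable_fun setT (fun z : R * R => z.1 * z.2) by exact: measurable_funM.
have mA' : measurable ((fun z : R * R => z.1 * z.2) @^-1` A).
  by rewrite -[_ @^-1` _]setTI; exact: mprod.
pose c : {nonneg R} := NngNum (fine_ge0 (measure_ge0 P (Z @^-1` C))).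
have cE : (c%:num%:E = P (Z @^-1` C))%E by rewrite /= fineK// fin_num_measure.
pose m2 := mscale c (distribution P Y').
have u (m : {measure set (R * R) -> \bar R}) :
    (forall A B, measurable A -> measurable B -> m (A `*` B) = (distribution P X' A * m2 B)%E) ->
    m ((fun z : R * R => z.1 * z.2) @^-1` A) =
    (distribution P X' \x m2)%E ((fun z : R * R => z.1 * z.2) @^-1` A).
  by move=> h; rewrite -(product_measure_unique h).
pose V : {mfun T >-> (R * R)%type} := mfun_Sub (mem_set mXY).
have h1 := u (pushforward (mrestr P mD) V).
have h2 := u (mscale c (distribution P V)).
transitivity (pushforward (mrestr P mD) V ((fun z : R * R => z.1 * z.2) @^-1` A)).
  by [].
rewrite h1; last first.
  move=> A1 B1 mA1 mB1; rewrite /pushforward /mrestr /m2 /mscale /= cE.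
  transitivity (P (X @^-1` A1 `&` (Y @^-1` B1 `&` Z @^-1` C))).
    by rewrite setIA.
  by rewrite XYZ//; congr (_ * _)%E; exact: muleC.
rewrite -h2; last first.
  move=> A1 B1 mA1 mB1; rewrite /m2 /mscale /= muleCA; congr (_ * _)%E.
  exact: XY.
by rewrite -cE muleC.
Qed.

End independence.

(** * Continuous paths and time integrals *)

Section uniform_continuity.
Context (R : realType).

Definition ucont (T : pseudoMetricType R) (a b : R) (f : R -> T) : Prop :=
  forall e : R, 0 < e -> exists2 del : R, 0 < del &
    forall r s, a <= r <= b -> a <= s <= b -> `|r - s| < del -> ball (f s) e (f r).

(** Compactness of the segment makes the radius uniform along the curve, also for points z off the
    curve. Such points arise as intermediate points of Taylor expansions. *)
Lemma ucont_along (T : pseudoMetricType R) (V : pseudoMetricType R) (a b : R)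
    (g : R -> T) (F : T -> V) :
  {within `[a, b], continuous g} ->
  (forall s, a <= s <= b -> {for g s, continuous F}) ->
  forall e : R, 0 < e -> exists2 del : R, 0 < del &
    forall s z, a <= s <= b -> ball (g s) del z -> ball (F (g s)) e (F z).
Proof.
move=> cg cF e e0.
have /compact_near_coveringP/near_covering_withinP := @segment_compact R a b.
move=> /(_ R 0^'+ (fun del s => forall z, ball (g s) del z -> ball (F (g s)) e (F z)) _).
have cov : forall x, `[a, b]%classic x -> \forall x' \near x & i \near 0^'+,
    `[a, b]%classic x' -> forall z, ball (g x') i z -> ball (F (g x')) e (F z).
  move=> x xab.
  have xab' : a <= x <= b by move: xab => /=; rewrite in_itv.
  have e2 : 0 < e / 2 by rewrite divr_gt0.
  have [del /= del0 hdel] : exists2 del : R, 0 < del &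
      forall z, ball (g x) del z -> ball (F (g x)) (e / 2) (F z).
    have /nbhs_ballP[del /= del0 hdel] :
      nbhs (g x) [set z | ball (F (g x)) (e / 2) (F z)].
      by apply: (cF _ xab'); exact: nbhsx_ballx.
    by exists del.
  have near1 : \forall x' \near x, `[a, b]%classic x' -> ball (g x) (del / 2) (g x').
    have := (iffLR (subspace_continuousP _ _) cg x xab).
    move=> /(_ [set y | ball (g x) (del / 2) y]); apply.
    by apply: nbhsx_ballx; rewrite divr_gt0.
  have near2 : \forall i \near 0^'+, i <= del / 2.
    by apply: nbhs_right_le; rewrite divr_gt0.
  exists ([set x' | `[a, b]%classic x' -> ball (g x) (del / 2) (g x')], [set i | i <= del / 2]) => //=.
  move=> [x' i] /= [h1 h2] /h1 bx' z bz.
  have b1 : ball (g x) del (g x').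
    by apply: le_ball bx'; lra.
  have b2 : ball (g x) del z.
    rewrite (splitr del); apply: (ball_triangle bx').
    exact: (le_ball h2).
  rewrite (splitr e); apply: (@ball_triangle _ _ (F (g x))).
    by apply: ball_sym; exact: hdel.
  exact: hdel.
move=> /(_ cov) near0.
have [i [i0 hi]] : exists i : R, 0 < i /\ (`[a, b]%classic `<=`
    (fun s => forall z, ball (g s) i z -> ball (F (g s)) e (F z))).
  near (0 : R)^'+ => i; exists i; split; first by near: i; exact: nbhs_right_gt.
  by near: i.
exists i => // s z sab; apply: hi; by rewrite /= in_itv.
Unshelve. all: by end_near. Qed.

Lemma ucont_within (T : pseudoMetricType R) (a b : R) (f : R -> T) :
  {within `[a, b], continuous f} -> ucont a b f.
Proof.
move=> cf e e0.
have /compact_near_coveringP/near_covering_withinP := @segment_compact R a b.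
move=> /(_ R 0^'+ (fun del s => forall r, a <= r <= b -> `|r - s| < del -> ball (f s) e (f r)) _).
have cov : forall x, `[a, b]%classic x -> \forall x' \near x & i \near 0^'+,
    `[a, b]%classic x' -> forall r, a <= r <= b -> `|r - x'| < i -> ball (f x') e (f r).
  move=> x xab.
  have e2 : 0 < e / 2 by rewrite divr_gt0.
  have : \forall x' \near x, `[a, b]%classic x' -> ball (f x) (e / 2) (f x').
    have := (iffLR (subspace_continuousP _ _) cf x xab).
    move=> /(_ [set y | ball (f x) (e / 2) y]); apply.
    exact: nbhsx_ballx.
  move=> /nbhs_ballP[del /= del0 hdel].
  exists (ball x (del / 2), [set i | i <= del / 2]) => /=.
    by split; [apply: nbhsx_ballx; rewrite divr_gt0|apply: nbhs_right_le; rewrite divr_gt0].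
  move=> [x' i] /= [h1 h2] x'ab r rab ri.
  rewrite (splitr e); apply: (@ball_triangle _ _ (f x)).
    apply: ball_sym; apply: hdel => //.
    by apply: le_ball h1; lra.
  apply: hdel; last by rewrite /= in_itv.
  rewrite (splitr del); apply: (ball_triangle h1).
  rewrite /ball/= distrC (lt_le_trans ri)//.
move=> /(_ cov) near0.
near (0 : R)^'+ => i; exists i; first by near: i; exact: nbhs_right_gt.
move=> r s rab sab rs.
have hi : (`[a, b]%classic `<=`
    (fun s => forall r, a <= r <= b -> `|r - s| < i -> ball (f s) e (f r))) by near: i.
by apply: hi => //; rewrite /= in_itv.
Unshelve. all: by end_near. Qed.

Lemma within_ucont (T : pseudoMetricType R) (a b : R) (f : R -> T) :
  ucont a b f -> {within `[a, b], continuous f}.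
Proof.
move=> uf; apply/subspace_continuousP => x xab A /nbhs_ballP[e /= e0 eA].
have [del del0 hdel] := uf e e0.
exists del => // y /= xy yab; apply: eA; apply: hdel.
- by move: yab; rewrite /= in_itv.
- by move: xab; rewrite /= in_itv.
- by rewrite distrC.
Qed.

Lemma within_bounded (a b : R) (f : R -> R) : {within `[a, b], continuous f} ->
  exists2 C : R, 0 < C & forall s, a <= s <= b -> `|f s| <= C.
Proof.
move=> cf; have [ab|ba] := leP a b; last first.
  by exists 1 => // s /andP[as_ sb]; have := le_trans as_ sb; rewrite leNgt ba.
have cn : {within `[a, b], continuous (fun s => `|f s|)}.
  by move=> x; apply: cvg_norm; exact: cf.
have [c cab hc] := EVT_max ab cn.
exists (`|f c| + 1) => [|s sab]; first by rewrite ltr_wpDl.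
by rewrite (le_trans (hc s _)) ?in_itv// lerDl.
Qed.

End uniform_continuity.

Section time_integrals.
Context (R : realType).
Local Notation mu := (@lebesgue_measure R).

Definition tint (a b : R) (f : R -> R) : R := (\int[mu]_(r in `[a, b]) f r)%R.

Definition tintegrable (a b : R) (f : R -> R) := mu.-integrable `[a, b] (EFin \o f).

Lemma within_tintegrable (a b : R) (f : R -> R) :
  {within `[a, b], continuous f} -> tintegrable a b f.
Proof. by apply: continuous_compact_integrable; exact: segment_compact. Qed.

Lemma within_sub (V : pseudoMetricType R) (a b c d : R) (f : R -> V) : a <= c -> d <= b ->
  {within `[a, b], continuous f} -> {within `[c, d], continuous f}.
Proof.
move=> ac db; apply: continuous_subspaceW => x /=; rewrite !in_itv/= => /andP[cx xd].
by rewrite (le_trans ac cx) (le_trans xd db).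
Qed.

Lemma tint_split (a b c : R) (f : R -> R) : a <= b -> b <= c ->
  {within `[a, c], continuous f} -> tint a c f = tint a b f + tint b c f.
Proof.
move=> ab bc cf; apply/eqP; rewrite addrC -subr_eq; apply/eqP; rewrite /tint.
rewrite (@Rintegral_itvB _ f (BLeft a) (BRight c) b) ?bnd_simp//.
  rewrite Rintegral_itv_obnd_cbnd//; apply: (@integrableS _ _ _ mu `[a, c]) => //.
    by move=> x /=; rewrite !in_itv/= => /andP[bx ->]; rewrite (le_trans ab)// ltW.
  exact: within_tintegrable.
exact: within_tintegrable.
Qed.

Lemma tint_self (a : R) (f : R -> R) : tint a a f = 0.
Proof. by rewrite /tint set_itv1 Rintegral_set1. Qed.

Lemma tint_cst (a b c : R) : a <= b -> tint a b (fun=> c) = c * (b - a).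
Proof.
by move=> ab; rewrite /tint Rintegral_cst//= lebesgue_measure_itv/= lte_fin;
  have [ba|ba] := ltP a b; rewrite //= (_ : a = b) ?subrr//; apply/eqP; rewrite eq_le ab ba.
Qed.

Lemma tint_bound (a b C : R) (f : R -> R) : a <= b ->
  {within `[a, b], continuous f} -> (forall r, a <= r <= b -> `|f r| <= C) ->
  `|tint a b f| <= C * (b - a).
Proof.
move=> ab cf fC; rewrite -tint_cst//.
apply: (le_trans (le_normr_Rintegral _ _)) => //; first exact: within_tintegrable.
apply: le_Rintegral => //.
- by apply: within_tintegrable => x; apply: cvg_norm; exact: cf.
- by apply: within_tintegrable => x; exact: cvg_cst.
Qed.

Lemma tintD (a b : R) (f g : R -> R) : 
  {within `[a, b], continuous f} -> {within `[a, b], continuous g} ->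
  tint a b (fun r => f r + g r) = tint a b f + tint a b g.
Proof.
by move=> cf cg; rewrite /tint RintegralD//; exact: within_tintegrable.
Qed.

Lemma tintB (a b : R) (f g : R -> R) : 
  {within `[a, b], continuous f} -> {within `[a, b], continuous g} ->
  tint a b (fun r => f r - g r) = tint a b f - tint a b g.
Proof.
by move=> cf cg; rewrite /tint RintegralB//; exact: within_tintegrable.
Qed.

Lemma tintZl (a b c : R) (f : R -> R) : {within `[a, b], continuous f} ->
  tint a b (fun r => c * f r) = c * tint a b f.
Proof. by move=> cf; rewrite /tint RintegralZl//; exact: within_tintegrable. Qed.

Lemma tint_dist (a b c e : R) (f : R -> R) : a <= b ->
  {within `[a, b], continuous f} -> (forall r, a <= r <= b -> `|f r - c| <= e) ->
  `|tint a b f - c * (b - a)| <= e * (b - a).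
Proof.
move=> ab cf fC; rewrite -tint_cst// -tintB//; last by move=> x; exact: cvg_cst.
apply: tint_bound => // x; apply: cvgB; [exact: cf|exact: cvg_cst].
Qed.

Lemma tint_sum_mono (x : nat -> R) (N : nat) (f : R -> R) :
  (forall i, (i < N)%N -> x i <= x i.+1) ->
  {within `[x 0%N, x N], continuous f} ->
  tint (x 0%N) (x N) f = \sum_(0 <= i < N) tint (x i) (x i.+1) f.
Proof.
elim: N => [|N IH] hx cf; first by rewrite big_geq// tint_self.
have x0N : x 0%N <= x N.
  elim: N hx {IH cf} => // N IH hx; apply: le_trans (IH _) (hx _ _) => // i iN.
  by apply: hx; rewrite ltnS ltnW.
rewrite big_nat_recr//= -IH.
- by apply: tint_split => //; exact: hx.
- by move=> i iN; apply: hx; rewrite ltnS ltnW.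
- by apply: within_sub cf => //; exact: hx.
Qed.

Lemma within_tint (a b : R) (f : R -> R) : {within `[a, b], continuous f} ->
  {within `[a, b], continuous (fun s => tint s b f)}.
Proof.
move=> cf; apply: within_ucont => e e0.
have [C C0 hC] := within_bounded cf.
exists (e / (C + 1)); first by rewrite divr_gt0// ltr_wpDr// ltW.
have key r s : a <= r -> r <= s -> s <= b -> s - r < e / (C + 1) ->
    `|tint r b f - tint s b f| < e.
  move=> ar rs sb sr; rewrite (@tint_split r s b)//; last exact: within_sub cf.
  rewrite addrK; apply: (@le_lt_trans _ _ (C * (s - r))).
    apply: tint_bound => //; first exact: within_sub cf.
    by move=> u /andP[ru us]; apply: hC; rewrite (le_trans ar ru) (le_trans us sb).
  move: sr; rewrite ltr_pdivlMr; last by rewrite ltr_wpDr// ltW.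
  by move=> ?; nra.
move=> r s /andP[ar rb] /andP[as_ sb] rs; rewrite /ball/=.
have [h|h] := leP r s.
  by rewrite distrC; apply: key => //; rewrite distrC ger0_norm ?subr_ge0// in rs.
by apply: key => //; [exact: ltW|rewrite gtr0_norm ?subr_gt0// in rs].
Qed.

Definition ugrid (a b : R) (N i : nat) : R := a + i%:R * ((b - a) / N%:R).

Lemma ugrid0 a b N : ugrid a b N 0 = a.
Proof. by rewrite /ugrid mul0r addr0. Qed.

Lemma ugridN a b N : (0 < N)%N -> ugrid a b N N = b.
Proof.
by move=> N0; rewrite /ugrid mulrC divfK ?pnatr_eq0 -?lt0n// addrCA subrr addr0.
Qed.

Lemma ugridS a b N i : ugrid a b N i.+1 - ugrid a b N i = (b - a) / N%:R.
Proof. by rewrite /ugrid -natr1; ring. Qed.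

Lemma ugrid_le a b N i j : a <= b -> (i <= j)%N -> ugrid a b N i <= ugrid a b N j.
Proof.
move=> ab ij; rewrite /ugrid lerD2l ler_wpM2r ?ler_nat//.
by rewrite divr_ge0 ?subr_ge0.
Qed.

Lemma ugrid_in a b N i : a <= b -> (i <= N)%N -> (0 < N)%N -> a <= ugrid a b N i <= b.
Proof.
move=> ab iN N0; rewrite -{1}(ugrid0 a b N) ugrid_le//=.
by rewrite -{2}(@ugridN a b N)// ugrid_le.
Qed.

Lemma mesh_lt (a b del : R) : 0 < del -> \forall N \near \oo,
  (0 < N)%N /\ (b - a) / N%:R < del.
Proof.
move=> del0; exists (Num.trunc (`|b - a| / del)).+1 => // N /= hN.
have N0 : (0 < N)%N by exact: leq_trans hN.
split=> //; rewrite ltr_pdivrMr ?ltr0n// mulrC -ltr_pdivrMr//.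
apply: (@le_lt_trans _ _ (`|b - a| / del)).
  by rewrite ler_pM2r ?invr_gt0// ler_norm.
apply: (lt_le_trans (truncnS_gt _)); by rewrite ler_nat.
Qed.

Lemma riemann_cvg (a b : R) (f : R -> R) : a <= b ->
  {within `[a, b], continuous f} ->
  (fun N => \sum_(0 <= i < N) (b - a) / N%:R * f (ugrid a b N i)) @ \oo --> tint a b f.
Proof.
move=> ab cf; apply/cvgrPdist_le => e e0.
(* The [+ 1] keeps the divisor positive when a = b. *)
have e1 : 0 < e / (b - a + 1) by rewrite divr_gt0// ltr_wpDl// subr_ge0.
have [del del0 hdel] := ucont_within cf e1.
apply: filterS (mesh_lt a b del0) => N [N0 hN].
have mono i : (i < N)%N -> ugrid a b N i <= ugrid a b N i.+1 by move=> _; exact: ugrid_le.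
rewrite -[X in tint X](ugrid0 a b N) -[X in tint _ X](ugridN a b N0) tint_sum_mono//; last first.
  by rewrite ugrid0 ugridN.
rewrite -sumrB; apply: (le_trans (ler_norm_sum _ _ _)).
apply: (@le_trans _ _ (\sum_(0 <= i < N) e / (b - a + 1) * ((b - a) / N%:R))).
  apply: ler_sum_nat => i /andP[_ iN].
  have /andP[ai _] := ugrid_in ab (ltnW iN) N0.
  have /andP[_ bi] := ugrid_in ab iN N0.
  rewrite [(b - a) / N%:R * _]mulrC -(ugridS a b N i).
  apply: tint_dist; first exact: mono.
    exact: within_sub cf.
  move=> r /andP[r1 r2]; apply: ltW; rewrite distrC.
  apply: hdel; rewrite ?(le_trans ai r1) ?(le_trans r2 bi)//.
    exact: ugrid_in ab (ltnW iN) N0.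
  rewrite ger0_norm ?subr_ge0//; apply: le_lt_trans hN.
  by rewrite -(ugridS a b N i) lerD2r.
rewrite sumr_const_nat subn0 -[_ *+ N]mulr_natr.
have -> : e / (b - a + 1) * ((b - a) / N%:R) * N%:R = e * ((b - a) / (b - a + 1)).
  by field; rewrite pnatr_eq0 -lt0n N0/= gt_eqF// ltr_wpDl// subr_ge0.
rewrite ger_pMr// ler_pdivrMr ?ltr_wpDl ?subr_ge0//.
by rewrite mul1r lerDl.
Qed.

End time_integrals.

(** * Measurability of continuous functionals and of time integrals *)

Section measurability.
Context (R : realType) (disp : measure_display) (Om : measurableType disp).

(* A random variable that is a pointwise limit of countably valued ones composes with
   continuous functions without any Borel structure on its codomain. *)
Lemma measurable_countable_approx (C : countType) (E : topologicalType)
    (c : nat -> Om -> C) (g : nat -> C -> E) (f : E -> R) (X : Om -> E) :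
  (forall n z, measurable [set om | c n om = z]) ->
  (forall om, (fun n => g n (c n om)) @ \oo --> X om) ->
  (forall om, {for X om, continuous f}) ->
  measurable_fun setT (fun om => f (X om)).
Proof.
move=> mc gX cf.
apply: (@measurable_fun_cvg _ _ _ setT (fun n om => f (g n (c n om)))).
  move=> n _ A mA; rewrite setTI.
  have -> : (fun om => f (g n (c n om))) @^-1` A =
      \bigcup_(z in [set z | A (f (g n z))]) [set om | c n om = z].
    apply/seteqP; split=> [om /= Aom|om [z /= Az]]; last by move=> /= ->.
    by exists (c n om).
  rewrite bigcup_mkcond; apply: countable_bigcupT_measurable => // z.
  by case: ifPn.
move=> om _; exact: cvg_comp (gX om) (cf om).
Qed.

Definition rvec (d : nat) (X : Om -> 'rV[R]_d) : Prop :=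
  forall k : 'I_d, measurable_fun setT (fun om => X om 0 k).

Definition vfloor (d : nat) (n : nat) (v : 'rV[R]_d) : 'rV[int]_d :=
  \row_k Num.floor (n.+1%:R * v 0 k).

Definition vgrid (d : nat) (n : nat) (z : 'rV[int]_d) : 'rV[R]_d :=
  \row_k ((z 0 k)%:~R / n.+1%:R).

Lemma vfloor_fiber d (X : Om -> 'rV[R]_d) n z : rvec X ->
  measurable [set om | vfloor n (X om) = z].
Proof.
move=> mX.
have -> : [set om | vfloor n (X om) = z] =
    \bigcap_(k in [set: 'I_d]) [set om | Num.floor (n.+1%:R * X om 0 k) = z 0 k].
  apply/seteqP; split=> [om /= <- k _ /=|om h /=]; first by rewrite mxE.
  by apply/rowP => k; rewrite mxE; exact: h.
apply: fin_bigcap_measurable; first exact: finite_finset.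
move=> k _.
have -> : [set om | Num.floor (n.+1%:R * X om 0 k) = z 0 k] =
   (fun om => n.+1%:R * X om 0 k) @^-1` `[(z 0 k)%:~R, (z 0 k + 1)%:~R[.
  apply/seteqP; split => om /=; rewrite in_itv/=.
    by move=> <-; rewrite floor_le floorD1_gt.
  by move=> h; apply/floor_def.
rewrite -[_ @^-1` _]setTI; apply: (measurable_funM (measurable_cst _) (mX k)) => //.
Qed.

Lemma vgrid_cvg d (v : 'rV[R]_d) : (fun n => vgrid n (vfloor n v)) @ \oo --> v.
Proof.
apply/cvg_ballP => e e0.
have : \forall n \near \oo, n.+1%:R^-1 < e :> R.
  have /cvgrPdist_lt/(_ _ e0) := @cvg_harmonic R; apply: filterS => n.
  by rewrite /harmonic sub0r normrN ger0_norm ?invr_ge0.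
apply: filterS => n ne; split=> // i k; rewrite ord1 /ball/= !mxE.
have n0 : 0 < n.+1%:R :> R by rewrite ltr0n.
have h1 := floor_le (n.+1%:R * v 0 k).
have h2 := floorD1_gt (n.+1%:R * v 0 k).
have -> : v 0 k - (Num.floor (n.+1%:R * v 0 k))%:~R / n.+1%:R =
   (n.+1%:R * v 0 k - (Num.floor (n.+1%:R * v 0 k))%:~R) / n.+1%:R by field; rewrite gt_eqF.
apply: le_lt_trans ne; rewrite normrM (gtr0_norm (_ : 0 < _^-1)) ?invr_gt0//.
rewrite -[leRHS]mul1r ler_pM2r ?invr_gt0//.
by rewrite ger0_norm ?subr_ge0// lerBlDl ltW//; move: h2; rewrite intrD.
Qed.

(** Rounding each coordinate to the grid of step 1/(n+1) provides the countably valued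
    approximations, so that measurability of the coordinates is enough. *)
Lemma measurable_cont_vec2 d (X Y : Om -> 'rV[R]_d) (f : 'rV[R]_d * 'rV[R]_d -> R) :
  rvec X -> rvec Y -> (forall om, {for (X om, Y om), continuous f}) ->
  measurable_fun setT (fun om => f (X om, Y om)).
Proof.
move=> mX mY cf.
apply: (@measurable_countable_approx ('rV[int]_d * 'rV[int]_d)%type _
  (fun n om => (vfloor n (X om), vfloor n (Y om)))
  (fun n z => (vgrid n z.1, vgrid n z.2)) f (fun om => (X om, Y om))) => // [n z|om].
  rewrite (_ : [set _ | _] = [set om | vfloor n (X om) = z.1] `&` [set om | vfloor n (Y om) = z.2]).
    by apply: measurableI; exact: vfloor_fiber.
  by apply/seteqP; split => om /=; [move=> <-|case=> -> ->; case: z].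
apply/cvg_ballP => e e0.
have /cvg_ballP/(_ e e0) h1 := @vgrid_cvg d (X om).
have /cvg_ballP/(_ e e0) h2 := @vgrid_cvg d (Y om).
by apply: filterS2 h1 h2 => n b1 b2; split.
Qed.

(** The integral is a pointwise limit of Riemann sums. The statement holds for any sigma-algebra on
    the sample space and is also applied to those of the backward filtration. *)
Lemma measurable_tint (a b : R) (f : R -> Om -> R) : a <= b ->
  (forall om, {within `[a, b], continuous (f ^~ om)}) ->
  (forall r, a <= r <= b -> measurable_fun setT (f r)) ->
  measurable_fun setT (fun om => tint a b (f ^~ om)).
Proof.
move=> ab cf mf.
apply: (@measurable_fun_cvg _ _ _ setT (fun N om =>
  \sum_(0 <= i < N) (b - a) / N%:R * f (ugrid a b N i) om)); last first.
  by move=> om _; exact: riemann_cvg (cf om).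
move=> N; under eq_fun do rewrite big_mkord.
apply: measurable_sum => i; apply: measurable_funM => //; apply: mf.
by apply: ugrid_in => //; [exact: ltnW|exact: leq_ltn_trans (ltn_ord i)].
Qed.

End measurability.

(** * Expansions along a path *)

(* [small], [big] and [vanish] are o(wt r s), O(wt r s) and o(1) as [s - r -> 0],
   uniformly in r and s; along a path of the noise, wt r s is (s - r) + |w_s - w_r|^2. *)
Section path_littleo.
Context (R : realType) (a b : R) (wt : R -> R -> R).
Hypothesis wt_ge : forall r s, r <= s -> s - r <= wt r s.

Definition small (f : R -> R -> R) := forall e : R, 0 < e ->
  exists2 del : R, 0 < del & forall r s, a <= r -> r <= s -> s <= b ->
    s - r < del -> `|f r s| <= e * wt r s.

Definition big (f : R -> R -> R) := exists2 C : R, 0 < C &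
  forall r s, a <= r -> r <= s -> s <= b -> `|f r s| <= C * wt r s.

Definition vanish (f : R -> R -> R) := forall e : R, 0 < e ->
  exists2 del : R, 0 < del & forall r s, a <= r -> r <= s -> s <= b ->
    s - r < del -> `|f r s| <= e.

Lemma wt_ge0 r s : r <= s -> 0 <= wt r s.
Proof. by move=> rs; apply: le_trans (wt_ge rs); rewrite subr_ge0. Qed.

Lemma small_ext f g : small f ->
  (forall r s, a <= r -> r <= s -> s <= b -> f r s = g r s) -> small g.
Proof.
move=> sf fg e e0; have [del del0 h] := sf e e0; exists del => // r s ar rs sb rsd.
by rewrite -fg//; exact: h.
Qed.

Lemma smallD f g : small f -> small g -> small (fun r s => f r s + g r s).
Proof.
move=> sf sg e e0; have e2 : 0 < e / 2 by rewrite divr_gt0.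
have [d1 d10 h1] := sf _ e2; have [d2 d20 h2] := sg _ e2.
exists (Num.min d1 d2); first by rewrite lt_min d10.
move=> r s ar rs sb; rewrite lt_min => /andP[l1 l2].
apply: (le_trans (ler_normD _ _)).
have := h1 r s ar rs sb l1; have := h2 r s ar rs sb l2; lra.
Qed.

Lemma small0 : small (fun _ _ => 0).
Proof.
move=> e e0; exists 1 => // r s _ rs _ _; rewrite normr0.
by apply: mulr_ge0; [exact: ltW|exact: wt_ge0].
Qed.

Lemma small_sum (I : finType) (P : pred I) (f : I -> R -> R -> R) :
  (forall i, P i -> small (f i)) -> small (fun r s => \sum_(i | P i) f i r s).
Proof.
move=> sf.
suff : forall l : seq I, small (fun r s => \sum_(i <- l | P i) f i r s) by exact.
elim=> [|i l IH]; first by apply: small_ext small0 _ => r s *; rewrite big_nil.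
case: (boolP (P i)) => Pi.
  apply: (small_ext (smallD (sf i Pi) IH)) => r s *; by rewrite big_cons Pi.
by apply: (small_ext IH) => r s *; rewrite big_cons (negbTE Pi).
Qed.

Lemma small_bdd (c : R -> R -> R) (C : R) f :
  (forall r s, a <= r -> r <= s -> s <= b -> `|c r s| <= C) ->
  small f -> small (fun r s => c r s * f r s).
Proof.
move=> cC sf e e0.
have C1 : 0 < `|C| + 1 by rewrite ltr_wpDl.
have [del del0 h] := sf (e / (`|C| + 1)) (divr_gt0 e0 C1).
exists del => // r s ar rs sb rsd; rewrite normrM.
have := h r s ar rs sb rsd; have := cC r s ar rs sb; have := ler_norm C.
have w0 := wt_ge0 rs.
move=> h1 h2 h3.
apply: (@le_trans _ _ ((`|C| + 1) * (e / (`|C| + 1) * wt r s))).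
  by apply: ler_pM => //; lra.
by rewrite !mulrA [_ * e]mulrC mulfK// gt_eqF.
Qed.

(** The typical use is a noise increment, which only tends to 0, times a time integral of order s -
    r. *)
Lemma small_vanish_big f g : vanish f -> big g -> small (fun r s => f r s * g r s).
Proof.
move=> vf [C C0 gC] e e0.
have [del del0 h] := vf (e / C) (divr_gt0 e0 C0).
exists del => // r s ar rs sb rsd; rewrite normrM.
apply: (@le_trans _ _ ((e / C) * (C * wt r s))).
  by apply: ler_pM => //; [exact: h|exact: gC].
by rewrite mulrA divfK// gt_eqF.
Qed.

Lemma smallZ (c : R) f : small f -> small (fun r s => c * f r s).
Proof. by apply: (@small_bdd (fun _ _ => c) `|c|). Qed.

Lemma smallB f g : small f -> small g -> small (fun r s => f r s - g r s).
Proof.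
move=> sf sg; apply: (small_ext (smallD sf (smallZ (-1) sg))) => r s *.
by rewrite mulN1r.
Qed.

Lemma small_le f g : small g ->
  (forall r s, a <= r -> r <= s -> s <= b -> `|f r s| <= `|g r s|) -> small f.
Proof.
move=> sg fg e e0; have [del del0 h] := sg e e0; exists del => // r s ar rs sb rsd.
by apply: le_trans (fg _ _ _ _ _) _ => //; exact: h.
Qed.

Lemma big_lin (C : R) f :
  (forall r s, a <= r -> r <= s -> s <= b -> `|f r s| <= C * (s - r)) -> big f.
Proof.
move=> h; exists (`|C| + 1) => [|r s ar rs sb]; first by rewrite ltr_wpDl.
apply: (le_trans (h r s ar rs sb)).
have h0 : 0 <= s - r by rewrite subr_ge0.
apply: (@le_trans _ _ ((`|C| + 1) * (s - r))); last by rewrite ler_wpM2l// wt_ge.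
by rewrite ler_wpM2r//; have := ler_norm C; lra.
Qed.

Lemma vanish_bdd (c : R -> R -> R) (C : R) f :
  (forall r s, a <= r -> r <= s -> s <= b -> `|c r s| <= C) ->
  vanish f -> vanish (fun r s => c r s * f r s).
Proof.
move=> cC sf e e0.
have C1 : 0 < `|C| + 1 by rewrite ltr_wpDl.
have [del del0 h] := sf (e / (`|C| + 1)) (divr_gt0 e0 C1).
exists del => // r s ar rs sb rsd; rewrite normrM.
have := h r s ar rs sb rsd; have := cC r s ar rs sb; have := ler_norm C.
move=> h1 h2 h3.
apply: (@le_trans _ _ ((`|C| + 1) * (e / (`|C| + 1)))).
  by apply: ler_pM => //; lra.
by rewrite mulrC divfK// gt_eqF.
Qed.

Lemma vanish_increment (f : R -> R) : {within `[a, b], continuous f} ->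
  vanish (fun r s => f r - f s).
Proof.
move=> cf e e0; have [del del0 h] := ucont_within cf e0.
exists del => // r s ar rs sb rsd; apply: ltW; rewrite distrC; apply: h.
- by rewrite ar (le_trans rs).
- by rewrite sb (le_trans ar).
- by rewrite distrC ger0_norm ?subr_ge0.
Qed.

Lemma small_tint (f : R -> R) : {within `[a, b], continuous f} ->
  small (fun r s => tint r s f - f s * (s - r)).
Proof.
move=> cf e e0; have [del del0 h] := ucont_within cf e0.
exists del => // r s ar rs sb rsd.
apply: (@le_trans _ _ (e * (s - r))); last by rewrite ler_wpM2l ?wt_ge// ltW.
apply: tint_dist => //; first exact: within_sub cf.
move=> u /andP[ru us]; apply: ltW; rewrite distrC; apply: h.
- by rewrite (le_trans ar ru) (le_trans us sb).
- by rewrite sb (le_trans ar).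
- by rewrite distrC ger0_norm ?subr_ge0//; lra.
Qed.

Lemma big_tint (f : R -> R) : {within `[a, b], continuous f} ->
  big (fun r s => tint r s f).
Proof.
move=> cf; have [C C0 hC] := within_bounded cf.
apply: (@big_lin C) => r s ar rs sb; apply: tint_bound => //.
  exact: within_sub cf.
by move=> u /andP[ru us]; apply: hC; rewrite (le_trans ar ru) (le_trans us sb).
Qed.

End path_littleo.

(** * Taylor expansions by means of partial derivatives *)

Section taylor.
Context (R : realType).

(** The derivative is compared with a frozen value c, so that only its oscillation e enters. The
    points come in either order, since time increments are taken backward. *)
Lemma mvt_dist (f df : R -> R) (x y c e : R) :
  (forall u : R, Num.min x y <= u <= Num.max x y -> is_derive u 1 f (df u)) ->
  (forall u : R, Num.min x y <= u <= Num.max x y -> `|df u - c| <= e) ->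
  `|f y - f x - c * (y - x)| <= e * `|y - x|.
Proof.
wlog xy : x y / x <= y => [hw|].
  case/orP: (le_total x y) => [xy|yx]; first exact: hw.
  move=> h1 h2; have := hw y x yx.
  rewrite minC maxC => /(_ h1 h2).
  by rewrite -normrN distrC (_ : - (_ - _ - _) = f y - f x - c * (y - x))//; ring.
rewrite min_l// max_r// => hd hb.
have cf : {within `[x, y], continuous f}.
  apply: derivable_within_continuous => u; rewrite in_itv/= => /hd h.
  exact: ex_derive.
have [|u uxy ->] := @MVT_segment R f df x y xy _ cf.
  by move=> u; rewrite in_itv/= => /andP[/ltW xu /ltW uy]; apply: hd; rewrite xu.
rewrite -mulrBl normrM ler_wpM2r//; apply: hb.
by move: uxy; rewrite in_itv.
Qed.

(** The mean value bound is applied twice: to [df], then to f minus its frozen second-order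
    polynomial, whose derivative is at most e |h| between 0 and h. *)
Lemma taylor2_dist (f df ddf : R -> R) (h c e : R) :
  (forall u : R, is_derive u 1 f (df u)) -> (forall u : R, is_derive u 1 df (ddf u)) ->
  (forall u, `|u| <= `|h| -> `|ddf u - c| <= e) ->
  `|f h - f 0 - df 0 * h - 1 / 2 * c * h ^+ 2| <= e * h ^+ 2.
Proof.
move=> hf hdf hb.
have e0 : 0 <= e by apply: le_trans (hb 0 _) => //; rewrite normr0.
have between (u : R) : Num.min 0 h <= u <= Num.max 0 h -> `|u| <= `|h|.
  have [h0|h0] := leP 0 h; rewrite ?(min_l, max_r, min_r, max_l)//.
    by move=> /andP[u0 uh]; rewrite !ger0_norm.
  by move=> /andP[u0 uh]; rewrite ler0_norm// ltr0_norm// lerN2.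
pose g u := f u - df 0 * u - 1 / 2 * c * u ^+ 2.
have hg (u : R) : is_derive u 1 g (df u - df 0 - c * u).
  have := hf u => hfu.
  rewrite /g; apply: is_derive_eq; rewrite /GRing.scale/=; by field.
have gb (u : R) : Num.min 0 h <= u <= Num.max 0 h -> `|(df u - df 0 - c * u) - 0| <= e * `|h|.
  move=> hu; rewrite subr0.
  have -> : df u - df 0 - c * u = df u - df 0 - c * (u - 0) by ring.
  apply: (@le_trans _ _ (e * `|u - 0|)).
    apply: (@mvt_dist df ddf 0 u c e) => v hv.
    apply: hb; apply: (@le_trans _ _ `|u|); last exact: between.
    move: hv; have [u0|u0] := leP 0 u; rewrite ?(min_l, max_r, min_r, max_l)//; try exact: ltW.
      by move=> /andP[v0 vu]; rewrite !ger0_norm.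
    by move=> /andP[v0 vu]; rewrite ler0_norm// ltr0_norm// lerN2.
  by rewrite subr0 ler_wpM2l// between.
have := @mvt_dist g _ 0 h 0 (e * `|h|) (fun u _ => hg u) gb.
have -> : g h - g 0 - 0 * (h - 0) = f h - f 0 - df 0 * h - 1 / 2 * c * h ^+ 2.
  by rewrite /g; ring.
by have -> : e * `|h| * `|h - 0| = e * h ^+ 2
  by rewrite subr0 -mulrA -normrM -expr2 ger0_norm ?sqr_ge0.
Qed.

Context (d : nat).
Implicit Types (x y z : 'rV[R]_d) (F : 'rV[R]_d -> R).

(** Corners of the staircase from x to y that changes one coordinate at a time; each edge is a
    one-dimensional problem for a single partial derivative. *)
Definition hyb x y (k : nat) : 'rV[R]_d := \row_i (if (i < k)%N then y 0 i else x 0 i).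

Lemma hyb0 x y : hyb x y 0 = x.
Proof. by apply/rowP => i; rewrite mxE. Qed.

Lemma hybd x y : hyb x y d = y.
Proof. by apply/rowP => i; rewrite mxE ltn_ord. Qed.

Lemma hybS x y (k : 'I_d) :
  hyb x y k.+1 = (y 0 k - x 0 k) *: basis_vec R k + hyb x y k.
Proof.
apply/rowP => i; rewrite !mxE ltnS leq_eqVlt eqxx/=.
have [->|ik] := eqVneq i k; first by rewrite eqxx/= ltnn mulr1 subrK.
by rewrite (negbTE (_ : (i != k :> nat)))//= mulr0 add0r.
Qed.

Lemma is_derive_line F (F' : 'rV[R]_d -> R) (v : 'rV[R]_d) x (u : R) :
  is_derive (u *: v + x) v F (F' (u *: v + x)) ->
  is_derive u 1 (fun t => F (t *: v + x)) (F' (u *: v + x)).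
Proof.
move=> [dF eF].
have E : (fun h : R => h^-1 *: (((fun t => F (t *: v + x)) \o shift u) (h *: 1) - F (u *: v + x)))
   = (fun h => h^-1 *: ((F \o shift (u *: v + x)) (h *: v) - F (u *: v + x))).
  apply/funext => h; congr (_ *: (_ - _)); rewrite /shift /=; congr F.
  by rewrite [_ *: 1]mulr1 scalerDl addrA.
split.
  by rewrite /derivable /= in dF *; rewrite E.
by rewrite -eF /derive E.
Qed.

(** A box centred at x that contains the whole staircase from x to y; the derivatives are compared
    with their frozen values there. *)
Definition box x y z := forall i, `|z 0 i - x 0 i| <= `|y 0 i - x 0 i|.

Lemma box_line x y (k : 'I_d) (u : R) : `|u| <= `|y 0 k - x 0 k| ->
  box x y (u *: basis_vec R k + hyb x y k).
Proof.
move=> hu i; rewrite !mxE eqxx/=.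
have [->|ik] := eqVneq i k; first by rewrite ltnn mulr1 addrK.
by rewrite mulr0 add0r; case: ifP => // _; rewrite subrr normr0.
Qed.

Lemma hyb_telescope F x y : F y - F x = \sum_(k < d) (F (hyb x y k.+1) - F (hyb x y k)).
Proof.
rewrite -(big_mkord xpredT (fun k => F (hyb x y k.+1) - F (hyb x y k))).
by rewrite telescope_sumr// hyb0 hybd.
Qed.

Lemma taylor1_box F (F' : 'I_d -> 'rV[R]_d -> R) (c : 'I_d -> R) (e : R) x y :
  (forall k z, is_derive z (basis_vec R k) F (F' k z)) ->
  (forall k z, box x y z -> `|F' k z - c k| <= e) ->
  `|F y - F x - \sum_k c k * (y 0 k - x 0 k)| <= e * \sum_k `|y 0 k - x 0 k|.
Proof.
move=> hF hc; rewrite hyb_telescope -sumrB mulr_sumr.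
apply: (le_trans (ler_norm_sum _ _ _)); apply: ler_sum => k _.
set h := y 0 k - x 0 k; rewrite hybS -/h.
have := @mvt_dist (fun u => F (u *: basis_vec R k + hyb x y k))
  (fun u => F' k (u *: basis_vec R k + hyb x y k)) 0 h (c k) e.
rewrite scale0r add0r subr0; apply => u hu.
  by apply: (is_derive_line (F' := F' k)).
apply: hc; apply: box_line; move: hu; rewrite -/h.
have [h0|h0] := leP 0 h; rewrite ?(min_l, max_r, min_r, max_l)//; try exact: ltW.
  by move=> /andP[u0 uh]; rewrite !ger0_norm.
by move=> /andP[u0 uh]; rewrite ler0_norm// ltr0_norm// lerN2.
Qed.

(** On edge k the expansion is of second order about the corner [hyb x y k]. Transporting the first
    derivative from that corner back to x produces the mixed terms, with j < k because only these
    coordinates have moved. Each of the two operations costs one e, hence the factor 2. *)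
Lemma taylor2_box F (F' : 'I_d -> 'rV[R]_d -> R) (F'' : 'I_d -> 'I_d -> 'rV[R]_d -> R)
    (c : 'I_d -> 'I_d -> R) (e : R) x y :
  (forall k z, is_derive z (basis_vec R k) F (F' k z)) ->
  (forall j k z, is_derive z (basis_vec R j) (F' k) (F'' j k z)) ->
  (forall j k z, box x y z -> `|F'' j k z - c j k| <= e) ->
  `|F y - F x - \sum_k F' k x * (y 0 k - x 0 k)
    - \sum_k 1 / 2 * c k k * (y 0 k - x 0 k) ^+ 2
    - \sum_(k < d) (\sum_(j < d | (j < k)%N) c j k * (y 0 j - x 0 j)) * (y 0 k - x 0 k)|
  <= 2 * e * (\sum_k `|y 0 k - x 0 k|) ^+ 2.
Proof.
move=> hF hF' hc; rewrite hyb_telescope -!sumrB.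
set S := \sum_k `|y 0 k - x 0 k|.
have S0 : 0 <= S by exact: sumr_ge0.
have vS (k : 'I_d) : `|y 0 k - x 0 k| <= S by rewrite /S (bigD1 k)//= lerDl sumr_ge0.
apply: (@le_trans _ _ (\sum_k 2 * e * S * `|y 0 k - x 0 k|)); last first.
  by rewrite -mulr_sumr -/S expr2 mulrA.
apply: (le_trans (ler_norm_sum _ _ _)); apply: ler_sum => k _.
set h := y 0 k - x 0 k; rewrite hybS -/h.
have e0 : 0 <= e.
  apply: le_trans (hc k k x _) => //.
  by move=> i; rewrite subrr normr0.
have t2 := @taylor2_dist (fun u => F (u *: basis_vec R k + hyb x y k))
  (fun u => F' k (u *: basis_vec R k + hyb x y k))
  (fun u => F'' k k (u *: basis_vec R k + hyb x y k)) h (c k k) e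
  (fun u => is_derive_line (F' := F' k) (hF _ _))
  (fun u => is_derive_line (F' := F'' k k) (hF' _ _ _)) 
  (fun u hu => hc k k _ (box_line hu)).
rewrite scale0r add0r in t2.
have t1 := @taylor1_box (F' k) (fun j => F'' j k) (fun j => c j k) e x (hyb x y k)
   (fun j z => hF' j k z).
have bx : forall z, box x (hyb x y k) z -> box x y z.
  move=> z hz i; apply: (le_trans (hz i)); rewrite mxE.
  by case: ifP => // _; rewrite subrr normr0.
have := t1 (fun j z hz => hc j k z (bx z hz)) => {}t1.
have sumE : \sum_j c j k * (hyb x y k 0 j - x 0 j) =
    \sum_(j < d | (j < k)%N) c j k * (y 0 j - x 0 j).
  rewrite [RHS]big_mkcond; apply: eq_bigr => j _; rewrite mxE.
  by case: ifP => //; rewrite subrr mulr0.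
have sumle : \sum_j `|hyb x y k 0 j - x 0 j| <= S.
  apply: ler_sum => j _; rewrite mxE.
  by case: ifP => // _; rewrite subrr normr0.
rewrite sumE in t1.
have {}t1 : `|F' k (hyb x y k) - F' k x -
   \sum_(j < d | (j < k)%N) c j k * (y 0 j - x 0 j)| <= e * S.
  by apply: (le_trans t1); rewrite ler_wpM2l.
move: t1 t2; set X := \sum_(j < d | _) _; set F1 := F' k _; set Fx := F' k x.
set D := F (h *: _ + _) - F _ => t1 t2.
have -> : D - Fx * h - 1 / 2 * c k k * h ^+ 2 - X * h =
   (D - F1 * h - 1 / 2 * c k k * h ^+ 2) + (F1 - Fx - X) * h by ring.
apply: (le_trans (ler_normD _ _)); rewrite normrM.
have : `|F1 - Fx - X| * `|h| <= e * S * `|h| by rewrite ler_wpM2r.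
have : e * h ^+ 2 <= e * S * `|h|.
  by rewrite -mulrA ler_wpM2l// -real_normK ?num_real// expr2 ler_wpM2r// vS.
by move: t2; lra.
Qed.

End taylor.

(** * Ito's formula along a single path *)

Lemma sqr_sum_le_fin (R : realType) (I : finType) (x : I -> R) :
  (\sum_k x k) ^+ 2 <= #|I|%:R * \sum_k x k ^+ 2.
Proof.
have -> : (\sum_k x k) ^+ 2 = \sum_j \sum_k x j * x k.
  by rewrite expr2 mulr_suml; apply: eq_bigr => j _; rewrite mulr_sumr.
have -> : #|I|%:R * \sum_k x k ^+ 2 = \sum_j \sum_k (1 / 2 * x j ^+ 2 + 1 / 2 * x k ^+ 2).
  transitivity (\sum_j ((1 / 2 * x j ^+ 2) *+ #|I| + 1 / 2 * \sum_k x k ^+ 2)).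
    rewrite big_split/= sumr_const sumrMnl -mulr_sumr.
    by rewrite -[in RHS](mulr_natl (1 / 2 * _) #|I|); set S := \sum_k _; field.
  apply: eq_bigr => j _; by rewrite big_split/= sumr_const mulr_sumr.
apply: ler_sum => j _; apply: ler_sum => k _.
by have := sqr_ge0 (x j - x k); rewrite sqrrB; lra.
Qed.

Section ito_path.
Context (R : realType) (d : nat) (a b m sg : R).
Variables (qs ps w bf : R -> 'rV[R]_d) (al : R -> R).
Hypothesis cqs : {within `[a, b], continuous qs}.
Hypothesis cps : {within `[a, b], continuous ps}.
Hypothesis cw : {within `[a, b], continuous w}.
Hypothesis cbf : {within `[a, b], continuous bf}.
Hypothesis cal : {within `[a, b], continuous al}.
Hypothesis hqs : forall k r s, a <= r -> r <= s -> s <= b ->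
  qs r 0 k - qs s 0 k = - tint r s (fun u => m^-1 * ps u 0 k).
Hypothesis hps : forall k r s, a <= r -> r <= s -> s <= b ->
  ps r 0 k - ps s 0 k = - tint r s (fun u => bf u 0 k) - sg * (w s 0 k - w r 0 k).

Variables (g gt : R -> 'rV[R]_d -> 'rV[R]_d -> R).
Variables (gq gp : 'I_d -> R -> 'rV[R]_d -> 'rV[R]_d -> R).
Variables (gpp : 'I_d -> 'I_d -> R -> 'rV[R]_d -> 'rV[R]_d -> R).

Definition uncurry3 (f : R -> 'rV[R]_d -> 'rV[R]_d -> R) (z : R * 'rV[R]_d * 'rV[R]_d) : R :=
  f z.1.1 z.1.2 z.2.

Definition continuous_along (f : R -> 'rV[R]_d -> 'rV[R]_d -> R) := forall s, a <= s <= b ->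
  {for (s, qs s, ps s), continuous (uncurry3 f)}.

Hypothesis hgt : forall (s : R) q p, a <= s <= b ->
  is_derive s 1 (fun u => g u q p) (gt s q p).
Hypothesis hgq : forall k s q p, a <= s <= b ->
  is_derive q (basis_vec R k) (fun y => g s y p) (gq k s q p).
Hypothesis hgp : forall k s q p, a <= s <= b ->
  is_derive p (basis_vec R k) (g s q) (gp k s q p).
Hypothesis hgpp : forall j k s q p, a <= s <= b ->
  is_derive p (basis_vec R j) (gp k s q) (gpp j k s q p).
Hypothesis cg : continuous_along g.
Hypothesis cgt : continuous_along gt.
Hypothesis cgq : forall k, continuous_along (gq k).
Hypothesis cgp : forall k, continuous_along (gp k).
Hypothesis cgpp : forall j k, continuous_along (gpp j k).

Definition at_path (f : R -> 'rV[R]_d -> 'rV[R]_d -> R) (s : R) : R := f s (qs s) (ps s).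

(** This is the cancellation of the terms in s - r. From s back to r, time, position and drift
    contribute minus the first three terms, the weight exp(- int_s^b al) contributes - al g, and the
    squared noise contributes + 1/2 sg^2 times the Laplacian in p. *)
Hypothesis pde : forall s, a <= s <= b ->
  at_path gt s + \sum_k at_path (gq k) s * (m^-1 * ps s 0 k)
  + \sum_k at_path (gp k) s * bf s 0 k + al s * at_path g s
  = 1 / 2 * sg ^+ 2 * \sum_k at_path (gpp k k) s.

Definition wgt (r s : R) : R := (s - r) + \sum_k (w s 0 k - w r 0 k) ^+ 2.

Lemma wgt_ge r s : r <= s -> s - r <= wgt r s.
Proof. by move=> _; rewrite lerDl sumr_ge0// => k _; exact: sqr_ge0. Qed.

Lemma coord_within (x : R -> 'rV[R]_d) (k : 'I_d) :
  {within `[a, b], continuous x} -> {within `[a, b], continuous (fun s => x s 0 k)}.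
Proof.
move=> cx s; apply: (@cvg_comp _ _ _ x (fun v : 'rV[R]_d => v 0 k)); first exact: cx.
exact: coord_continuous.
Qed.

Lemma cgamma : {within `[a, b], continuous (fun s => (s, qs s, ps s))}.
Proof.
move=> x; apply/cvg_ballP => e e0.
have := (@cqs x); move=> /cvg_ballP/(_ e e0) h1.
have := (@cps x); move=> /cvg_ballP/(_ e e0) h2.
have idw : {within `[a, b], continuous (fun s : R => s)} by apply: continuous_subspaceT => y; exact: cvg_id.
have := (@idw x); move=> /cvg_ballP/(_ e e0) h3.
by apply: filterS3 h1 h2 h3 => y b1 b2 b3; split=> //; split.
Qed.

Lemma within_at_path f : continuous_along f -> {within `[a, b], continuous (at_path f)}.
Proof.
move=> cf; apply: within_ucont => e e0.
have [del del0 hdel] := ucont_along cgamma cf e0.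
have [eta eta0 heta] := ucont_within cgamma del0.
exists eta => // r s rab sab rs; apply: (hdel s (r, qs r, ps r)) => //.
exact: heta.
Qed.

Lemma bounded_at_path f : continuous_along f ->
  exists C, forall s, a <= s <= b -> `|at_path f s| <= C.
Proof. by move=> /within_at_path/within_bounded[C _ h]; exists C. Qed.

(** A modulus uniform along the path and valid at all intermediate points of a backward step: times
    in [r, s], positions and momenta in the boxes spanned by the increments. *)
Lemma near_path (f : R -> 'rV[R]_d -> 'rV[R]_d -> R) (e : R) : continuous_along f -> 0 < e ->
  exists2 del : R, 0 < del & forall r s u y z, a <= r -> r <= s -> s <= b -> s - r < del ->
    r <= u <= s -> box (qs s) (qs r) y -> box (ps s) (ps r) z ->
    `|f u y z - at_path f s| <= e.
Proof.
move=> cf e0; have [del del0 hdel] := ucont_along cgamma cf e0.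
have [d1 d10 h1] := ucont_within cqs del0.
have [d2 d20 h2] := ucont_within cps del0.
exists (Num.min del (Num.min d1 d2)); first by rewrite !lt_min del0 d10.
move=> r s u y z ar rs sb; rewrite !lt_min => /and3P[l0 l1 l2] /andP[ru us] hy hz.
have rab : a <= r <= b by rewrite ar (le_trans rs).
have sab : a <= s <= b by rewrite sb (le_trans ar).
have rs' : `|r - s| = s - r by rewrite distrC ger0_norm// subr_ge0.
rewrite -rs' in l1 l2.
apply: ltW; rewrite distrC; apply: (hdel s (u, y, z)) => //; split => /=.
  split=> /=; first by rewrite /ball/= ger0_norm ?subr_ge0//; lra.
  have [_ bq] := h1 r s rab sab l1; split=> // i j; rewrite ord1.
  by have := bq 0 j; rewrite /ball/= distrC => h; rewrite distrC (le_lt_trans (hy j)).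
have [_ bp] := h2 r s rab sab l2; split=> // i j; rewrite ord1.
by have := bp 0 j; rewrite /ball/= distrC => h; rewrite distrC (le_lt_trans (hz j)).
Qed.

Lemma box_refl (x y : 'rV[R]_d) : box x y x.
Proof. by move=> i; rewrite subrr normr0. Qed.

Lemma box_end (x y : 'rV[R]_d) : box x y y.
Proof. by move=> i. Qed.

Notation sm := (small a b wgt).
Notation bg := (big a b wgt).

Let D (k : 'I_d) (r s : R) := tint r s (fun u => bf u 0 k).
Let dw (k : 'I_d) (r s : R) := w s 0 k - w r 0 k.
Let v (k : 'I_d) (r s : R) := ps r 0 k - ps s 0 k.

Lemma vE k r s : a <= r -> r <= s -> s <= b -> v k r s = - D k r s - sg * dw k r s.
Proof. exact: hps. Qed.

(** The increment of g is split in the order time, position, momentum, with the other arguments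
    frozen accordingly. Time and position enter at first order and momentum at second order, as the
    class C^{1,1,2} permits. *)
Lemma sm_time : sm (fun r s => g r (qs r) (ps r) - g s (qs r) (ps r) + at_path gt s * (s - r)).
Proof.
move=> e e0; have [del del0 h] := near_path cgt e0.
exists del => // r s ar rs sb rsd.
have key := @mvt_dist R (fun u => g u (qs r) (ps r)) (fun u => gt u (qs r) (ps r)) s r (at_path gt s) e.
have -> : g r (qs r) (ps r) - g s (qs r) (ps r) + at_path gt s * (s - r) =
   g r (qs r) (ps r) - g s (qs r) (ps r) - at_path gt s * (r - s) by ring.
apply: (@le_trans _ _ (e * `|r - s|)).
  apply: key; rewrite min_r// max_l// => u /andP[ru us].
    by apply: hgt; rewrite (le_trans ar ru) (le_trans us sb).
  have rus : r <= u <= s by rewrite ru us.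
  exact: (h r s u (qs r) (ps r) ar rs sb rsd rus (box_end _ _) (box_end _ _)).
by rewrite distrC ger0_norm ?subr_ge0// ler_wpM2l ?wgt_ge// ltW.
Qed.

Lemma big_dq : exists2 C : R, 0 < C & forall k r s, a <= r -> r <= s -> s <= b ->
  `|qs r 0 k - qs s 0 k| <= C * (s - r).
Proof.
have : forall k, exists2 C : R, 0 < C & forall s, a <= s <= b -> `|m^-1 * ps s 0 k| <= C.
  move=> k; apply: within_bounded => x; apply: cvgM; [exact: cvg_cst|exact: coord_within].
move=> /(_ _)/cid2-/all_sig2[C C0 hC].
exists (1 + \sum_k C k) => [|k r s ar rs sb].
  by rewrite ltr_pwDl// sumr_ge0// => k _; exact: ltW.
rewrite hqs// normrN; apply: (@le_trans _ _ (C k * (s - r))).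
  apply: tint_bound => //.
    apply: within_sub ar sb _ => x.
    by apply: cvgM; [exact: cvg_cst|exact: coord_within].
  by move=> u /andP[ru us]; apply: hC; rewrite (le_trans ar ru) (le_trans us sb).
rewrite ler_wpM2r ?subr_ge0// (bigD1 k)//= addrCA lerDl addr_ge0// sumr_ge0// => i _.
exact: ltW.
Qed.

Lemma sm_pos : sm (fun r s => g s (qs r) (ps r) - g s (qs s) (ps r)
  + (\sum_k at_path (gq k) s * (m^-1 * ps s 0 k)) * (s - r)).
Proof.
have s1 : sm (fun r s => g s (qs r) (ps r) - g s (qs s) (ps r)
    - \sum_k at_path (gq k) s * (qs r 0 k - qs s 0 k)).
  have [C C0 hC] := big_dq.
  (* The d coordinates move by at most C (s - r) each; [d.+1] instead of d keeps the divisor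
     positive. *)
  move=> e e0; have e1 : 0 < e / (d.+1%:R * C) by rewrite divr_gt0// mulr_gt0.
  have : forall k, exists2 del : R, 0 < del & forall r s u y z, a <= r -> r <= s -> s <= b ->
    s - r < del -> r <= u <= s -> box (qs s) (qs r) y -> box (ps s) (ps r) z ->
    `|gq k u y z - at_path (gq k) s| <= e / (d.+1%:R * C).
    by move=> k; apply: near_path.
  move=> /(_ _)/cid2-/all_sig2[del del0 h].
  exists (\big[Num.min/1]_k del k).
    by apply: lt_bigmin => // k _; exact: del0.
  move=> r s ar rs sb rsd.
  have rsk k : s - r < del k by apply: (lt_le_trans rsd); exact: bigmin_le_cond.
  have sab : a <= s <= b by rewrite sb (le_trans ar).
  have := @taylor1_box R d (fun y => g s y (ps r)) (fun k y => gq k s y (ps r))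
    (fun k => at_path (gq k) s) (e / (d.+1%:R * C)) (qs s) (qs r)
    (fun k z => hgq k z (ps r) sab).
  move=> /(_ (fun k z hz => h k r s s z (ps r) ar rs sb (rsk k) _ hz (box_end _ _))) t1.
  apply: (le_trans (t1 _)); first by rewrite rs lexx.
  apply: (@le_trans _ _ (e / (d.+1%:R * C) * (d%:R * C * (s - r)))).
    rewrite ler_wpM2l ?(ltW e1)//.
    apply: (@le_trans _ _ (\sum_(k < d) C * (s - r))).
      by apply: ler_sum => k _; exact: hC.
    by rewrite sumr_const card_ord -[_ *+ _]mulr_natl mulrA.
  apply: (@le_trans _ _ (e / (d.+1%:R * C) * (d.+1%:R * C * (s - r)))).
    rewrite ler_wpM2l ?(ltW e1)// ler_wpM2r ?subr_ge0// ler_wpM2r ?(ltW C0)//.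
    by rewrite ler_nat.
  rewrite mulrA divfK ?gt_eqF ?mulr_gt0//.
  by rewrite ler_wpM2l ?wgt_ge// ltW.
have s2 : sm (fun r s => \sum_k at_path (gq k) s * 
    (- (tint r s (fun u => m^-1 * ps u 0 k) - m^-1 * ps s 0 k * (s - r)))).
  apply: small_sum; first exact: wgt_ge.
  move=> k _; have [C hC] := bounded_at_path (@cgq k).
  apply: (@small_bdd _ _ _ _ wgt_ge (fun _ s => at_path (gq k) s) C).
    by move=> r s ar rs sb; apply: hC; rewrite sb (le_trans ar).
  have cpk : {within `[a, b], continuous (fun u => m^-1 * ps u 0 k)}.
    by move=> x; apply: cvgM; [exact: cvg_cst|exact: coord_within].
  apply: (small_ext (smallZ wgt_ge (-1) (small_tint wgt_ge cpk))).
  by move=> r s *; rewrite mulN1r.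
apply: (small_ext (smallD s1 s2)) => r s ar rs sb.
rewrite -!addrA; congr (_ + (_ + _)).
rewrite mulr_suml -sumrN -big_split/=; apply: eq_bigr => k _.
by rewrite hqs//; ring.
Qed.

Lemma bigD k : bg (D k).
Proof. by apply: big_tint; [exact: wgt_ge|exact: coord_within]. Qed.

Lemma van_dw k : vanish a b (dw k).
Proof.
move=> e e0; have [del del0 h] := vanish_increment (@coord_within _ k cw) e0.
by exists del => // r s ar rs sb rsd; rewrite /dw distrC; exact: h.
Qed.

Lemma van_D k : vanish a b (D k).
Proof.
move=> e e0.
have [del del0 h] := vanish_increment (within_tint (@coord_within _ k cbf)) e0.
exists del => // r s ar rs sb rsd.
suff -> : D k r s = tint r b (fun u => bf u 0 k) - tint s b (fun u => bf u 0 k) by exact: h.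
rewrite (@tint_split _ r s b)// ?addrK//.
by apply: within_sub ar (lexx b) _; exact: coord_within.
Qed.

(** Write v = - D - sg dw. The drift part D is of order s - r, and D and dw both tend to 0
    uniformly, so every product containing D is negligible. *)
Lemma sm_vv j k : sm (fun r s => v j r s * v k r s - sg ^+ 2 * (dw j r s * dw k r s)).
Proof.
have s1 := small_vanish_big (van_D j) (bigD k).
have s2 := smallZ wgt_ge sg (small_vanish_big (van_dw k) (bigD j)).
have s3 := smallZ wgt_ge sg (small_vanish_big (van_dw j) (bigD k)).
apply: (small_ext (smallD s1 (smallD s2 s3))) => r s ar rs sb.
by rewrite !vE//; ring.
Qed.

(** This is where the weight must contain |dw|^2: the square of v is bounded by the square of the
    drift integral, of order s - r, plus the square of the noise. *)
Lemma big_sumv : bg (fun r s => (\sum_k `|v k r s|) ^+ 2).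
Proof.
have [CD CD0 hD] : exists2 C : R, 0 < C & forall k r s, a <= r -> r <= s -> s <= b ->
    `|D k r s| <= C * (s - r) /\ `|D k r s| <= C.
  have : forall k, exists2 C : R, 0 < C & forall s, a <= s <= b -> `|bf s 0 k| <= C.
    by move=> k; apply: within_bounded; exact: coord_within.
  move=> /(_ _)/cid2-/all_sig2[C C0 hC].
  have sC : 0 <= \sum_k C k by apply: sumr_ge0 => k _; exact: ltW.
  (* The factor 1 + |b - a| makes the same constant bound both D / (s - r) and D, so that D^2 <=
     CD^2 (s - r). *)
  exists ((1 + \sum_k C k) * (1 + `|b - a|)) => [|k r s ar rs sb].
    by rewrite mulr_gt0// ltr_pwDl.
  have h1 : `|D k r s| <= C k * (s - r).
    apply: tint_bound => //.
      by apply: within_sub ar sb _; exact: coord_within.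
    by move=> u /andP[ru us]; apply: hC; rewrite (le_trans ar ru) (le_trans us sb).
  have h2 : C k <= 1 + \sum_k C k.
    rewrite (bigD1 k)//= addrCA lerDl addr_ge0// sumr_ge0// => i _; exact: ltW.
  have h3 : 0 <= s - r by rewrite subr_ge0.
  have h4 : s - r <= 1 + `|b - a|.
    by apply: (@le_trans _ _ (b - a)); [lra|apply: (le_trans (ler_norm _)); rewrite lerDr].
  have h5 : C k * (s - r) <= (1 + \sum_k C k) * (s - r) by rewrite ler_wpM2r.
  have h6 : 0 <= (1 + \sum_k C k) * (s - r) by rewrite mulr_ge0// addr_ge0.
  have h7 := normr_ge0 (b - a).
  split; apply: (le_trans h1); apply: (le_trans h5).
    by rewrite -mulrA ler_wpM2l ?addr_ge0// ler_peMl// lerDl.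
  by rewrite ler_wpM2l ?addr_ge0.
pose K := d.+1%:R * (2 * CD ^+ 2 + 2 * sg ^+ 2).
have K0 : 0 < K.
  by rewrite mulr_gt0// ltr_pwDl ?mulr_gt0 ?exprn_gt0// mulr_ge0// sqr_ge0.
exists (d.+1%:R * K) => [|r s ar rs sb]; first by rewrite mulr_gt0.
have W0 := wt_ge0 wgt_ge rs.
have sq (k : 'I_d) : `|v k r s| ^+ 2 <= (2 * CD ^+ 2 + 2 * sg ^+ 2) * wgt r s.
  have [d1 d2] := hD k r s ar rs sb.
  have dd : D k r s ^+ 2 <= CD ^+ 2 * (s - r).
    rewrite -real_normK ?num_real// !expr2 -mulrA ler_pM//.
  have ww : dw k r s ^+ 2 <= wgt r s.
    rewrite /wgt (bigD1 k)//= addrCA lerDl addr_ge0 ?subr_ge0// sumr_ge0// => *.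
    exact: sqr_ge0.
  have hh := wgt_ge rs.
  have c1 : CD ^+ 2 * (s - r) <= CD ^+ 2 * wgt r s by rewrite ler_wpM2l ?sqr_ge0.
  have c2 : sg ^+ 2 * dw k r s ^+ 2 <= sg ^+ 2 * wgt r s by rewrite ler_wpM2l ?sqr_ge0.
  rewrite real_normK ?num_real// vE//.
  have -> : (- D k r s - sg * dw k r s) ^+ 2 =
    2 * D k r s ^+ 2 + 2 * (sg ^+ 2 * dw k r s ^+ 2) - (D k r s - sg * dw k r s) ^+ 2 by ring.
  by have := sqr_ge0 (D k r s - sg * dw k r s); lra.
rewrite ger0_norm ?sqr_ge0//.
have cs : (\sum_k `|v k r s|) ^+ 2 <= d.+1%:R * \sum_k `|v k r s| ^+ 2.
  apply: (le_trans (sqr_sum_le_fin _)); rewrite card_ord; apply: ler_wpM2r; last by rewrite ler_nat.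
  by apply: sumr_ge0 => k _; exact: exprn_ge0.
apply: (le_trans cs); rewrite -mulrA ler_wpM2l//.
apply: (le_trans (ler_sum _ (fun k _ => sq k))).
rewrite sumr_const card_ord /K -[_ *+ _]mulr_natl mulrA.
apply: ler_wpM2r => //; apply: ler_wpM2r; last by rewrite ler_nat.
by rewrite addr_ge0// mulr_ge0// sqr_ge0.
Qed.

Lemma sm_mom : sm (fun r s => g s (qs s) (ps r) - g s (qs s) (ps s)
  - \sum_k at_path (gp k) s * v k r s
  - \sum_k 1 / 2 * at_path (gpp k k) s * v k r s ^+ 2
  - \sum_(k < d) (\sum_(j < d | (j < k)%N) at_path (gpp j k) s * v j r s) * v k r s).
Proof.
have [C C0 hC] := big_sumv.
move=> e e0; have e1 : 0 < e / (2 * C) by rewrite divr_gt0// mulr_gt0.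
have : forall jk : 'I_d * 'I_d, exists2 del : R, 0 < del &
    forall r s u y z, a <= r -> r <= s -> s <= b ->
    s - r < del -> r <= u <= s -> box (qs s) (qs r) y -> box (ps s) (ps r) z ->
    `|gpp jk.1 jk.2 u y z - at_path (gpp jk.1 jk.2) s| <= e / (2 * C).
  by move=> jk; apply: near_path.
move=> /(_ _)/cid2-/all_sig2[del del0 h].
exists (\big[Num.min/1]_jk del jk).
  by apply: lt_bigmin => // jk _; exact: del0.
move=> r s ar rs sb rsd.
have rsk jk : s - r < del jk by apply: (lt_le_trans rsd); exact: bigmin_le_cond.
have sab : a <= s <= b by rewrite sb (le_trans ar).
have rss : r <= s <= s by rewrite rs lexx.
have t := @taylor2_box R d (g s (qs s)) (fun k => gp k s (qs s))
  (fun j k => gpp j k s (qs s)) (fun j k => at_path (gpp j k) s) (e / (2 * C)) (ps s) (ps r)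
  (fun k z => hgp k (qs s) z sab) (fun j k z => hgpp j k (qs s) z sab)
  (fun j k z hz => h (j, k) r s s (qs s) z ar rs sb (rsk _) rss (box_refl _ _) hz).
apply: (le_trans t); rewrite mulrCA.
have := hC r s ar rs sb; rewrite ger0_norm ?sqr_ge0// => hS.
apply: (@le_trans _ _ (2 * (e / (2 * C)) * (C * wgt r s))).
  by rewrite mulrCA ler_wpM2l// mulr_ge0// ltW.
by rewrite le_eqVlt; apply/orP; left; apply/eqP; field; rewrite gt_eqF.
Qed.

Lemma within_En : {within `[a, b], continuous (fun s => expR (- tint s b al))}.
Proof.
move=> x; have hx := @within_tint _ _ _ _ cal x.
apply: (cvg_comp _ _ (cvgN hx)); exact: continuous_expR.
Qed.

(** With y the integral of [al] over [r, s], the remainder is at most y^2 exp|y|: one factor y is of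
    order s - r and the other tends to 0. *)
Lemma sm_exp : sm (fun r s => expR (- tint r s al) - 1 + al s * (s - r)).
Proof.
have [C C0 hC] := within_bounded cal.
have van : vanish a b (fun r s => tint r s al * expR `|tint r s al|).
  have vt : vanish a b (fun r s => tint r s al).
    move=> e e0; have [del del0 h] := vanish_increment (within_tint cal) e0.
    exists del => // r s ar rs sb rsd.
    suff -> : tint r s al = tint r b al - tint s b al by exact: h.
    rewrite (@tint_split _ r s b)// ?addrK//.
    by apply: within_sub ar (lexx b) _.
  have := @vanish_bdd _ a b (fun r s => expR `|tint r s al|) (expR (C * `|b - a|)) _ _ vt.
  have bdd r s : a <= r -> r <= s -> s <= b -> `|expR `|tint r s al| | <= expR (C * `|b - a|).
    move=> ar rs sb; rewrite ger0_norm ?expR_ge0// ler_expR.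
    apply: (@le_trans _ _ (C * (s - r))).
      apply: tint_bound => //; first exact: within_sub cal.
      by move=> u /andP[ru us]; apply: hC; rewrite (le_trans ar ru) (le_trans us sb).
    rewrite ler_wpM2l ?(ltW C0)//; apply: (@le_trans _ _ (b - a)); first lra.
    exact: ler_norm.
  move=> /(_ bdd) h e e0; have [del del0 h'] := h e e0.
  by exists del => // r s *; rewrite mulrC; exact: h'.
have s1 := small_vanish_big van (big_tint wgt_ge cal).
have s2 := smallZ wgt_ge (-1) (small_tint wgt_ge cal).
have s3 : sm (fun r s => expR (- tint r s al) - 1 - (- tint r s al)).
  apply: (small_le s1) => r s *; apply: (le_trans (expR_sub1sub_le _)).
  rewrite normrN sqrrN; apply: le_trans (ler_norm _).
  by rewrite le_eqVlt; apply/orP; left; apply/eqP; ring.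
apply: (small_ext (smallD s3 s2)) => r s *; ring.
Qed.

(** The part of the increment that has mean zero given the noise after s: linear terms, with the
    sign - sg because p_r - p_s contains - sg (w_s - w_r), centred squares, and products of distinct
    coordinates. *)
Definition ito_main (r s : R) : R :=
  \sum_k (- sg * at_path (gp k) s) * dw k r s
  + \sum_k (1 / 2 * sg ^+ 2 * at_path (gpp k k) s) * (dw k r s ^+ 2 - (s - r))
  + \sum_(k < d) \sum_(j < d | (j < k)%N)
       (sg ^+ 2 * at_path (gpp j k) s) * (dw j r s * dw k r s).


Lemma sm_gp : sm (fun r s => \sum_k at_path (gp k) s * v k r s
  + (\sum_k at_path (gp k) s * bf s 0 k) * (s - r)
  + sg * \sum_k at_path (gp k) s * dw k r s).
Proof.
have s1 : sm (fun r s => \sum_k at_path (gp k) s * (- 1 * (D k r s - bf s 0 k * (s - r)))).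
  apply: small_sum; first exact: wgt_ge.
  move=> k _; have [C hC] := bounded_at_path (@cgp k).
  apply: (@small_bdd _ _ _ _ wgt_ge (fun _ s => at_path (gp k) s) C).
    by move=> r s ar rs sb; apply: hC; rewrite sb (le_trans ar).
  apply: smallZ; first exact: wgt_ge.
  by apply: small_tint; [exact: wgt_ge|exact: coord_within].
apply: (small_ext s1) => r s ar rs sb.
rewrite mulr_suml mulr_sumr -!big_split/=; apply: eq_bigr => k _.
by rewrite vE//; ring.
Qed.

Lemma sm_gpp : sm (fun r s => \sum_k 1 / 2 * at_path (gpp k k) s * v k r s ^+ 2
  - 1 / 2 * sg ^+ 2 * \sum_k at_path (gpp k k) s * dw k r s ^+ 2).
Proof.
have s1 : sm (fun r s => \sum_k at_path (gpp k k) s *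
    (1 / 2 * (v k r s * v k r s - sg ^+ 2 * (dw k r s * dw k r s)))).
  apply: small_sum; first exact: wgt_ge.
  move=> k _; have [C hC] := bounded_at_path (@cgpp k k).
  apply: (@small_bdd _ _ _ _ wgt_ge (fun _ s => at_path (gpp k k) s) C).
    by move=> r s ar rs sb; apply: hC; rewrite sb (le_trans ar).
  by apply: smallZ; [exact: wgt_ge|exact: sm_vv].
apply: (small_ext s1) => r s ar rs sb.
rewrite mulr_sumr -sumrB; apply: eq_bigr => k _; ring.
Qed.

Lemma sm_gpp_mixed : sm (fun r s =>
  \sum_(k < d) (\sum_(j < d | (j < k)%N) at_path (gpp j k) s * v j r s) * v k r s
  - sg ^+ 2 * \sum_(k < d) \sum_(j < d | (j < k)%N) at_path (gpp j k) s * (dw j r s * dw k r s)).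
Proof.
have s1 : sm (fun r s => \sum_(k < d) \sum_(j < d | (j < k)%N) at_path (gpp j k) s *
    (v j r s * v k r s - sg ^+ 2 * (dw j r s * dw k r s))).
  apply: small_sum; first exact: wgt_ge.
  move=> k _; apply: small_sum; first exact: wgt_ge.
  move=> j _; have [C hC] := bounded_at_path (@cgpp j k).
  apply: (@small_bdd _ _ _ _ wgt_ge (fun _ s => at_path (gpp j k) s) C).
    by move=> r s ar rs sb; apply: hC; rewrite sb (le_trans ar).
  exact: sm_vv.
apply: (small_ext s1) => r s ar rs sb.
rewrite mulr_sumr -sumrB; apply: eq_bigr => k _.
rewrite mulr_suml mulr_sumr -sumrB; apply: eq_bigr => j _; ring.
Qed.

Lemma ito_mainE r s : ito_main r s =
  - (sg * \sum_k at_path (gp k) s * dw k r s)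
  + (1 / 2 * sg ^+ 2 * (\sum_k at_path (gpp k k) s * dw k r s ^+ 2)
     - 1 / 2 * sg ^+ 2 * (\sum_k at_path (gpp k k) s) * (s - r))
  + sg ^+ 2 * \sum_(k < d) \sum_(j < d | (j < k)%N) at_path (gpp j k) s * (dw j r s * dw k r s).
Proof.
rewrite /ito_main; congr (_ + _ + _).
- by rewrite mulr_sumr -sumrN; apply: eq_bigr => k _; ring.
- rewrite mulr_sumr mulr_sumr mulr_suml -sumrB; apply: eq_bigr => k _; ring.
- rewrite mulr_sumr; apply: eq_bigr => k _; rewrite mulr_sumr; apply: eq_bigr => j _; ring.
Qed.

Theorem ito_path : sm (fun r s =>
  expR (- tint r b al) * at_path g r - expR (- tint s b al) * at_path g s
  - expR (- tint s b al) * ito_main r s).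
Proof.
have [CG hG] := bounded_at_path cg.
have s7 : sm (fun r s => at_path g r * (expR (- tint r s al) - 1 + al s * (s - r))).
  apply: (@small_bdd _ _ _ _ wgt_ge (fun r _ => at_path g r) CG) sm_exp.
  by move=> r s ar rs sb; apply: hG; rewrite ar (le_trans rs).
have [Ca _ ha] := within_bounded cal.
(* The expansion of the exponential is multiplied by g at r, whereas the equation holds at s; the
   discrepancy is a vanishing increment times a term of order s - r. *)
have s8 : sm (fun r s => (at_path g r - at_path g s) * (al s * (s - r))).
  apply: small_vanish_big; first exact: vanish_increment (within_at_path cg).
  apply: (@big_lin _ _ _ _ wgt_ge Ca) => r s ar rs sb.
  rewrite normrM (ger0_norm (_ : 0 <= s - r)) ?subr_ge0//.
  by rewrite ler_wpM2r ?subr_ge0// ha// sb (le_trans ar).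
have [CE _ hE] := within_bounded within_En.
have sG := smallD (smallD (smallD sm_time sm_pos) sm_mom)
  (smallD sm_gp (smallD sm_gpp sm_gpp_mixed)).
have sT := smallB wgt_ge (smallD s7 sG) s8.
have := @small_bdd _ _ _ _ wgt_ge (fun _ s => expR (- tint s b al)) CE _ _ sT.
have bE r s : a <= r -> r <= s -> s <= b -> `|expR (- tint s b al)| <= CE.
  by move=> ar rs sb; apply: hE; rewrite sb (le_trans ar).
move=> /(_ bE) sF; apply: (small_ext sF) => r s ar rs sb.
have sab : a <= s <= b by rewrite sb (le_trans ar).
have -> : expR (- tint r b al) = expR (- tint s b al) * expR (- tint r s al).
  rewrite -expRD -opprD addrC (@tint_split _ r s b)//.
  exact: within_sub ar (lexx b) cal.
rewrite ito_mainE -(pde sab) /v.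
rewrite (_ : g r (qs r) (ps r) = at_path g r)// (_ : g s (qs s) (ps s) = at_path g s)//.
by ring.
Qed.

End ito_path.

(** * The density weighted by the Maxwell factor *)

Section continuous_real_functions.
Context (R : realType) (T : topologicalType).
Implicit Types f g : T -> R.

Lemma continuous_mulr f g : continuous f -> continuous g -> continuous (fun x => f x * g x).
Proof. by move=> cf cg x; apply: cvgM; [exact: cf|exact: cg]. Qed.

Lemma continuous_addr f g : continuous f -> continuous g -> continuous (fun x => f x + g x).
Proof. by move=> cf cg x; apply: cvgD; [exact: cf|exact: cg]. Qed.

Lemma continuous_sumr (I : Type) (l : seq I) (f : I -> T -> R) :
  (forall i, continuous (f i)) -> continuous (fun x => \sum_(i <- l) f i x).
Proof.
move=> cf; elim: l => [|i l IH].
  by under eq_fun do rewrite big_nil; exact: cst_continuous.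
by under eq_fun do rewrite big_cons; exact: continuous_addr.
Qed.

Lemma continuous_expr f : continuous f -> continuous (fun x => expR (f x)).
Proof. by move=> cf x; apply: cvg_comp; [exact: cf|exact: continuous_expR]. Qed.

End continuous_real_functions.

Section weighted_density.
Context (R : realType) (d : nat).

(** Reduces a directional derivative to a derivative of one real variable, where the rules for
    polynomials and the exponential apply. *)
Lemma is_derive_of_line (F : 'rV[R]_d -> R) (v x : 'rV[R]_d) (l : R) :
  is_derive (0 : R) 1 (fun t => F (t *: v + x)) l -> is_derive x v F l.
Proof.
move=> [dF eF].
have E : (fun h : R => h^-1 *: (((fun t => F (t *: v + x)) \o shift 0) (h *: 1) - F (0 *: v + x)))
   = (fun h => h^-1 *: ((F \o shift x) (h *: v) - F x)).
  apply/funext => h; congr (_ *: (_ - _)); last by rewrite scale0r add0r.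
  by rewrite /shift /= addr0 [_ *: 1]mulr1.
split; first by rewrite /derivable /= in dF *; rewrite -E.
by rewrite -eF /derive E.
Qed.

Lemma is_derive_coord (j k : 'I_d) (x : 'rV[R]_d) :
  is_derive x (basis_vec R j) (fun y => y 0 k) (j == k)%:R.
Proof.
apply: is_derive_of_line.
have -> : (fun t : R => (t *: basis_vec R j + x) 0 k) = (fun t => t * (j == k)%:R + x 0 k).
  by apply/funext => t; rewrite !mxE eqxx/= eq_sym.
by apply: is_derive_eq; rewrite /GRing.scale/=; ring.
Qed.

Lemma normsq_line (j : 'I_d) (x : 'rV[R]_d) (t : R) :
  normsq (t *: basis_vec R j + x) = normsq x + 2 * t * x 0 j + t ^+ 2.
Proof.
rewrite /normsq /dotp (bigD1 j)//= [in RHS](bigD1 j)//= !mxE !eqxx/=.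
have -> : \sum_(i < d | i != j) (t *: basis_vec R j + x) 0 i * (t *: basis_vec R j + x) 0 i
   = \sum_(i < d | i != j) x 0 i * x 0 i.
  by apply: eq_bigr => i ij; rewrite !mxE eqxx (negbTE ij)/= mulr0 add0r.
ring.
Qed.

Variables (m tau beta : R).

Definition mbw (p : 'rV[R]_d) : R := expR (beta * normsq p / (2 * m)).

Lemma is_derive_mbw (j : 'I_d) (p : 'rV[R]_d) :
  is_derive p (basis_vec R j) mbw (beta / m * p 0 j * mbw p).
Proof.
apply: is_derive_of_line; rewrite /mbw.
have -> : (fun t : R => expR (beta * normsq (t *: basis_vec R j + p) / (2 * m))) =
   expR \o (fun t => beta * (normsq p + 2 * t * p 0 j + t ^+ 2) / (2 * m)).
  by apply/funext => t /=; rewrite normsq_line.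
have h : is_derive (0 : R) 1 (fun t => beta * (normsq p + 2 * t * p 0 j + t ^+ 2) / (2 * m))
   (beta / m * p 0 j).
  apply: is_derive_eq; rewrite /GRing.scale/= invfM.
  by set i := m^-1; field.
apply: is_derive_eq; rewrite /GRing.scale/= mulr0 mul0r expr0n/= !addr0.
by ring.
Qed.

Hypotheses (hm : 0 < m) (htau : 0 < tau) (hbeta : 0 < beta).
Variables (ti : R) (U : R -> 'rV[R]_d -> R) (rho : R -> 'rV[R]_d -> 'rV[R]_d -> R).
Hypothesis hrho : fokker_planck_solution m tau beta ti U rho.

Definition wden s q p := mbw p * rho s q p.
Definition wden_t s q p := mbw p * derive1 (fun u : R => rho u q p) s.
Definition wden_q (k : 'I_d) s q p := mbw p * partial k (fun y => rho s y p) q.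
Definition wden_p (k : 'I_d) s q p :=
  mbw p * (partial k (rho s q) p + beta / m * p 0 k * rho s q p).
Definition wden_pp (j k : 'I_d) s q p :=
  mbw p * (partial j (partial k (rho s q)) p + beta / m * p 0 k * partial j (rho s q) p
    + beta / m * (j == k)%:R * rho s q p
    + beta / m * p 0 j * (partial k (rho s q) p + beta / m * p 0 k * rho s q p)).

Lemma is_derive_wden_t (s : R) q p : ti < s ->
  is_derive s 1 (fun u => wden u q p) (wden_t s q p).
Proof.
move=> ts; have [[h _ _ _] _ _ _] := hrho.
have hs : is_derive s 1 (fun u : R => rho u q p) (derive1 (fun u : R => rho u q p) s).
  by rewrite derive1E; apply: derivableP; exact: h.
rewrite /wden /wden_t; apply: is_derive_eq; rewrite /GRing.scale/=; ring.
Qed.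

Let is_derive_rho_q k s q p : ti < s ->
  is_derive q (basis_vec R k) (fun y => rho s y p) (partial k (fun y => rho s y p) q).
Proof.
move=> ts; have [[_ h _ _] _ _ _] := hrho.
by apply: derivableP; have [] := h s q p k ts.
Qed.

Let is_derive_rho_p k s q p : ti < s ->
  is_derive p (basis_vec R k) (rho s q) (partial k (rho s q) p).
Proof.
move=> ts; have [[_ h _ _] _ _ _] := hrho.
by apply: derivableP; have [] := h s q p k ts.
Qed.

Let is_derive_rho_pp j k s q p : ti < s ->
  is_derive p (basis_vec R j) (partial k (rho s q)) (partial j (partial k (rho s q)) p).
Proof.
move=> ts; have [[_ h _ _] _ _ _] := hrho.
by apply: derivableP; have [_ _ ] := h s q p j ts; apply.
Qed.

Lemma is_derive_wden_q k s q p : ti < s ->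
  is_derive q (basis_vec R k) (fun y => wden s y p) (wden_q k s q p).
Proof.
move=> ts; have h := is_derive_rho_q k q p ts.
rewrite /wden /wden_q; apply: is_derive_eq; rewrite /GRing.scale/=; ring.
Qed.

Lemma is_derive_wden_p k s q p : ti < s ->
  is_derive p (basis_vec R k) (wden s q) (wden_p k s q p).
Proof.
move=> ts; have h := is_derive_rho_p k q p ts; have h2 := is_derive_mbw k p.
rewrite /wden /wden_p.
have := is_deriveM h2 h; rewrite /GRing.scale/= => h3.
by apply: is_derive_eq h3 _; ring.
Qed.

Lemma is_derive_wden_pp j k s q p : ti < s ->
  is_derive p (basis_vec R j) (wden_p k s q) (wden_pp j k s q p).
Proof.
move=> ts; have h1 := is_derive_rho_p j q p ts; have h2 := is_derive_mbw j p.
have h3 := is_derive_rho_pp j k q p ts; have h4 := is_derive_coord j k p.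
have h5 := is_deriveM (is_deriveZ (beta / m) h4) h1.
have := is_deriveM h2 (is_deriveD h3 h5); rewrite /GRing.scale/= => h6.
apply: is_derive_eq h6 _; rewrite /wden_pp.
have -> : (partial k (rho s q) + (beta / m) \*: (fun y : 'rV_d => y 0 k) * rho s q) p =
  partial k (rho s q) p + beta / m * p 0 k * rho s q p by [].
by rewrite -[(beta / m) *: p 0 k]/(beta / m * p 0 k); ring.
Qed.

(** Differentiating the Maxwell weight adds (beta / m) p to each momentum derivative. As
    noise_amplitude^2 / 2 = m / (beta tau), the Laplacian then yields (2 / tau) p . d_p rho, of
    which the drift p / tau takes one half, the term (d / tau) rho of the friction divergence, and a
    multiple of |p|^2 rho that the drift also produces. The force acting on the weight gives - (beta
    / m) <dU, p>, which the zeroth-order term cancels. *)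
Lemma wden_pde s q p : ti < s ->
  wden_t s q p + \sum_k wden_q k s q p * (m^-1 * p 0 k)
  + \sum_k wden_p k s q p * (drift_flat tau U s q p) 0 k
  + (beta / m * dotp (grad (U s) q) p) * wden s q p
  = 1 / 2 * noise_amplitude m tau beta ^+ 2 * \sum_k wden_pp k k s q p.
Proof.
move=> ts; have [_ _ _ /(_ s q p ts)] := hrho.
rewrite /fokker_planck /noise_amplitude sqr_sqrtr; last first.
  by rewrite divr_ge0 ?mulr_ge0 ?ltW.
have divE : divergence (fun y => rho s q y *: (tau^-1 *: y)) p =
   tau^-1 * (\sum_k p 0 k * partial k (rho s q) p) + tau^-1 * d%:R * rho s q p.
  rewrite /divergence mulr_sumr.
  have -> : tau^-1 * d%:R * rho s q p = \sum_(k < d) tau^-1 * rho s q p.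
    by rewrite sumr_const card_ord -[RHS]mulr_natl; ring.
  rewrite -big_split/=; apply: eq_bigr => k _.
  have h1 := is_derive_rho_p k q p ts; have h4 := is_derive_coord k k p.
  have := is_deriveM h1 (is_deriveZ tau^-1 h4); rewrite eqxx.
  rewrite /partial => h.
  have -> : (fun y : 'rV_d => (rho s q y *: (tau^-1 *: y)) 0 k) =
    rho s q * (tau^-1 \*: (fun y : 'rV[R]_d => y 0 k)).
    by apply/funext => y; rewrite !mxE.
  rewrite derive_val /GRing.scale/= -[_ *: p 0 k]/(tau^-1 * p 0 k).
  by ring.
rewrite divE /laplacian /dotp.
set N := \sum_k p 0 k * p 0 k.
set S1 := \sum_k p 0 k * partial k (rho s q) p.
set L := \sum_(i < d) partial i (partial i (rho s q)) p.
have -> : \sum_(i < d) (m^-1 *: p) 0 i * grad (fun y => rho s y p) q 0 i =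
    m^-1 * \sum_k p 0 k * partial k (fun y => rho s y p) q.
  by rewrite mulr_sumr; apply: eq_bigr => k _; rewrite !mxE mulrA.
set Q := \sum_k p 0 k * partial k (fun y => rho s y p) q.
have -> : \sum_(i < d) grad (U s) q 0 i * grad (rho s q) p 0 i =
    \sum_k grad (U s) q 0 k * partial k (rho s q) p.
  by apply: eq_bigr => k _; rewrite [grad (rho s q) p 0 k]mxE.
set S2 := \sum_k grad (U s) q 0 k * partial k (rho s q) p.
set S3 := \sum_(i < d) grad (U s) q 0 i * p 0 i.
have -> : \sum_k wden_q k s q p * (m^-1 * p 0 k) = mbw p * (m^-1 * Q).
  by rewrite /Q !mulr_sumr; apply: eq_bigr => k _; rewrite /wden_q; ring.
have -> : \sum_k wden_p k s q p * drift_flat tau U s q p 0 k =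
  mbw p * (tau^-1 * S1 - S2 + beta / m * rho s q p * (tau^-1 * N - S3)).
  rewrite /S1 /S2 /S3 /N !mulr_sumr -!sumrB mulr_sumr -big_split/= mulr_sumr.
  by apply: eq_bigr => k _; rewrite /wden_p /drift_flat !mxE; ring.
have -> : \sum_k wden_pp k k s q p =
  mbw p * (L + 2 * beta / m * S1 + d%:R * (beta / m) * rho s q p + (beta / m) ^+ 2 * N * rho s q p).
  have -> : d%:R * (beta / m) * rho s q p = \sum_(k < d) beta / m * rho s q p.
    by rewrite sumr_const card_ord -[RHS]mulr_natl; ring.
  rewrite /L /S1 /N !mulr_sumr mulr_suml -!big_split/= mulr_sumr.
  by apply: eq_bigr => k _; rewrite /wden_pp eqxx/=; ring.
rewrite /wden_t /wden => fp.
have m0 : m != 0 by rewrite gt_eqF. 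
have t0 : tau != 0 by rewrite gt_eqF. 
have b0 : beta != 0 by rewrite gt_eqF.
set dt := derive1 _ _ in fp *; set rr := rho s q p in fp *.
have -> : dt = - (m^-1 * Q) + S2 + (tau^-1 * S1 + tau^-1 * d%:R * rr) + m / (beta * tau) * L.
  by move: fp; lra.
by field; rewrite m0 t0 b0.
Qed.

Let cts_after (f : R -> 'rV[R]_d -> 'rV[R]_d -> R) (c : 'rV[R]_d -> R) :
  continuous c -> continuous_after ti f ->
  continuous_after ti (fun s q p => c p * f s q p).
Proof.
move=> cc cf z tz; apply: cvgM; last exact: cf.
by apply: (@cvg_comp _ _ _ snd c); [exact: cvg_snd|exact: cc].
Qed.

Let cts_add (f g : R -> 'rV[R]_d -> 'rV[R]_d -> R) :
  continuous_after ti f -> continuous_after ti g ->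
  continuous_after ti (fun s q p => f s q p + g s q p).
Proof. by move=> cf cg z tz; apply: cvgD; [exact: cf|exact: cg]. Qed.

Lemma continuous_normsq : continuous (@normsq R d).
Proof.
apply: continuous_sumr => i.
by apply: continuous_mulr; exact: coord_continuous.
Qed.

Lemma continuous_mbw : continuous mbw.
Proof.
apply: continuous_expr; apply: continuous_mulr; last exact: cst_continuous.
by apply: continuous_mulr; [exact: cst_continuous|exact: continuous_normsq].
Qed.

Let continuous_rho : continuous_after ti rho.
Proof.
move=> z tz; have [_ cr _ _] := hrho.
have /subspace_continuousP/(_ z (ltW tz)) h := cr.
move=> V /h hV.
have nz : \forall z' \near z, ti <= z'.1.1.
  have c1 : z'.1.1 @[z' --> z] --> z.1.1.
    by apply: (@cvg_comp _ _ _ fst fst); [exact: cvg_fst|exact: cvg_fst].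
  have h2 : nbhs z.1.1 [set u | ti <= u].
    by apply: filterS (lt_nbhsr tz) => u; exact: ltW.
  exact: c1 _ h2.
have hV' : \forall z' \near z, ti <= z'.1.1 -> V (rho z'.1.1 z'.1.2 z'.2) := hV.
have : \forall z' \near z, V (rho z'.1.1 z'.1.2 z'.2); last by [].
by apply: filterS2 hV' nz => z' h1 h2; exact: h1.
Qed.

Lemma continuous_wden : continuous_after ti wden.
Proof. by apply: cts_after; [exact: continuous_mbw|exact: continuous_rho]. Qed.

Lemma continuous_wden_t : continuous_after ti wden_t.
Proof. by apply: cts_after; [exact: continuous_mbw|have [[_ _ ? _] _ _ _] := hrho]. Qed.

Lemma continuous_wden_q k : continuous_after ti (wden_q k).
Proof.
apply: cts_after; first exact: continuous_mbw.
by have [[_ _ _ /(_ k)[]]] := hrho.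
Qed.

Let continuous_coef (k : 'I_d) : continuous (fun p : 'rV[R]_d => beta / m * p 0 k).
Proof. by apply: continuous_mulr; [exact: cst_continuous|exact: coord_continuous]. Qed.

Let continuous_rho_p k : continuous_after ti (fun s q p => partial k (rho s q) p).
Proof. by have [[_ _ _ /(_ k)[]]] := hrho. Qed.

Let continuous_rho_pp j k : continuous_after ti (fun s q p => partial j (partial k (rho s q)) p).
Proof. by have [[_ _ _ /(_ j)[_ _ h]] _ _ _] := hrho; exact: (h k). Qed.

Let cts_p k : continuous_after ti
  (fun s q p => partial k (rho s q) p + beta / m * p 0 k * rho s q p).
Proof.
apply: cts_add; first exact: continuous_rho_p.
by apply: cts_after; [exact: continuous_coef|exact: continuous_rho].
Qed.

Lemma continuous_wden_p k : continuous_after ti (wden_p k).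
Proof. by apply: cts_after; [exact: continuous_mbw|exact: cts_p]. Qed.

Lemma continuous_wden_pp j k : continuous_after ti (wden_pp j k).
Proof.
apply: cts_after; first exact: continuous_mbw.
apply: cts_add; last by apply: cts_after; [exact: continuous_coef|exact: cts_p].
apply: cts_add; last first.
  apply: (@cts_after rho (fun=> beta / m * (j == k)%:R)); last exact: continuous_rho.
  exact: cst_continuous.
apply: cts_add; first exact: continuous_rho_pp.
by apply: cts_after; [exact: continuous_coef|exact: continuous_rho_p].
Qed.

End weighted_density.

(** * Uniform integrability *)

Section uniform_integrability.
Context (R : realType) d (T : measurableType d) (P : probability T R).
Implicit Types X Y : nat -> T -> R.

(** An equivalent form of uniform integrability, in place of the one with truncated tails: it is
    linear in the probability of B, so sums are immediate. *)
Definition ui X := forall e : R, 0 < e -> exists K : R, forall n B, measurable B ->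
  (\int[P]_(x in B) `|X n x|%:E <= e%:E + K%:E * P B)%E.

Definition inprob0 X := forall eta e : R, 0 < eta -> 0 < e ->
  \forall n \near \oo, (P [set x | (eta < `|X n x|)%R] <= e%:E)%E.

Lemma P_fin (B : set T) : measurable B -> P B \is a fin_num.
Proof. by move=> mB; exact: fin_num_measure. Qed.

Lemma measurable_absE (f : T -> R) (D : set T) : measurable_fun setT f ->
  measurable_fun D (fun x => `|f x|%:E).
Proof.
move=> mf; apply: measurable_funTS; apply/measurable_EFinP.
by apply: measurableT_comp => //; exact: normr_measurable.
Qed.

Lemma measurable_gt (f : T -> R) (c : R) : measurable_fun setT f ->
  measurable [set x | c < f x].
Proof.
move=> mf; rewrite (_ : [set _ | _] = f @^-1` `]c, +oo[).
  by rewrite -[_ @^-1` _]setTI; exact: mf.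
by apply/seteqP; split => x /=; rewrite in_itv/= andbT.
Qed.

Lemma measurable_abs_gt (f : T -> R) (c : R) : measurable_fun setT f ->
  measurable [set x | c < `|f x|].
Proof.
by move=> mf; apply: measurable_gt; apply: measurableT_comp => //; exact: normr_measurable.
Qed.

Lemma integral_abs_le_on (f : T -> R) (B : set T) (c : R) : measurable B -> 0 <= c ->
  measurable_fun setT f -> (forall x, B x -> `|f x| <= c) ->
  (\int[P]_(x in B) `|f x|%:E <= c%:E * P B)%E.
Proof.
move=> mB c0 mf fc; rewrite -integral_cst//; apply: ge0_le_integral => //.
- exact: measurable_absE.
Qed.

(** Three thirds of e: the values below e/3, the slack in [ui], and K times the probability of a
    larger value, which is eventually at most (e/3) / (|K| + 1). *)
Lemma vitali X : (forall n, measurable_fun setT (X n)) -> ui X -> inprob0 X ->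
  forall e : R, 0 < e -> \forall n \near \oo, (\int[P]_x `|X n x|%:E <= e%:E)%E.
Proof.
move=> mX uX pX e e0.
have e3 : 0 < e / 3 by rewrite divr_gt0.
have [K hK] := uX _ e3.
have K1 : 0 < `|K| + 1 by rewrite ltr_wpDl.
have := pX (e / 3) (e / 3 / (`|K| + 1)) e3 (divr_gt0 e3 K1).
apply: filterS => n hn.
pose B := [set x | e / 3 < `|X n x|].
have mB : measurable B by exact: measurable_abs_gt.
have -> : (\int[P]_x `|X n x|%:E =
   \int[P]_(x in B) `|X n x|%:E + \int[P]_(x in ~` B) `|X n x|%:E)%E.
  rewrite -ge0_integral_setU//; first by rewrite setUv.
  - exact: measurableC.
  - exact: measurable_absE.
  - by apply/disj_setPS; rewrite setICr.
have h1 : (\int[P]_(x in ~` B) `|X n x|%:E <= (e / 3)%:E)%E.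
  apply: (le_trans (@integral_abs_le_on (X n) (~` B) (e / 3) _ _ _ _)) => //.
  - exact: measurableC.
  - exact: ltW.
  - by move=> x /= /negP; rewrite -leNgt.
  - rewrite -[leRHS]mule1; apply: lee_wpmul2l; first by rewrite lee_fin ltW.
    by apply: probability_le1; exact: measurableC.
have h2 : (\int[P]_(x in B) `|X n x|%:E <= (e / 3 + e / 3)%:E)%E.
  apply: (le_trans (hK n B mB)); rewrite EFinD leeD2l//.
  apply: (@le_trans _ _ ((`|K| + 1)%:E * P B)%E).
    by apply: lee_wpmul2r => //; rewrite lee_fin (le_trans (ler_norm _))// lerDl.
  apply: (@le_trans _ _ ((`|K| + 1)%:E * (e / 3 / (`|K| + 1))%:E)%E).
    by apply: lee_wpmul2l => //; rewrite lee_fin ltW.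
  by rewrite -EFinM mulrC divfK// gt_eqF.
apply: (le_trans (leeD h2 h1)); rewrite -EFinD lee_fin.
by rewrite le_eqVlt; apply/orP; left; apply/eqP; field.
Qed.

Lemma uiD X Y : (forall n, measurable_fun setT (X n)) -> (forall n, measurable_fun setT (Y n)) ->
  ui X -> ui Y -> ui (fun n x => X n x + Y n x).
Proof.
move=> mX mY uX uY e e0; have e2 : 0 < e / 2 by rewrite divr_gt0.
have [K1 h1] := uX _ e2; have [K2 h2] := uY _ e2.
exists (K1 + K2) => n B mB.
apply: (@le_trans _ _ (\int[P]_(x in B) (`|X n x|%:E + `|Y n x|%:E))%E).
  apply: ge0_le_integral => //.
  - by apply: measurable_absE; exact: measurable_funD.
  - by apply: emeasurable_funD; exact: measurable_absE.
  - by move=> x _; rewrite -EFinD lee_fin ler_normD.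
rewrite ge0_integralD//; [|exact: measurable_absE..].
apply: (le_trans (leeD (h1 n B mB) (h2 n B mB))).
rewrite -(fineK (P_fin mB)) -!(EFinM, EFinD) lee_fin.
by rewrite le_eqVlt; apply/orP; left; apply/eqP; field.
Qed.

Lemma uiN X : ui X -> ui (fun n x => - X n x).
Proof.
move=> uX e e0; have [K h] := uX e e0; exists K => n B mB.
by under eq_integral do rewrite normrN; exact: h.
Qed.

Lemma ui_cst (c : R) : ui (fun _ _ => c).
Proof.
move=> e e0; exists `|c| => n B mB; rewrite integral_cst// leeDr// lee_fin ltW//.
Qed.

(** Pointwise |x| <= l x^2 + 1/l. With l = e / (|C| + 1) the first term integrates to at most e, and
    1/l serves as the constant of [ui]. *)
Lemma ui_sqr X (C : R) : (forall n, measurable_fun setT (X n)) ->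
  (forall n, (\int[P]_x (X n x ^+ 2)%:E <= C%:E)%E) -> ui X.
Proof.
move=> mX hC e e0.
have C1 : 0 < `|C| + 1 by rewrite ltr_wpDl.
pose l := e / (`|C| + 1); have l0 : 0 < l by rewrite divr_gt0.
exists l^-1 => n B mB.
apply: (@le_trans _ _ (\int[P]_(x in B) (l%:E * (X n x ^+ 2)%:E + l^-1%:E))%E).
  apply: ge0_le_integral => //.
  - exact: measurable_absE.
  - apply: emeasurable_funD => //; apply: measurable_funeM; apply/measurable_EFinP.
    by apply: measurable_funTS; exact: measurable_funX.
  - move=> x _; rewrite -EFinM -EFinD lee_fin -(real_normK (num_real (X n x))).
    have [h|h] := leP `|X n x| l^-1.
      apply: (le_trans h); rewrite lerDr; apply: mulr_ge0; [exact: ltW|exact: exprn_ge0].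
    have : 1 <= l * `|X n x| by rewrite -ler_pdivrMl// mulr1 ltW.
    move=> h1; have li : 0 < l^-1 by rewrite invr_gt0.
    have : 1 * `|X n x| <= l * `|X n x| * `|X n x| by rewrite ler_wpM2r.
    by rewrite mul1r -mulrA -expr2; lra.
have mX2 D : measurable_fun D (fun x => (X n x ^+ 2)%:E).
  by apply/measurable_EFinP; apply: measurable_funTS; exact: measurable_funX.
rewrite ge0_integralD//; last 3 first.
- by move=> x _; rewrite -EFinM lee_fin mulr_ge0 ?sqr_ge0// ltW.
- by apply: measurable_funeM.
- by move=> x _; rewrite lee_fin invr_ge0 ltW.
rewrite integral_cst// leeD2r// ge0_integralZl//; last 2 first.
- by move=> x _; rewrite lee_fin sqr_ge0.
- by rewrite lee_fin ltW.
apply: (@le_trans _ _ (l%:E * C%:E)%E).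
  apply: lee_wpmul2l; first by rewrite lee_fin ltW.
  apply: le_trans (hC n); apply: ge0_subset_integral => //.
  by move=> x _; rewrite lee_fin sqr_ge0.
rewrite -EFinM lee_fin /l mulrAC ler_pdivrMr// ler_wpM2l ?(ltW e0)//.
by rewrite (le_trans (ler_norm _))// lerDl.
Qed.

Lemma ui_integrable X n : measurable_fun setT (X n) -> ui X ->
  P.-integrable setT (EFin \o X n).
Proof.
move=> mX uX; apply/integrableP; split; first exact/measurable_EFinP.
have [K h] := uX 1 ltr01; apply: le_lt_trans (h n setT measurableT) _.
by rewrite probability_setT mule1 -EFinD ltry.
Qed.

(** Dominated convergence for the indicators of the events, each of which vanishes eventually at
    every point. *)
Lemma pointwise_inprob0 X : (forall n, measurable_fun setT (X n)) ->
  (forall x, (X ^~ x) @ \oo --> (0 : R)) -> inprob0 X.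
Proof.
move=> mX cX eta e eta0 e0.
have mB n : measurable [set x | eta < `|X n x|] by exact: measurable_abs_gt.
have : (\int[P]_x (\1_[set x | (eta < `|X n x|)%R] x)%:E @[n --> \oo] --> \int[P]_x (0 : \bar R))%E.
  apply: (@dominated_cvg _ _ _ P setT measurableT _ _ (EFin \o cst 1)) => //.
  - by move=> n; apply/measurable_EFinP; exact: measurable_indic.
  - move=> x _; apply: cvg_near_cst.
    have /cvgrPdist_lt/(_ _ eta0) := cX x; apply: filterS => n; rewrite sub0r normrN => h.
    by rewrite indicE memNset//= => h'; have := lt_trans h h'; rewrite ltxx.
  - exact: finite_measure_integrable_cst.
  - by move=> n x _; rewrite /= lee_fin ger0_norm// indicE; case: (_ \in _).
rewrite integral0 => /fine_cvgP[fn /cvgrPdist_le/(_ _ e0)].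
apply: filterS2 fn => n fn; rewrite sub0r normrN /= => h.
rewrite -[X in P X]setIT -integral_indic// -(fineK fn) lee_fin.
exact: le_trans (ler_norm _) h.
Qed.

(** If |X Y| > eta then |X| > eta / A or |Y| > A. By Markov's inequality A = 2 (|C| + 1) / e makes
    the second event of probability at most e / 2. *)
Lemma inprob0_mul X Y (C : R) : (forall n, measurable_fun setT (X n)) ->
  (forall n, measurable_fun setT (Y n)) ->
  inprob0 X -> (forall n, (\int[P]_x `|Y n x|%:E <= C%:E)%E) ->
  inprob0 (fun n x => X n x * Y n x).
Proof.
move=> mX mY pX hY eta e eta0 e0.
have C1 : 0 < `|C| + 1 by rewrite ltr_wpDl.
pose A := 2 * (`|C| + 1) / e; have A0 : 0 < A by rewrite divr_gt0// mulr_gt0.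
have e2 : 0 < e / 2 by rewrite divr_gt0.
apply: filterS (pX (eta / A) (e / 2) (divr_gt0 eta0 A0) e2) => n hn.
have sub : [set x | eta < `|X n x * Y n x|] `<=`
   [set x | eta / A < `|X n x|] `|` [set x | A < `|Y n x|].
  move=> x /=; rewrite normrM => h.
  have [|xa] := ltP (eta / A) `|X n x|; first by left.
  right; rewrite ltNge; apply/negP => ya.
  have : `|X n x| * `|Y n x| <= eta / A * A by exact: ler_pM.
  by rewrite divfK ?gt_eqF// leNgt h.
have hAY : (P [set x | (A < `|Y n x|)%R] <= (e / 2)%:E)%E.
  have mA : measurable [set x | A < `|Y n x|] by exact: measurable_abs_gt.
  have : (A%:E * P [set x | (A < `|Y n x|)%R] <= C%:E)%E.
    rewrite -integral_cst//; apply: le_trans (hY n).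
    apply: (@le_trans _ _ (\int[P]_(x in [set x | (A < `|Y n x|)%R]) `|Y n x|%:E)%E).
      apply: ge0_le_integral => //.
      - by move=> x _; rewrite lee_fin ltW.
      - exact: measurable_absE.
      - by move=> x /= /ltW; rewrite lee_fin.
    by apply: ge0_subset_integral => //; exact: measurable_absE.
  rewrite -(fineK (P_fin mA)) -EFinM !lee_fin => h.
  have : A * fine (P [set x | A < `|Y n x|]) <= A * (e / 2).
    apply: (le_trans h); rewrite /A.
    have -> : 2 * (`|C| + 1) / e * (e / 2) = `|C| + 1 by field; rewrite gt_eqF.
    by rewrite (le_trans (ler_norm _))// lerDl.
  by rewrite ler_pM2l.
apply: (@le_trans _ _ (P ([set x | eta / A < `|X n x|] `|` [set x | A < `|Y n x|]))).
  apply: le_measure; rewrite ?inE//.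
    by apply: measurable_abs_gt; exact: measurable_funM.
  by apply: measurableU; exact: measurable_abs_gt.
apply: (le_trans (measureU2 _ _ _)); [exact: measurable_abs_gt..|].
by rewrite (splitr e) EFinD leeD.
Qed.

Lemma ui_cvg X (Z : T -> R) : (forall n, measurable_fun setT (X n)) -> measurable_fun setT Z ->
  ui X -> ui (fun _ => Z) -> (forall x, (X ^~ x) @ \oo --> Z x) ->
  (fun n => (\int[P]_x (X n x))%R) @ \oo --> (\int[P]_x Z x)%R.
Proof.
move=> mX mZ uX uZ cX.
have iX n : P.-integrable setT (EFin \o X n) by exact: ui_integrable.
have iZ : P.-integrable setT (EFin \o Z) by exact: (@ui_integrable (fun _ => Z) 0).
have mXZ n : measurable_fun setT (fun x => X n x - Z x) by exact: measurable_funB.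
have p0 : inprob0 (fun n x => X n x - Z x).
  by apply: pointwise_inprob0 => // x; apply/subr_cvg0; exact: cX.
have uXZ : ui (fun n x => X n x - Z x).
  by apply: uiD => //; [move=> n; exact: measurableT_comp|exact: uiN].
apply/cvgrPdist_le => e e0.
apply: filterS (vitali mXZ uXZ p0 e0) => n.
rewrite distrC -RintegralB// => h; rewrite -lee_fin; apply: le_trans h.
have iXZ : P.-integrable setT (EFin \o (fun x => X n x - Z x)).
  by apply: (@ui_integrable (fun n x => X n x - Z x)).
rewrite EFin_normr_Rintegral//; apply: le_abse_integral => //.
by apply/measurable_EFinP.
Qed.

End uniform_integrability.

(** * Means of stopped discrete martingales *)

(** Replacing y by max(1, y) makes the inverse continuous on the whole line without changing it on
    the range of f. *)
Lemma measurable_inv_ge1 (R : realType) d (T : measurableType d) (f : T -> R) :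
  measurable_fun setT f -> (forall x, 1 <= f x) -> measurable_fun setT (fun x => (f x)^-1).
Proof.
move=> mf f1.
have -> : (fun x => (f x)^-1) = (fun y => (Num.max 1 y)^-1) \o f.
  by apply/funext => x /=; rewrite max_r.
apply: measurableT_comp => //; apply: continuous_measurable_fun => y.
apply: cvgV; first by rewrite gt_eqF// lt_max ltr01.
by apply: (@continuous_max R R (fun=> 1) id y); [exact: cvg_cst|exact: cvg_id].
Qed.

Section discrete_martingale.
Context (R : realType) (disp : measure_display) (Om : measurableType disp).
Variables (P : probability Om R) (a b : R) (L : finType).
Variables (Gn : R -> set (set Om)) (M : R -> Om -> R) (M0 : R).
Variables (c : L -> R -> Om -> R) (Y : L -> R -> R -> Om -> R) (W : R -> R -> Om -> R).
Variables (CY CW : R).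

(** Time runs backward: what is known at s is the noise at later times. The generated sigma-algebra
    is used as a structure on the sample space, so that the closure properties of measurable
    functions apply verbatim. *)
Definition past (s : R) (X : Om -> R) : Prop :=
  @measurable_fun _ _ (g_sigma_algebraType (Gn s)) R setT X.

(** With the clock running down from b, the event s <= T says that stopping has occurred by the time
    s is reached. *)
Definition stopping (T : Om -> R) : Prop :=
  (forall om, a <= T om <= b) /\
  (forall s, a <= s -> s <= b -> (<<s Gn s >>) [set om | s <= T om]).

Hypothesis ab : a < b.
Hypothesis F_mono : forall r s, a <= r -> r <= s -> s <= b -> <<s Gn s >> `<=` <<s Gn r >>.
Hypothesis F_sub : forall s, a <= s -> s <= b -> <<s Gn s >> `<=` @measurable _ Om.
Hypothesis pM : forall s, a <= s -> s <= b -> past s (M s).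
Hypothesis Mb : forall om, M b om = M0.
Hypothesis pc : forall l s, a <= s -> s <= b -> past s (c l s).
Hypothesis bc : forall om, exists K, forall l s, a <= s -> s <= b -> `|c l s om| <= K.
Hypothesis pY : forall l r s, a <= r -> r < s -> s <= b -> past r (Y l r s).
Hypothesis iY2 : forall l r s, a <= r -> r < s -> s <= b ->
  P.-integrable setT (EFin \o (fun om => Y l r s om ^+ 2)).
Hypothesis EY2 : forall l r s, a <= r -> r < s -> s <= b ->
  (\int[P]_om (Y l r s om ^+ 2))%R <= CY * (s - r).
Hypothesis indepY : forall l r s Z, a <= r -> r < s -> s <= b -> past s Z ->
  P.-integrable setT (EFin \o Z) ->
  P.-integrable setT (EFin \o (fun om => Z om * Y l r s om)) /\
  (\int[P]_om (Z om * Y l r s om))%R = 0.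
Hypothesis mW : forall r s, a <= r -> r < s -> s <= b -> measurable_fun setT (W r s).
Hypothesis W0 : forall r s om, a <= r -> r < s -> s <= b -> 0 <= W r s om.
Hypothesis EW : forall r s, a <= r -> r < s -> s <= b ->
  (\int[P]_om (W r s om)%:E <= (CW * (s - r))%:E)%E.
Hypothesis step_small : forall om, small a b (fun r s => W r s om)
  (fun r s => M r om - M s om - \sum_l c l s om * Y l r s om).
Hypothesis MD : forall e : R, 0 < e -> exists K : R, forall T, stopping T ->
  (\int[P]_(om in [set om | (K < `|M (T om) om|)%R]) `|M (T om) om|%:E <= e%:E)%E.

Lemma past_le r s X : a <= r -> r <= s -> s <= b -> past s X -> past r X.
Proof.
move=> ar rs sb pX _ A mA; apply: (F_mono ar rs sb); exact: pX.
Qed.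

Lemma past_measurable s X : a <= s -> s <= b -> past s X -> measurable_fun setT X.
Proof.
move=> as_ sb pX _ A mA; apply: (F_sub as_ sb); exact: pX.
Qed.

Lemma stopping_cst r : a <= r -> r <= b -> stopping (fun=> r).
Proof.
move=> ar rb; split=> [om|s as_ sb]; first by rewrite ar.
have [sr|rs] := leP s r.
  by rewrite (_ : [set _ | _] = setT); [exact: (@measurableT _ (g_sigma_algebraType (Gn s)))|exact/seteqP].
rewrite (_ : [set _ | _] = set0); first exact: (@measurable0 _ (g_sigma_algebraType (Gn s))).
by apply/seteqP; split.
Qed.

(** The index increases as time decreases, in the order in which the filtration grows. *)
Definition bgrid (N k : nat) : R := b - k%:R * ((b - a) / N%:R).

Lemma bgrid0 N : bgrid N 0 = b.
Proof. by rewrite /bgrid mul0r subr0. Qed.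

Lemma bgridN N : (0 < N)%N -> bgrid N N = a.
Proof. by move=> N0; rewrite /bgrid mulrC divfK ?pnatr_eq0 -?lt0n// subKr. Qed.

Lemma bgridS N k : bgrid N k - bgrid N k.+1 = (b - a) / N%:R.
Proof. by rewrite /bgrid -natr1; ring. Qed.

Lemma bgrid_le N i j : (i <= j)%N -> bgrid N j <= bgrid N i.
Proof.
move=> ij; rewrite /bgrid lerB// ler_wpM2r ?ler_nat//.
by rewrite divr_ge0 ?subr_ge0// ltW.
Qed.

Lemma bgrid_lt N k : (0 < N)%N -> bgrid N k.+1 < bgrid N k.
Proof. by move=> N0; rewrite -subr_gt0 bgridS divr_gt0 ?subr_gt0 ?ltr0n. Qed.

Lemma bgrid_lb N k : (k <= N)%N -> (0 < N)%N -> a <= bgrid N k.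
Proof. by move=> kN N0; rewrite -(bgridN N0) bgrid_le. Qed.

Lemma bgrid_ub N k : bgrid N k <= b.
Proof. by rewrite -(bgrid0 N) bgrid_le. Qed.

Definition bad (n N k : nat) (om : Om) : bool := [exists l, n%:R < `|c l (bgrid N k) om|].

(** If no index below N is bad, [find] returns N; the stopping time is then a itself and the
    terminal value of M is reached. *)
Definition J (n N : nat) (om : Om) : nat := find (fun k => bad n N k om) (iota 0 N).

Definition Tst (n N : nat) (om : Om) : R := bgrid N (J n N om).

Lemma J_le n N om : (J n N om <= N)%N.
Proof. by rewrite /J -[X in (_ <= X)%N](size_iota 0 N) find_size. Qed.

Lemma ltJP n N k om : (k < N)%N ->
  (k < J n N om)%N = [forall i : 'I_k.+1, ~~ bad n N i om].
Proof.
move=> kN; apply/idP/forallP => [kJ i|h].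
  have iJ : (i < J n N om)%N by apply: leq_ltn_trans kJ; rewrite -ltnS.
  have := before_find 0%N iJ; rewrite nth_iota ?add0n; first by move=> /negbT.
  exact: leq_trans iJ (J_le _ _ _).
rewrite ltnNge; apply/negP => Jk.
have JN : (J n N om < N)%N by exact: leq_ltn_trans kN.
have hb : has (fun k => bad n N k om) (iota 0 N) by rewrite has_find size_iota.
have := nth_find 0%N hb; rewrite -/(J n N om) nth_iota// add0n.
have Jk1 : (J n N om < k.+1)%N by rewrite ltnS.
by have /negP := h (Ordinal Jk1).
Qed.

Lemma past_bad n N k : (k <= N)%N -> (0 < N)%N ->
  (<<s Gn (bgrid N k) >>) [set om | bad n N k om].
Proof.
move=> kN N0.
have -> : [set om | bad n N k om] =
    \bigcup_(l in [set: L]) [set om | n%:R < `|c l (bgrid N k) om|].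
  by apply/seteqP; split => om /= => [/existsP[l hl]|[l _ hl]]; [exists l|apply/existsP; exists l].
apply: (@fin_bigcup_measurable _ (g_sigma_algebraType (Gn (bgrid N k)))); first exact: finite_finset.
move=> l _; apply: (@measurable_abs_gt _ _ (g_sigma_algebraType (Gn (bgrid N k)))).
exact: pc (bgrid_lb kN N0) (bgrid_ub _ _).
Qed.

Lemma past_alive n N k : (k < N)%N ->
  (<<s Gn (bgrid N k) >>) [set om | (k < J n N om)%N].
Proof.
move=> kN; have N0 : (0 < N)%N by exact: leq_ltn_trans kN.
have -> : [set om | (k < J n N om)%N] = \bigcap_(i in [set: 'I_k.+1]) ~` [set om | bad n N i om].
  apply/seteqP; split => om /=; rewrite ltJP// => h.
    by move=> i _ /=; apply/negP; exact: (forallP h).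
  by apply/forallP => i; apply/negP; exact: h.
apply: (@fin_bigcap_measurable _ (g_sigma_algebraType (Gn (bgrid N k)))); first exact: finite_finset.
move=> i _; apply: (@measurableC _ (g_sigma_algebraType (Gn (bgrid N k)))).
have iN : (i <= N)%N by apply: ltnW; apply: leq_ltn_trans kN; rewrite -ltnS.
apply: (F_mono (s := bgrid N i)).
- exact: bgrid_lb (ltnW kN) N0.
- by apply: bgrid_le; rewrite -ltnS.
- exact: bgrid_ub.
- exact: past_bad.
Qed.

(** For s > a, stopping at or before s means that some grid point of index below N lying above s is
    bad, an event known at s. The index N is excluded because its grid point is a. *)
Lemma stopping_Tst n N : (0 < N)%N -> stopping (Tst n N).
Proof.
move=> N0; split=> [om|s as_ sb].
  by rewrite bgrid_ub bgrid_lb// J_le.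
have [sa|sa] := leP s a.
  rewrite (_ : [set _ | _] = setT); first exact: (@measurableT _ (g_sigma_algebraType (Gn s))).
  by apply/seteqP; split => om //= _; apply: (le_trans sa); exact: bgrid_lb (J_le _ _ _) N0.
have -> : [set om | s <= Tst n N om] =
    \bigcup_(k in [set: 'I_N]) (if s <= bgrid N k then [set om | bad n N k om] else set0).
  apply/seteqP; split => om /=.
    move=> sT; have JN : (J n N om < N)%N.
      rewrite ltn_neqAle J_le andbT; apply/eqP => JN.
      by move: sT; rewrite /Tst JN bgridN// leNgt sa.
    exists (Ordinal JN) => //=; rewrite -/(Tst n N om) sT /=.
    have hb : has (fun k => bad n N k om) (iota 0 N) by rewrite has_find size_iota.
    by have := nth_find 0%N hb; rewrite -/(J n N om) nth_iota.
  move=> [k _]; case: ifP => // sk /= bk; apply: (le_trans sk); apply: bgrid_le.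
  rewrite leqNgt; apply/negP => kJ.
  by have := before_find 0%N kJ; rewrite nth_iota// add0n bk.
apply: (@fin_bigcup_measurable _ (g_sigma_algebraType (Gn s))); first exact: finite_finset.
move=> k _; case: ifP => [sk|_]; last exact: (@measurable0 _ (g_sigma_algebraType (Gn s))).
apply: (F_mono as_ sk (bgrid_ub _ _)); apply: past_bad => //; exact: ltnW.
Qed.

Definition alive (n N k : nat) (om : Om) : R := (k < J n N om)%N%:R.

(** Coefficient switched off from the stopping index on. While it is on, index k itself has been
    tested, so it is bounded by n; the test uses only what is known at the k-th grid point. *)
Definition xi (n N k : nat) (l : L) (om : Om) : R := alive n N k om * c l (bgrid N k) om.

Definition incr (n N k : nat) (om : Om) : R :=
  \sum_l xi n N k l om * Y l (bgrid N k.+1) (bgrid N k) om.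

Definition mart (n N j : nat) (om : Om) : R := \sum_(k < j) incr n N k om.

Lemma past_alive_fun n N k : (k < N)%N -> past (bgrid N k) (alive n N k).
Proof.
move=> kN; rewrite /past.
rewrite (_ : alive n N k = \1_[set om | (k < J n N om)%N]).
  exact: (@measurable_indic _ (g_sigma_algebraType (Gn (bgrid N k))) R setT _ (past_alive n kN)).
apply/funext => om; rewrite /alive indicE; congr ((nat_of_bool _)%:R).
by apply/idP/idP => h; [exact/mem_set|exact: set_mem h].
Qed.

Lemma past_xi n N k l : (k < N)%N -> past (bgrid N k) (xi n N k l).
Proof.
move=> kN; have N0 : (0 < N)%N by exact: leq_ltn_trans kN.
apply: measurable_funM; first exact: past_alive_fun.
by apply: pc; [exact: bgrid_lb (ltnW kN) N0|exact: bgrid_ub].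
Qed.

Lemma xi_bound n N k l om : (k < N)%N -> `|xi n N k l om| <= n%:R.
Proof.
move=> kN; rewrite /xi /alive normrM; case: (ltnP k (J n N om)) => [|_]; last first.
  by rewrite normr0 mul0r.
rewrite ltJP// => /forallP/(_ ord_max); rewrite /bad negb_exists => /forallP/(_ l).
by rewrite -leNgt normr1 mul1r.
Qed.

Lemma integrable_bddM (f g : Om -> R) (K : R) : measurable_fun setT f ->
  (forall om, `|f om| <= K) -> P.-integrable setT (EFin \o g) ->
  P.-integrable setT (EFin \o (fun om => f om * g om)).
Proof.
move=> mf fK ig.
have mg : measurable_fun setT g by apply/measurable_EFinP; exact: measurable_int ig.
have ig' : P.-integrable setT (fun om => (K%:E * (EFin \o g) om)%E) by exact: integrableZl.
apply: le_integrable ig' => //.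
  by apply/measurable_EFinP; exact: measurable_funM.
move=> om _ /=; rewrite lee_fin !normrM ler_wpM2r//.
exact: le_trans (fK om) (ler_norm _).
Qed.

Lemma integrable_mul_sqr (f g : Om -> R) : measurable_fun setT f -> measurable_fun setT g ->
  P.-integrable setT (EFin \o (fun om => f om ^+ 2)) ->
  P.-integrable setT (EFin \o (fun om => g om ^+ 2)) ->
  P.-integrable setT (EFin \o (fun om => f om * g om)).
Proof.
move=> mf mg i1 i2; have i3 := integrableD measurableT i1 i2.
apply: le_integrable i3 => //.
  by apply/measurable_EFinP; exact: measurable_funM.
move=> om _ /=; rewrite lee_fin normrM [leRHS]ger0_norm ?addr_ge0 ?sqr_ge0//.
rewrite -(real_normK (num_real (f om))) -(real_normK (num_real (g om))).
have := sqr_ge0 (`|f om| - `|g om|); rewrite sqrrB.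
have := sqr_ge0 `|f om|; have := sqr_ge0 `|g om|; lra.
Qed.

Lemma integrable_of_sqr (f : Om -> R) : measurable_fun setT f ->
  P.-integrable setT (EFin \o (fun om => f om ^+ 2)) -> P.-integrable setT (EFin \o f).
Proof.
move=> mf i1.
have i2 : P.-integrable setT (EFin \o (fun om => (cst 1 om : R) ^+ 2)).
  apply: (eq_integrable _ (EFin \o cst 1)) => //; last exact: finite_measure_integrable_cst.
  by move=> om _ /=; rewrite expr1n.
have := integrable_mul_sqr mf (measurable_cst _) i1 i2.
by apply: eq_integrable => // om _ /=; rewrite mulr1.
Qed.

Lemma integrable_sumr (I : Type) (l : seq I) (f : I -> Om -> R) :
  (forall i, P.-integrable setT (EFin \o f i)) ->
  P.-integrable setT (EFin \o (fun om => \sum_(i <- l) f i om)) /\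
  (\int[P]_om (\sum_(i <- l) f i om))%R = \sum_(i <- l) (\int[P]_om f i om)%R.
Proof.
move=> hf; elim: l => [|i l [IH1 IH2]].
  split.
    apply: (eq_integrable _ (EFin \o cst 0)) => //; last exact: finite_measure_integrable_cst.
    by move=> om _ /=; rewrite big_nil.
  under eq_Rintegral do rewrite big_nil.
  by rewrite big_nil Rintegral_cst// mul0r.
have i2 := integrableD measurableT (hf i) IH1.
split.
  by apply: eq_integrable i2 => // om _ /=; rewrite big_cons.
under eq_Rintegral do rewrite big_cons.
by rewrite RintegralD// IH2 big_cons.
Qed.

(** One factor #|L| is Cauchy-Schwarz for the sum over L, the other counts its terms. For the last
    clause, Z times the bounded coefficient is again integrable and known at the k-th grid point,
    hence orthogonal to the noise of the next step. *)
Lemma incr_facts n N k : (k < N)%N ->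
  [/\ past (bgrid N k.+1) (incr n N k),
      P.-integrable setT (EFin \o (fun om => incr n N k om ^+ 2)),
      (\int[P]_om (incr n N k om ^+ 2))%R <= #|L|%:R ^+ 2 * n%:R ^+ 2 * CY * ((b - a) / N%:R) &
      forall Z, past (bgrid N k) Z -> P.-integrable setT (EFin \o Z) ->
        P.-integrable setT (EFin \o (fun om => Z om * incr n N k om)) /\
        (\int[P]_om (Z om * incr n N k om))%R = 0].
Proof.
move=> kN; have N0 : (0 < N)%N by exact: leq_ltn_trans kN.
have h1 : a <= bgrid N k.+1 by exact: bgrid_lb.
have h2 := bgrid_lt k N0.
have h3 := bgrid_ub N k.
have h4 : a <= bgrid N k by exact: bgrid_lb (ltnW kN) N0.
have pincr : past (bgrid N k.+1) (incr n N k).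
  apply: measurable_sum => l; apply: measurable_funM; last exact: pY.
  by apply: past_le (past_xi n l kN) => //; exact: ltW.
have mxi l : measurable_fun setT (xi n N k l) by exact: past_measurable (past_xi n l kN).
have mY l : measurable_fun setT (Y l (bgrid N k.+1) (bgrid N k)).
  by apply: past_measurable (pY l h1 h2 h3) => //; exact: ltW (lt_le_trans h2 h3).
have mincr : measurable_fun setT (incr n N k).
  by apply: past_measurable pincr => //; exact: ltW (lt_le_trans h2 h3).
have iG l : P.-integrable setT (EFin \o (fun om => n%:R ^+ 2 * Y l (bgrid N k.+1) (bgrid N k) om ^+ 2)).
  apply: (@integrable_bddM (fun=> n%:R ^+ 2) _ (`|n%:R ^+ 2|)) => //.
  exact: iY2.
have [iS eS] := integrable_sumr (index_enum L) iG.
have bound om : incr n N k om ^+ 2 <=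
    #|L|%:R * \sum_l n%:R ^+ 2 * Y l (bgrid N k.+1) (bgrid N k) om ^+ 2.
  rewrite /incr; apply: (le_trans (sqr_sum_le_fin _)).
  apply: ler_wpM2l => //; apply: ler_sum => l _; rewrite exprMn ler_wpM2r ?sqr_ge0//.
  by rewrite -real_normK ?num_real// lerXn2r ?nnegrE// xi_bound.
have iLS : P.-integrable setT (EFin \o (fun om => #|L|%:R *
    \sum_l n%:R ^+ 2 * Y l (bgrid N k.+1) (bgrid N k) om ^+ 2)).
  by apply: (@integrable_bddM (fun=> #|L|%:R) _ `|#|L|%:R|).
have i2 : P.-integrable setT (EFin \o (fun om => incr n N k om ^+ 2)).
  apply: le_integrable iLS => //.
    by apply/measurable_EFinP; exact: measurable_funX.
  move=> om _ /=; rewrite lee_fin ger0_norm ?sqr_ge0//.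
  exact: le_trans (bound om) (ler_norm _).
split=> //.
- apply: (@le_trans _ _ (\int[P]_om (#|L|%:R *
    \sum_l n%:R ^+ 2 * Y l (bgrid N k.+1) (bgrid N k) om ^+ 2))%R).
    by apply: le_Rintegral.
  rewrite RintegralZl// eS.
  have -> : #|L|%:R ^+ 2 * n%:R ^+ 2 * CY * ((b - a) / N%:R) =
    #|L|%:R * \sum_(l in L) n%:R ^+ 2 * (CY * ((b - a) / N%:R)) :> R.
    by rewrite sumr_const -[_ *+ _]mulr_natl; ring.
  apply: ler_wpM2l => //; apply: ler_sum => l _.
  rewrite RintegralZl//; last exact: iY2.
  apply: ler_wpM2l; first exact: sqr_ge0.
  by rewrite -(bgridS N k); exact: EY2.
- move=> Z pZ iZ.
  have mZ : measurable_fun setT Z by exact: past_measurable pZ.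
  have hl l : P.-integrable setT (EFin \o
      (fun om => (xi n N k l om * Z om) * Y l (bgrid N k.+1) (bgrid N k) om)) /\
      (\int[P]_om ((xi n N k l om * Z om) * Y l (bgrid N k.+1) (bgrid N k) om))%R = 0.
    apply: indepY => //.
      by apply: measurable_funM => //; exact: past_xi.
    by apply: (@integrable_bddM _ _ n%:R) => // om; exact: xi_bound.
  have [j1 j2] := integrable_sumr (index_enum L) (fun l => (hl l).1).
  have E om : Z om * incr n N k om =
    \sum_l (xi n N k l om * Z om) * Y l (bgrid N k.+1) (bgrid N k) om.
    by rewrite /incr mulr_sumr; apply: eq_bigr => l _; ring.
  split.
    by apply: eq_integrable j1 => // om _ /=; rewrite E.
  under eq_Rintegral do rewrite E.
  by rewrite j2 big1// => l _; exact: (hl l).2.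
Qed.

(** The increments are orthogonal, so their second moments add; at j = N the total contains N steps
    of length (b - a) / N and the bound does not depend on N. *)
Lemma mart_facts n N j : (0 < N)%N -> (j <= N)%N ->
  [/\ past (bgrid N j) (mart n N j),
      P.-integrable setT (EFin \o (fun om => mart n N j om ^+ 2)),
      (\int[P]_om (mart n N j om ^+ 2))%R <=
        j%:R * (#|L|%:R ^+ 2 * n%:R ^+ 2 * CY * ((b - a) / N%:R)) &
      (\int[P]_om (mart n N j om))%R = 0].
Proof.
move=> N0; elim: j => [_|j IH jN].
  have E : mart n N 0 = cst 0 by apply/funext => om; rewrite /mart big_ord0.
  rewrite E; split.
  - exact: measurable_cst.
  - apply: (eq_integrable _ (EFin \o cst 0)) => //; last exact: finite_measure_integrable_cst.
    by move=> om _ /=; rewrite expr0n.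
  - by under eq_Rintegral do rewrite /= expr0n/=; rewrite Rintegral_cst// !mul0r.
  - by rewrite Rintegral_cst// mul0r.
have [p1 i1 b1 e1] := IH (ltnW jN).
have [p2 i2 b2 h2] := incr_facts n jN.
have E om : mart n N j.+1 om = mart n N j om + incr n N j om by rewrite /mart big_ord_recr.
have h1 : a <= bgrid N j.+1 by exact: bgrid_lb.
have h1' : a <= bgrid N j by exact: bgrid_lb (ltnW jN) N0.
have h3 := bgrid_ub N j; have h4 := bgrid_ub N j.+1.
have m1 : measurable_fun setT (mart n N j) by exact: past_measurable p1.
have m2 : measurable_fun setT (incr n N j) by exact: past_measurable p2.
have i1' := integrable_of_sqr m1 i1; have i2' := integrable_of_sqr m2 i2.
have [i3 e3] := h2 _ p1 i1'.
have i3' : P.-integrable setT (EFin \o (fun om => 2 * (mart n N j om * incr n N j om))).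
  by apply: (@integrable_bddM (fun=> 2) _ `|2|).
have E2 om : mart n N j.+1 om ^+ 2 = mart n N j om ^+ 2 +
    (2 * (mart n N j om * incr n N j om) + incr n N j om ^+ 2) by rewrite E; ring.
have i4 := integrableD measurableT i3' i2.
have i5 := integrableD measurableT i1 i4.
split.
- rewrite /past (_ : mart n N j.+1 = fun om => mart n N j om + incr n N j om); last exact/funext.
  by apply: measurable_funD => //; apply: past_le p1 => //; exact: bgrid_le.
- by apply: eq_integrable i5 => // om _ /=; rewrite E2.
- under eq_Rintegral do rewrite E2.
  rewrite RintegralD// RintegralD// RintegralZl// e3 mulr0 add0r -natr1 mulrDl mul1r.
  exact: lerD.
- under eq_Rintegral do rewrite E.
  rewrite RintegralD// e1 add0r.
  (* The mean of the increment vanishes by orthogonality to the constant 1. *)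
  have pc1 : past (bgrid N j) (cst 1) by exact: measurable_cst.
  have ic1 : P.-integrable setT (EFin \o (cst 1 : Om -> R)) by exact: finite_measure_integrable_cst.
  have [_ +] := h2 _ pc1 ic1.
  by under eq_Rintegral do rewrite mul1r.
Qed.

Definition resid (n N : nat) (om : Om) : R := M (Tst n N om) om - M0 - mart n N N om.

Lemma stopped_sum n N om : M (Tst n N om) om =
  M0 + \sum_(k < N) alive n N k om * (M (bgrid N k.+1) om - M (bgrid N k) om).
Proof.
rewrite -(big_mkord xpredT (fun k => alive n N k om * (M (bgrid N k.+1) om - M (bgrid N k) om))).
rewrite (big_cat_nat (leq0n _) (J_le n N om))/=.
rewrite [X in _ + (_ + X)]big_nat_cond [X in _ + (_ + X)]big1 ?addr0; last first.
  by move=> k /andP[/andP[Jk _] _]; rewrite /alive ltnNge Jk/= mul0r.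
rewrite (eq_big_nat _ _ (F2 := fun k => M (bgrid N k.+1) om - M (bgrid N k) om)); last first.
  by move=> k /andP[_ kJ]; rewrite /alive kJ mul1r.
by rewrite telescope_sumr// bgrid0 Mb addrCA subrr addr0.
Qed.

Lemma resid_sum n N om : resid n N om = \sum_(k < N) alive n N k om *
  (M (bgrid N k.+1) om - M (bgrid N k) om
   - \sum_l c l (bgrid N k) om * Y l (bgrid N k.+1) (bgrid N k) om).
Proof.
rewrite /resid stopped_sum /mart [M0 + _]addrC addrK -sumrB; apply: eq_bigr => k _.
rewrite [in RHS]mulrBr; congr (_ - _); rewrite /incr mulr_sumr; apply: eq_bigr => l _.
by rewrite /xi mulrA.
Qed.

(** Total weight of the grid; the added 1 permits division by it. *)
Definition vol (N : nat) (om : Om) : R := 1 + \sum_(k < N) W (bgrid N k.+1) (bgrid N k) om.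

Lemma vol_ge1 N om : (0 < N)%N -> 1 <= vol N om.
Proof.
move=> N0; rewrite lerDl sumr_ge0// => k _; apply: W0.
- exact: bgrid_lb.
- exact: bgrid_lt.
- exact: bgrid_ub.
Qed.

(** Once the mesh is below the modulus of this path, each remainder is at most e times its weight.
    The total weight is controlled in mean only, which is why the ratio is considered. *)
Lemma resid_small n om : (fun N => resid n N.+1 om / vol N.+1 om) @ \oo --> (0 : R).
Proof.
apply/cvgrPdist_le => e e0.
have [del del0 h] := step_small om e0.
have := mesh_lt a b del0 => -[N0 _ hN0].
exists N0 => // N /= NN0; have [_ hN] := hN0 N.+1 (leqW NN0).
have v1 := @vol_ge1 N.+1 om isT.
have v0 : 0 < vol N.+1 om by rewrite (lt_le_trans _ v1).
rewrite sub0r normrN normrM normfV (gtr0_norm v0) ler_pdivrMr// resid_sum.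
apply: (le_trans (ler_norm_sum _ _ _)).
apply: (@le_trans _ _ (\sum_(k < N.+1) e * W (bgrid N.+1 k.+1) (bgrid N.+1 k) om)).
  apply: ler_sum => k _; rewrite normrM.
  have k1 : a <= bgrid N.+1 k.+1 by exact: bgrid_lb.
  have k2 : bgrid N.+1 k.+1 < bgrid N.+1 k by exact: bgrid_lt.
  have k3 := bgrid_ub N.+1 k.
  have := h (bgrid N.+1 k.+1) (bgrid N.+1 k) k1 (ltW k2) k3; rewrite bgridS => /(_ hN) hk.
  rewrite -[leRHS]mul1r; apply: ler_pM => //.
  by rewrite /alive; case: (_ < _)%N; rewrite ?normr1// normr0.
rewrite -mulr_sumr ler_wpM2l ?(ltW e0)// /vol.
by rewrite lerDr.
Qed.

Lemma measurable_M s : a <= s -> s <= b -> measurable_fun setT (M s).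
Proof. by move=> as_ sb; exact: past_measurable (pM as_ sb). Qed.

Lemma measurable_stopped n N : measurable_fun setT (fun om => M (Tst n N.+1 om) om).
Proof.
under eq_fun do rewrite stopped_sum.
apply: measurable_funD => //; apply: measurable_sum => k.
have h1 : a <= bgrid N.+1 k.+1 by exact: bgrid_lb.
have h2 : a <= bgrid N.+1 k by apply: bgrid_lb => //; exact: ltnW.
apply: measurable_funM.
  by apply: past_measurable (past_alive_fun n (ltn_ord k)) => //; exact: bgrid_ub.
by apply: measurable_funB; apply: measurable_M => //; exact: bgrid_ub.
Qed.

Lemma measurable_mart n N : measurable_fun setT (mart n N.+1 N.+1).
Proof.
have [p _ _ _] := mart_facts n (ltn0Sn N) (leqnn N.+1).
by apply: past_measurable p; [exact: bgrid_lb|exact: bgrid_ub].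
Qed.

Lemma measurable_resid n N : measurable_fun setT (resid n N.+1).
Proof.
apply: measurable_funB; last exact: measurable_mart.
by apply: measurable_funB => //; exact: measurable_stopped.
Qed.

Lemma measurable_vol N : measurable_fun setT (vol N.+1).
Proof.
apply: measurable_funD => //; apply: measurable_sum => k; apply: mW.
- exact: bgrid_lb.
- exact: bgrid_lt.
- exact: bgrid_ub.
Qed.

Lemma integral_vol N : (\int[P]_om `|vol N.+1 om|%:E <= (1 + CW * (b - a))%:E)%E.
Proof.
have mWk (k : 'I_N.+1) : measurable_fun setT
    (fun om => (W (bgrid N.+1 k.+1) (bgrid N.+1 k) om)%:E).
  apply/measurable_EFinP; apply: mW; [exact: bgrid_lb|exact: bgrid_lt|exact: bgrid_ub].
have Wk0 (k : 'I_N.+1) om : 0 <= W (bgrid N.+1 k.+1) (bgrid N.+1 k) om.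
  by apply: W0; [exact: bgrid_lb|exact: bgrid_lt|exact: bgrid_ub].
under eq_integral => om _.
  rewrite ger0_norm; last by rewrite (le_trans _ (@vol_ge1 N.+1 om isT)).
  rewrite /vol EFinD -sumEFin; over.
rewrite ge0_integralD//; last 2 first.
- by move=> om _; apply: sume_ge0 => k _; rewrite lee_fin.
- by apply: emeasurable_sum => k; exact: mWk.
rewrite integral_cst// [X in (_ * X)%E]probability_setT mule1 EFinD leeD2l//.
rewrite ge0_integral_sum//; last by move=> k om _; rewrite lee_fin.
apply: (@le_trans _ _ (\sum_(k < N.+1) (CW * ((b - a) / N.+1%:R))%:E)%E).
  apply: lee_sum => k _; rewrite -(bgridS N.+1 k).
  by apply: EW; [exact: bgrid_lb|exact: bgrid_lt|exact: bgrid_ub].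
rewrite sumEFin lee_fin sumr_const card_ord -[_ *+ _]mulr_natl.
by rewrite le_eqVlt; apply/orP; left; apply/eqP; field; rewrite addrC natr1 pnatr_eq0.
Qed.

(** From tails to the linear form: on B the values above K contribute at most e, the others at most
    |K| P(B). *)
Lemma ui_stopped (T : nat -> Om -> R) : (forall i, stopping (T i)) ->
  (forall i, measurable_fun setT (fun om => M (T i om) om)) ->
  ui P (fun i om => M (T i om) om).
Proof.
move=> sT mT e e0; have [K hK] := MD e0; exists `|K| => i B mB.
pose A := [set om | K < `|M (T i om) om|].
have mA : measurable A by exact: measurable_abs_gt.
have mabs D : measurable_fun D (fun om => `|M (T i om) om|%:E) by exact: measurable_absE.
have -> : (\int[P]_(x in B) `|M (T i x) x|%:E = \int[P]_(x in B `&` A) `|M (T i x) x|%:E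
   + \int[P]_(x in B `\` A) `|M (T i x) x|%:E)%E.
  rewrite -ge0_integral_setU//.
  - by rewrite setUIDK.
  - exact: measurableI.
  - exact: measurableD.
  - by apply/disj_setPS => x [[_ Ax] [_ nAx]].
apply: leeD.
  apply: le_trans (hK (T i) (sT i)); apply: ge0_subset_integral => //.
  exact: measurableI.
apply: (@le_trans _ _ (`|K|%:E * P (B `\` A))%E).
  apply: integral_abs_le_on => //; first exact: measurableD.
  move=> x [_ /=]; rewrite /A /= => /negP; rewrite -leNgt => h.
  exact: le_trans h (ler_norm _).
by apply: lee_wpmul2l => //; apply: le_measure; rewrite ?inE//; exact: measurableD.
Qed.

Lemma stopped_mean n : (fun N => (\int[P]_om (M (Tst n N.+1 om) om))%R) @ \oo --> M0.
Proof.
have uS : ui P (fun N om => M (Tst n N.+1 om) om).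
  apply: ui_stopped => N; [exact: stopping_Tst|exact: measurable_stopped].
have uM : ui P (fun N om => mart n N.+1 N.+1 om).
  apply: (@ui_sqr _ _ _ _ _ (#|L|%:R ^+ 2 * n%:R ^+ 2 * CY * (b - a))) => N.
    exact: measurable_mart.
  have [_ i2 b2 _] := mart_facts n (ltn0Sn N) (leqnn N.+1).
  rewrite -(fineK (integrable_fin_num measurableT i2)) lee_fin.
  by apply: (le_trans b2); rewrite le_eqVlt; apply/orP; left; apply/eqP; field;
    rewrite addrC natr1 pnatr_eq0.
have uR : ui P (fun N om => resid n N.+1 om).
  apply: uiD.
  - by move=> N; apply: measurable_funB => //; exact: measurable_stopped.
  - by move=> N; apply: measurableT_comp => //; exact: measurable_mart.
  - apply: uiD => //; [by move=> N; exact: measurable_stopped|exact: ui_cst].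
  - exact: uiN.
have pR : inprob0 P (fun N om => resid n N.+1 om).
  have mq N : measurable_fun setT (fun om => resid n N.+1 om / vol N.+1 om).
    apply: measurable_funM; first exact: measurable_resid.
    by apply: measurable_inv_ge1; [exact: measurable_vol|move=> om; exact: vol_ge1].
  have q0 := pointwise_inprob0 P mq (resid_small n).
  (* The residual is recovered as the ratio, tending to 0 in probability, times the weight, bounded
     in mean. *)
  have := inprob0_mul mq (fun N => measurable_vol N) q0 integral_vol.
  move=> h eta e eta0 e0; apply: filterS (h eta e eta0 e0) => N.
  have vE x : resid n N.+1 x / vol N.+1 x * vol N.+1 x = resid n N.+1 x.
    by rewrite divfK// gt_eqF// (lt_le_trans _ (@vol_ge1 N.+1 x isT)).
  apply: le_trans; rewrite le_eqVlt; apply/orP; left; apply/eqP; congr (P _).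
  by apply/seteqP; split => x /=; rewrite vE.
apply/cvgrPdist_le => e e0.
apply: filterS (vitali (measurable_resid n) uR pR e0) => N hN.
have iS := ui_integrable (measurable_stopped n N) uS.
have iM := @ui_integrable _ _ _ P (fun N => mart n N.+1 N.+1) N (measurable_mart n N) uM.
have iR := @ui_integrable _ _ _ P (fun N => resid n N.+1) N (measurable_resid n N) uR.
have [_ _ _ eM] := mart_facts n (ltn0Sn N) (leqnn N.+1).
have icst : P.-integrable setT (EFin \o (fun=> M0 : R)) by exact: finite_measure_integrable_cst.
have -> : M0 - (\int[P]_om (M (Tst n N.+1 om) om))%R = - (\int[P]_om (resid n N.+1 om))%R.
  rewrite /resid RintegralB//; last first.
    by rewrite (_ : _ \o _ = (EFin \o (fun om => M (Tst n N.+1 om) om)) \- (EFin \o cst M0))%E//; exact: integrableB.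
  rewrite RintegralB// eM subr0 Rintegral_cst//.
  by rewrite /= probability_setT mulr1 opprB.
rewrite normrN -lee_fin; apply: le_trans hN.
rewrite EFin_normr_Rintegral//; apply: le_abse_integral => //.
by apply/measurable_EFinP; exact: measurable_resid.
Qed.

(** A diagonal choice: for each level n a grid is fixed on which the stopped mean is within 1/(n+1)
    of M0. On a given path, once n exceeds the bound of its coefficients no index is bad, so the
    stopped value equals M a from then on and uniform integrability carries the means to the
    limit. *)
Theorem terminal_mean :
  P.-integrable setT (EFin \o M a) /\ (\int[P]_om (M a om))%R = M0.
Proof.
have mMa : measurable_fun setT (M a) by apply: measurable_M => //; exact: ltW.
have hN n : exists N, `|M0 - (\int[P]_om (M (Tst n N.+1 om) om))%R| <= n.+1%:R^-1.
  have n0 : 0 < n.+1%:R^-1 :> R by rewrite invr_gt0.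
  have /cvgrPdist_le/(_ _ n0)[N _ h] := stopped_mean n.
  by exists N; apply: h => /=.
have [Nf hNf] := choice hN.
have uMa : ui P (fun _ : nat => M a).
  by apply: (@ui_stopped (fun _ _ => a)) => // _; apply: stopping_cst => //; exact: ltW.
have uT : ui P (fun n om => M (Tst n (Nf n).+1 om) om).
  by apply: ui_stopped => n; [exact: stopping_Tst|exact: measurable_stopped].
split; first exact: (@ui_integrable _ _ _ P (fun _ => M a) 0%N).
have cv om : (fun n => M (Tst n (Nf n).+1 om) om) @ \oo --> M a om.
  have [K hK] := bc om.
  apply: cvg_near_cst; exists (Num.trunc `|K|).+1 => // n /= hn.
  suff -> : Tst n (Nf n).+1 om = a by [].
  rewrite /Tst; suff -> : J n (Nf n).+1 om = (Nf n).+1 by rewrite bgridN.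
  apply/eqP; rewrite eqn_leq J_le/= ltJP//; apply/forallP => i.
  rewrite /bad negb_exists; apply/forallP => l; rewrite -leNgt.
  have iN : (i <= (Nf n).+1)%N by exact: leq_trans (leq_ord i) _.
  apply: (le_trans (hK l _ (bgrid_lb iN _) (bgrid_ub _ _))) => //.
  apply: (le_trans (ler_norm _)); apply: ltW; apply: (lt_le_trans (truncnS_gt _)).
  by rewrite ler_nat.
have c1 := ui_cvg (fun n => measurable_stopped n (Nf n)) mMa uT uMa cv.
have c2 : (fun n => (\int[P]_om (M (Tst n (Nf n).+1 om) om))%R) @ \oo --> M0.
  apply/cvgrPdist_le => e e0.
  have /cvgrPdist_lt/(_ _ e0) := @cvg_harmonic R; apply: filterS => n.
  rewrite sub0r normrN ger0_norm ?invr_ge0// => h.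
  exact: le_trans (hNf n) (ltW h).
exact: cvg_unique c1 c2.
Qed.

End discrete_martingale.

(** * Noise functionals of a backward Wiener process *)

Section backward_noise.
Context (R : realType) (d : nat) (disp : measure_display) (Om : measurableType disp).
Variables (P : probability Om R) (ti t : R) (Gn : R -> set (set Om)) (w : R -> Om -> 'rV[R]_d).
Hypothesis hw : backward_wiener P ti t (fun s => <<s Gn s >>) w.
Hypothesis F_mono : forall r s, ti <= r -> r <= s -> s <= t -> <<s Gn s >> `<=` <<s Gn r >>.
Hypothesis F_sub : forall s, ti <= s -> s <= t -> <<s Gn s >> `<=` @measurable _ Om.

Definition dwn (k : 'I_d) (r s : R) (om : Om) : R := w s om 0 k - w r om 0 k.

Lemma measurable_dwn k r s : ti <= r -> r <= t -> ti <= s -> s <= t ->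
  measurable_fun setT (dwn k r s).
Proof.
move=> tr rt ts st; have [[mw _ _ _] _ _] := hw.
by apply: measurable_funB; apply: mw; rewrite in_itv/= ?tr ?ts.
Qed.

Lemma past_dwn k r s : ti <= r -> r <= s -> s <= t -> past Gn r (dwn k r s).
Proof.
move=> tr rs st; have [_ ad _] := hw.
have h u : r <= u -> u <= t -> past Gn r (fun om => w t om 0 k - w u om 0 k).
  move=> ru ut _ A mA; rewrite setTI.
  have : (<<s Gn u >>) [set om | A ((w t om - w u om) 0 k)].
    by apply: ad => //; rewrite in_itv/= ut (le_trans tr ru).
  move=> /(F_mono tr ru ut); congr (<<s _ >> _).
  by apply/seteqP; split => om /=; rewrite !mxE.
have -> : dwn k r s = (fun om => (w t om 0 k - w r om 0 k) - (w t om 0 k - w s om 0 k)).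
  by apply/funext => om; rewrite /dwn; ring.
by apply: measurable_funB; apply: h => //; exact: le_trans rs st.
Qed.

(** The case of a single interval in the joint law of consecutive increments. *)
Lemma dwn_law r s (A : 'I_d -> set R) : ti <= r -> r < s -> s <= t ->
  (forall k, measurable (A k)) ->
  P [set om | forall k, A k (dwn k r s om)] =
  (\prod_(k < d) normal_prob 0 (Num.sqrt (s - r)%R) (A k))%E.
Proof.
move=> tr rs st mA; have [[_ _ _ h] _ _] := hw.
pose u (i : nat) := if i == 0%N then r else s.
have h1 : forall i, (i <= 1)%N -> u i \in `[ti, t].
  move=> [|[|i]]// _; rewrite in_itv/= /u/=.
    by rewrite tr (le_trans (ltW rs)).
  by rewrite st (le_trans tr (ltW rs)).
have h2 : forall i, (i < 1)%N -> u i < u i.+1 by move=> [|i].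
have := h 1%N u (fun _ => A) h1 h2 (fun _ => mA).
rewrite big_ord1 /u/= => <-; congr (P _).
apply/seteqP; split => om /= ho; last by move=> k; exact: (ho 0%N k).
by move=> [|i] k //= _; exact: ho.
Qed.

Lemma prod_sub1 (f : 'I_d -> \bar R) (k : 'I_d) : (forall j, j != k -> f j = 1%E) ->
  (\prod_(j < d) f j = f k)%E.
Proof.
by move=> h; rewrite (bigD1 k)//= big1 ?mule1// => j jk; exact: h.
Qed.

Lemma dwn_gaussian k r s : ti <= r -> r < s -> s <= t ->
  gaussian_rv P (Num.sqrt (s - r)) (dwn k r s).
Proof.
move=> tr rs st; split.
  by apply: measurable_dwn; rewrite ?(le_trans tr (ltW rs)) ?(le_trans (ltW rs) st).
move=> A mA.
have := @dwn_law r s (fun j => if j == k then A else setT) tr rs st _.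
rewrite (@prod_sub1 _ k) ?eqxx; last first.
  by move=> j jk; rewrite (negbTE jk); exact: probability_setT.
move=> <-; last by move=> j; case: ifP.
congr (P _); apply/seteqP; split => om /= ho; last by have := ho k; rewrite eqxx.
by move=> j; case: eqP => // ->.
Qed.

Lemma past_preimage s Z A : past Gn s Z -> measurable A -> (<<s Gn s >>) (Z @^-1` A).
Proof. by move=> pZ mA; rewrite -[_ @^-1` _]setTI; exact: pZ. Qed.

Lemma dwn_indep1 k r s Z : ti <= r -> r < s -> s <= t -> past Gn s Z ->
  indep_sets P Z (dwn k r s).
Proof.
move=> tr rs st pZ A B mA mB; have [_ _ h] := hw.
have := h r s (Z @^-1` A) (fun j => if j == k then B else setT) tr rs st
  (past_preimage pZ mA) _.
have E : [set om | forall j, (if j == k then B else setT) (w s om 0 j - w r om 0 j)] =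
    dwn k r s @^-1` B.
  apply/seteqP; split => om /= ho; first by have := ho k; rewrite eqxx.
  by move=> j; case: eqP => // ->.
by rewrite E; apply => j; case: ifP.
Qed.

(** Independence of the past from the whole increment vector is combined with the product law of its
    coordinates; the coordinates other than j and k are left free. *)
Lemma dwn_indep2 j k r s Z A B C : ti <= r -> r < s -> s <= t -> past Gn s Z -> j != k ->
  measurable A -> measurable B -> measurable C ->
  P (Z @^-1` A `&` (dwn j r s @^-1` B `&` dwn k r s @^-1` C)) =
  (P (Z @^-1` A) * (P (dwn j r s @^-1` B) * P (dwn k r s @^-1` C)))%E.
Proof.
move=> tr rs st pZ jk mA mB mC; have [_ _ h] := hw.
pose AA i : set R := if i == j then B else if i == k then C else setT.
have mAA i : measurable (AA i) by rewrite /AA; case: ifP => // _; case: ifP.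
have E : [set om | forall i, AA i (w s om 0 i - w r om 0 i)] =
    dwn j r s @^-1` B `&` dwn k r s @^-1` C.
  apply/seteqP; split => om /= ho.
    have := ho j; have := ho k; rewrite /AA !eqxx eq_sym (negbTE jk) => h1 h2.
    by split.
  move=> i; rewrite /AA; case: eqP => [->|_]; first exact: ho.1.
  by case: eqP => [->|//]; exact: ho.2.
have := h r s (Z @^-1` A) AA tr rs st (past_preimage pZ mA) mAA.
rewrite /= E => ->; congr (_ * _)%E.
rewrite (dwn_gaussian j tr rs st).2// (dwn_gaussian k tr rs st).2//.
have := dwn_law tr rs st mAA; rewrite -E => ->.
rewrite (bigD1 j)//= (bigD1 k)//=; last by rewrite eq_sym.
rewrite big1 ?mule1; last first.
  by move=> i /andP[ij ik]; rewrite /AA (negbTE ij) (negbTE ik); exact: probability_setT.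
by rewrite /AA !eqxx eq_sym (negbTE jk).
Qed.

Definition noise_index : Type := ('I_d + 'I_d * 'I_d)%type.

(** The random factors of [ito_main], as one family over a finite type. Each unordered pair of
    distinct coordinates appears once, for j < k; the value 0 fills the remaining indices. *)
Definition noise (l : noise_index) (r s : R) (om : Om) : R :=
  match l with
  | inl k => dwn k r s om
  | inr (j, k) => if j == k then dwn k r s om ^+ 2 - (s - r)
                  else if (j < k)%N then dwn j r s om * dwn k r s om else 0
  end.

Let K4 : R := 512 * expR (1 / 2).

Section one_step.
Variables (r s : R).
Hypotheses (tr : ti <= r) (rs : r < s) (st : s <= t).

Let sd := Num.sqrt (s - r).
Let sd0 : 0 < sd. Proof. by rewrite sqrtr_gt0 subr_gt0. Qed.
Let sd2 : sd ^+ 2 = s - r. Proof. by rewrite sqr_sqrtr// subr_ge0 ltW. Qed.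
Let gs k := dwn_gaussian k tr rs st.
Let mdw k : measurable_fun setT (dwn k r s) := (gs k).1.
Let i1 k : P.-integrable setT (EFin \o dwn k r s) := gaussian_integrable sd0 (gs k).
Let i2 k : P.-integrable setT (EFin \o (fun om => dwn k r s om ^+ 2)) :=
  gaussian_sqr_integrable sd0 (gs k).
Let i4 k : P.-integrable setT (EFin \o (fun om => dwn k r s om ^+ 4)) :=
  gaussian_pow4_integrable sd0 (gs k).
Let e1 k : (\int[P]_om dwn k r s om)%R = 0.
Proof. by rewrite /Rintegral (gaussian_mean sd0 (gs k)). Qed.
Let e2 k : (\int[P]_om (dwn k r s om ^+ 2))%R = s - r.
Proof. by rewrite /Rintegral (gaussian_variance sd0 (gs k)) sd2. Qed.
Let e4 k : (\int[P]_om (dwn k r s om ^+ 4))%R <= K4 * (s - r) ^+ 2.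
Proof.
have := gaussian_pow4_le sd0 (gs k); rewrite -/K4 -/sd.
rewrite -(fineK (integrable_fin_num measurableT (i4 k))) lee_fin.
by rewrite (_ : sd ^+ 4 = (s - r) ^+ 2)// -sd2 -exprM.
Qed.

Lemma measurable_noise l : measurable_fun setT (noise l r s).
Proof.
case: l => [k|[j k]]; rewrite /noise; first exact: mdw.
case: (eqVneq j k) => _; first by apply: measurable_funB => //; exact: measurable_funX.
by case: (ltnP j k) => _ //; exact: measurable_funM.
Qed.

Lemma past_noise l : past Gn r (noise l r s).
Proof.
have p k : past Gn r (dwn k r s) by apply: past_dwn => //; exact: ltW.
case: l => [k|[j k]] /=; first exact: p.
rewrite /past /noise; case: (eqVneq j k) => _.
  by apply: measurable_funB => //; exact: measurable_funX (p k).
by case: (ltnP j k) => _ //; exact: measurable_funM (p j) (p k).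
Qed.

Let i44 j k : P.-integrable setT
  (EFin \o (fun om => 2 * dwn j r s om ^+ 4 + 2 * dwn k r s om ^+ 4 + 2 * (s - r) ^+ 2)).
Proof.
have h i : P.-integrable setT (EFin \o (fun om => 2 * dwn i r s om ^+ 4)).
  by apply: (@integrable_bddM _ _ _ _ (fun=> 2) _ `|2|) (i4 i).
have hc : P.-integrable setT (EFin \o (fun=> 2 * (s - r) ^+ 2)) by exact: finite_measure_integrable_cst.
exact: (integrableD measurableT (integrableD measurableT (h j) (h k)) hc).
Qed.

Lemma noise_sqr_le l om : noise l r s om ^+ 2 <= match l with
  | inl k => dwn k r s om ^+ 2
  | inr (j, k) => 2 * dwn j r s om ^+ 4 + 2 * dwn k r s om ^+ 4 + 2 * (s - r) ^+ 2 end.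
Proof.
case: l => [k|[j k]] //=.
set x := dwn j r s om; set y := dwn k r s om; set h := s - r.
have x4 : x ^+ 4 = (x ^+ 2) ^+ 2 by rewrite -exprM.
have y4 : y ^+ 4 = (y ^+ 2) ^+ 2 by rewrite -exprM.
have X0 := sqr_ge0 (x ^+ 2); have Y0 := sqr_ge0 (y ^+ 2); have H0 := sqr_ge0 h.
rewrite x4 y4; case: eqP => _; last case: ifP => _.
- by have := sqr_ge0 (y ^+ 2 + h); rewrite sqrrD sqrrB; lra.
- by rewrite exprMn; have := sqr_ge0 (x ^+ 2 - y ^+ 2); rewrite sqrrB; lra.
- by rewrite expr0n/=; lra.
Qed.

Lemma noise_sqr_integrable l : P.-integrable setT (EFin \o (fun om => noise l r s om ^+ 2)).
Proof.
case: l (noise_sqr_le l) (measurable_noise l) => [k _ _|[j k] h m]; first exact: i2.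
apply: le_integrable (i44 j k) => //.
  by apply/measurable_EFinP; exact: measurable_funX.
move=> om _; rewrite /= lee_fin ger0_norm ?sqr_ge0//.
exact: le_trans (h om) (ler_norm _).
Qed.

(** Quadratic terms have second moments of order (s - r)^2 <= (t - ti) (s - r), hence a bound linear
    in the step. 4 K4 + 2 collects two fourth moments and the centring term; the summand 1 is for
    the linear noise. *)
Lemma noise_sqr_mean l :
  (\int[P]_om (noise l r s om ^+ 2))%R <= (1 + (4 * K4 + 2) * (t - ti)) * (s - r).
Proof.
have h0 : 0 < s - r by rewrite subr_gt0.
have h1 : s - r <= t - ti by rewrite lerB.
have K40 : 0 <= K4 by rewrite mulr_ge0 ?expR_ge0.
have hh : (s - r) ^+ 2 <= (t - ti) * (s - r) by rewrite expr2 ler_wpM2r// ltW.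
case: l => [k|[j k]].
  rewrite /= e2 ler_peMl ?(ltW h0)// lerDl mulr_ge0//; first by rewrite addr_ge0// mulr_ge0.
  by rewrite subr_ge0 (le_trans tr)// (le_trans (ltW rs)).
apply: (@le_trans _ _ (\int[P]_om (2 * dwn j r s om ^+ 4 + 2 * dwn k r s om ^+ 4 + 2 * (s - r) ^+ 2))%R).
  apply: le_Rintegral => //; first exact: noise_sqr_integrable.
  by move=> om _; exact: (noise_sqr_le (inr (j, k))).
have h i : P.-integrable setT (EFin \o (fun om => 2 * dwn i r s om ^+ 4)).
  by apply: (@integrable_bddM _ _ _ _ (fun=> 2) _ `|2|) (i4 i).
have hc : P.-integrable setT (EFin \o (fun=> 2 * (s - r) ^+ 2)) by exact: finite_measure_integrable_cst.
rewrite RintegralD//; last exact: (integrableD measurableT (h j) (h k)).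
rewrite RintegralD// Rintegral_cst// [X in fine X]probability_setT mulr1 !RintegralZl//.
apply: (@le_trans _ _ ((4 * K4 + 2) * ((s - r) ^+ 2))).
  by have := e4 j; have := e4 k; lra.
apply: (@le_trans _ _ ((4 * K4 + 2) * ((t - ti) * (s - r)))).
  by rewrite ler_wpM2l// addr_ge0// mulr_ge0.
by rewrite mulrA [leRHS]mulrDl mul1r lerDr ltW.
Qed.

(** For a product of two coordinates, Z dw_j is independent of dw_k, which has mean zero; for a
    square, the variance of the increment is exactly the subtracted s - r. *)
Lemma noise_indep l Z : past Gn s Z -> P.-integrable setT (EFin \o Z) ->
  P.-integrable setT (EFin \o (fun om => Z om * noise l r s om)) /\
  (\int[P]_om (Z om * noise l r s om))%R = 0.
Proof.
move=> pZ iZ.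
have ts : ti <= s by exact: le_trans tr (ltW rs).
have mZ : measurable_fun setT Z by move=> _ A mA; apply: (F_sub ts st); exact: pZ.
have lin k : P.-integrable setT (EFin \o (fun om => Z om * dwn k r s om)) /\
    (\int[P]_om (Z om * dwn k r s om))%R = 0.
  have [a1 a2] := indep_integrable_mul mZ (mdw k) (dwn_indep1 k tr rs st pZ) iZ (i1 k).
  split=> //; rewrite /Rintegral a2 fineM ?integrable_fin_num//; last exact: i1.
  by rewrite [X in _ * X]e1 mulr0.
case: l => [k|[j k]] /=; first exact: lin.
case: (eqVneq j k) => [_|jk].
  have ms : measurable_fun setT (fun om => dwn k r s om ^+ 2) by exact: measurable_funX.
  have ind : indep_sets P Z (fun om => dwn k r s om ^+ 2).
    move=> A B mA mB.
    have mB' : measurable ((fun x : R => x ^+ 2) @^-1` B).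
      by rewrite -[_ @^-1` _]setTI; apply: (measurable_funX 2 (@measurable_id _ _ setT)).
    exact: (dwn_indep1 k tr rs st pZ mA mB').
  have [a1 a2] := indep_integrable_mul mZ ms ind iZ (i2 k).
  have iZh : P.-integrable setT (EFin \o (fun om => (s - r) * Z om)).
    by apply: (@integrable_bddM _ _ _ _ (fun=> s - r) _ `|s - r|) iZ.
  have E om : Z om * (dwn k r s om ^+ 2 - (s - r)) = Z om * dwn k r s om ^+ 2 - (s - r) * Z om.
    by ring.
  split.
    have iB := integrableB measurableT a1 iZh.
    by apply: eq_integrable iB => // om _ /=; rewrite E.
  under eq_Rintegral do rewrite E.
  rewrite RintegralB// RintegralZl// /Rintegral a2 fineM ?integrable_fin_num//; last exact: i2.
  by rewrite [X in _ * X - _]e2; ring.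
case: (ltnP j k) => _; last first.
  split.
    apply: (eq_integrable _ (EFin \o cst 0)) => //; last exact: finite_measure_integrable_cst.
    by move=> om _ /=; rewrite mulr0.
  under eq_Rintegral do rewrite mulr0.
  by rewrite Rintegral_cst// mul0r.
have ind : indep_sets P (fun om => Z om * dwn j r s om) (dwn k r s).
  by apply: indep_mul3 => // A B C mA mB mC; exact: dwn_indep2.
have mZj : measurable_fun setT (fun om => Z om * dwn j r s om) by exact: measurable_funM.
have [a1 a2] := indep_integrable_mul mZj (mdw k) ind (lin j).1 (i1 k).
have E om : Z om * (dwn j r s om * dwn k r s om) = Z om * dwn j r s om * dwn k r s om by ring.
split; first by apply: eq_integrable a1 => // om _ /=; rewrite E.
under eq_Rintegral do rewrite E.
rewrite /Rintegral a2 fineM ?integrable_fin_num//; [|exact: (lin j).1|exact: i1].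
by rewrite [X in _ * X]e1 mulr0.
Qed.

Definition quad (r s : R) (om : Om) : R := (s - r) + \sum_k dwn k r s om ^+ 2.

Lemma measurable_quad : measurable_fun setT (quad r s).
Proof.
apply: measurable_funD => //; apply: measurable_sum => k; exact: measurable_funX.
Qed.

Lemma quad_ge0 om : 0 <= quad r s om.
Proof. by rewrite addr_ge0 ?subr_ge0 ?(ltW rs)// sumr_ge0// => k _; exact: sqr_ge0. Qed.

Lemma quad_mean : (\int[P]_om (quad r s om)%:E <= (d.+1%:R * (s - r))%:E)%E.
Proof.
have [j1 j2] := @integrable_sumr _ _ _ P _ (index_enum 'I_d) _ i2.
have hc : P.-integrable setT (EFin \o (fun=> s - r)) by exact: finite_measure_integrable_cst.
have iq := integrableD measurableT hc j1.
rewrite (_ : (\int[P]_om (quad r s om)%:E)%E = (\int[P]_om quad r s om)%R%:E); last first.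
  by rewrite /Rintegral fineK//; exact: (integrable_fin_num measurableT iq).
rewrite lee_fin /quad RintegralD// j2 Rintegral_cst// /= probability_setT mulr1.
under eq_bigr do rewrite e2.
rewrite sumr_const card_ord -[_ *+ _]mulr_natl -nat1r mulrDl mul1r.
exact: lexx.
Qed.

End one_step.
End backward_noise.

(** * The martingale under the dissipative path measure *)

Lemma within_comp (T U V : topologicalType) (A : set T) (B : set U) (g : T -> U) (f : U -> V) :
  {within A, continuous g} -> (forall x, A x -> B (g x)) -> {within B, continuous f} ->
  {within A, continuous (f \o g)}.
Proof.
move=> /subspace_continuousP cg gB /subspace_continuousP cf.
apply/subspace_continuousP => x Ax S Sfx.
have h1 := cf (g x) (gB x Ax) S Sfx.
have h2 := cg x Ax _ h1.
have h3 : \forall x' \near x, A x' -> B (g x') -> S (f (g x')) := h2.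
have : \forall x' \near x, A x' -> S (f (g x')).
  by apply: filterS h3 => x' h Ax'; apply: h => //; exact: gB.
by [].
Qed.

(** * Generators of the backward filtration *)

Section backward_filtration.
Context (R : realType) (d : nat) (disp : measure_display) (Om : measurableType disp).
Variables (ti t : R) (w : R -> Om -> 'rV[R]_d).
Hypothesis mw : forall s (k : 'I_d), s \in `[ti, t] -> measurable_fun setT (fun om => w s om 0 k).

(** The generating sets of [backward_filtration], isolated because a sigma-algebra structure on the
    sample space is built from generators. *)
Definition bgen (s : R) : set (set Om) := [set B | exists r (k : 'I_d) (A : set R),
  [/\ s <= r <= t, measurable A & B = [set om | A (w t om 0 k - w r om 0 k)]] ].

Lemma bgen_mono r s : r <= s -> <<s bgen s >> `<=` <<s bgen r >>.
Proof.
move=> rs; apply: sub_sigma_algebra2 => B [u [k [A [/andP[su ut] mA ->]]]].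
by exists u, k, A; split => //; rewrite (le_trans rs su).
Qed.

Lemma bgen_sub s : ti <= s -> s <= t -> <<s bgen s >> `<=` @measurable _ Om.
Proof.
move=> ts st; apply: smallest_sub; first exact: sigma_algebra_measurable.
move=> B [u [k [A [/andP[su ut] mA ->]]]].
have mt : measurable_fun setT (fun om => w t om 0 k - w u om 0 k).
  apply: measurable_funB; apply: mw; rewrite in_itv/= ?ut ?lexx ?andbT.
    exact: le_trans ts st.
  exact: le_trans ts su.
by rewrite -[X in measurable X]setTI; exact: mt.
Qed.

End backward_filtration.

(** * Increments of the process along a path *)

Section pathwise_dynamics.
Context (R : realType) (d : nat) (disp : measure_display) (Om : measurableType disp).
Variables (m tau beta ti t : R) (F : R -> set (set Om)).
Variables (b : R -> 'rV[R]_d -> 'rV[R]_d -> 'rV[R]_d) (w : R -> Om -> 'rV[R]_d).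
Variables (q p : 'rV[R]_d) (qs ps : R -> Om -> 'rV[R]_d).
Hypothesis hP : backward_process m tau beta ti t F b w q p qs ps.
Hypothesis cb : forall om k, {within `[ti, t], continuous (fun r => b r (qs r om) (ps r om) 0 k)}.

Lemma pos_increment om k r s : ti <= r -> r <= s -> s <= t ->
  qs r om 0 k - qs s om 0 k = - tint r s (fun u => m^-1 * ps u om 0 k).
Proof.
move=> tr rs st; have [[_ cps] _ hq _] := hP.
have rin : r \in `[ti, t] by rewrite in_itv/= tr (le_trans rs).
have sin : s \in `[ti, t] by rewrite in_itv/= st (le_trans tr).
have cf : {within `[ti, t], continuous (fun u => m^-1 * ps u om 0 k)}.
  by move=> x; apply: cvgM; [exact: cvg_cst|exact: coord_within].
rewrite (hq om r rin) (hq om s sin) !mxE.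
have E u : (\int[lebesgue_measure]_(r0 in `[u, t]) (m^-1 *: ps r0 om) 0 k)%R =
    tint u t (fun u => m^-1 * ps u om 0 k).
  by apply: eq_Rintegral => x _; rewrite mxE.
rewrite !E (@tint_split _ r s t)//; last exact: within_sub tr (lexx t) cf.
by ring.
Qed.

Lemma mom_increment om k r s : ti <= r -> r <= s -> s <= t ->
  ps r om 0 k - ps s om 0 k = - tint r s (fun u => b u (qs u om) (ps u om) 0 k)
    - noise_amplitude m tau beta * (w s om 0 k - w r om 0 k).
Proof.
move=> tr rs st; have [_ _ _ hp] := hP.
have rin : r \in `[ti, t] by rewrite in_itv/= tr (le_trans rs).
have sin : s \in `[ti, t] by rewrite in_itv/= st (le_trans tr).
rewrite (hp om r rin) (hp om s sin) !mxE.
have E u : (\int[lebesgue_measure]_(r0 in `[u, t]) b r0 (qs r0 om) (ps r0 om) 0 k)%R =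
    tint u t (fun u => b u (qs u om) (ps u om) 0 k) by [].
rewrite !E (@tint_split _ r s t)//; last exact: within_sub tr (lexx t) (@cb om k).
by ring.
Qed.

Lemma end_pos om : ti <= t -> qs t om = q.
Proof.
move=> tt; have [_ _ hq _] := hP.
rewrite hq ?in_itv/= ?tt ?lexx//; apply/rowP => k.
by rewrite !mxE -/(tint _ _ _) tint_self subr0.
Qed.

Lemma end_mom om : ti <= t -> ps t om = p.
Proof.
move=> tt; have [_ _ _ hp] := hP.
rewrite hp ?in_itv/= ?tt ?lexx//; apply/rowP => k.
by rewrite !mxE -/(tint _ _ _) tint_self subrr mulr0 !subr0.
Qed.

End pathwise_dynamics.

(** * Continuity of the force *)

Section potential.
Context (R : realType) (d : nat).
Variables (ti t : R) (U : R -> 'rV[R]_d -> R).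
Hypothesis hU : regular_potential ti U.

Lemma continuous_grad s : ti <= s -> continuous (grad (U s)).
Proof.
move=> ts; have [_ _ cU] := hU.
suff : {within setT, continuous ((fun z : R * 'rV[R]_d => grad (U z.1) z.2) \o (fun y => (s, y)))}.
  move=> /subspace_continuousP h y S hS.
  have h1 : \forall z \near y, setT z -> S (grad (U s) z) := h y I S hS.
  have : \forall z \near y, S (grad (U s) z); last by [].
  by apply: filterS h1 => z h2; exact: h2.
apply: within_comp cU => //.
apply: continuous_subspaceT => y S /nbhs_ballP[e /= e0 he].
by apply/nbhs_ballP; exists e => // z yz; apply: he; split=> //=; exact: ballxx.
Qed.

Lemma within_grad_path (x : R -> 'rV[R]_d) : {within `[ti, t], continuous x} ->
  {within `[ti, t], continuous (fun s => grad (U s) (x s))}.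
Proof.
move=> cx; have [_ _ cU] := hU.
have := @within_comp _ _ _ `[ti, t]%classic _ (fun s => (s, x s)) _ _ _ cU; apply.
  have idw : {within `[ti, t], continuous (fun s : R => s)}.
    by apply: continuous_subspaceT => y; exact: cvg_id.
  move=> y; apply/cvg_ballP => e e0.
  have /cvg_ballP/(_ e e0) h1 := @cx y.
  have /cvg_ballP/(_ e e0) h3 := @idw y.
  by apply: filterS2 h1 h3 => z b1 b2; split.
by move=> s /=; rewrite in_itv/= => /andP[].
Qed.

Lemma continuous_power s : ti <= s ->
  continuous (fun z : 'rV[R]_d * 'rV[R]_d => dotp (grad (U s) z.1) z.2).
Proof.
move=> ts; apply: continuous_sumr => k; apply: continuous_mulr => z.
  apply: (@cvg_comp _ _ _ fst (fun y : 'rV[R]_d => grad (U s) y 0 k)); first exact: cvg_fst.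
  apply: (@cvg_comp _ _ _ (grad (U s)) (fun y : 'rV[R]_d => y 0 k)).
    exact: continuous_grad.
  exact: coord_continuous.
apply: (@cvg_comp _ _ _ snd (fun y : 'rV[R]_d => y 0 k)); first exact: cvg_snd.
exact: coord_continuous.
Qed.

End potential.

(** * The weighted density as a process adapted to the backward filtration *)

Section flat_martingale.
Context (R : realType) (d : nat) (m tau beta ti t : R).
Hypotheses (hm : 0 < m) (htau : 0 < tau) (hbeta : 0 < beta).
Variables (U : R -> 'rV[R]_d -> R) (rho : R -> 'rV[R]_d -> 'rV[R]_d -> R).
Hypothesis hU : regular_potential ti U.
Hypothesis hrho : fokker_planck_solution m tau beta ti U rho.
Hypothesis tt : ti <= t.
Context (disp : measure_display) (Om : measurableType disp) (P : probability Om R).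
Variables (w wf qs ps : R -> Om -> 'rV[R]_d) (q p : 'rV[R]_d).
Hypothesis mw : forall s (k : 'I_d), s \in `[ti, t] -> measurable_fun setT (fun om => w s om 0 k).
(** Two noises are present: the filtration is the one generated by [w], while the equation is driven
    by [wf], whose earlier increments are independent of that same filtration under P. *)
Hypothesis hwf : backward_wiener P ti t (backward_filtration t w) wf.
Hypothesis hP : backward_process m tau beta ti t (backward_filtration t w)
  (drift_flat tau U) wf q p qs ps.
Hypothesis hD : class_D P ti t (backward_filtration t w)
  (martingale_candidate m beta t U rho qs ps).

Notation Gn := (bgen t w).
Notation M := (martingale_candidate m beta t U rho qs ps).

Let cqs om : {within `[ti, t], continuous (qs ^~ om)}.
Proof. by have [[h _] _ _ _] := hP; exact: h. Qed.

Let cps om : {within `[ti, t], continuous (ps ^~ om)}.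
Proof. by have [[_ h] _ _ _] := hP; exact: h. Qed.

Lemma within_drift_flat om k :
  {within `[ti, t], continuous (fun r => drift_flat tau U r (qs r om) (ps r om) 0 k)}.
Proof.
have cg := @within_grad_path _ _ ti t U hU _ (@cqs om).
have c1 := @coord_within _ _ ti t _ k cg.
have c2 := @coord_within _ _ ti t _ k (@cps om).
have -> : (fun r => drift_flat tau U r (qs r om) (ps r om) 0 k) =
   (fun r => tau^-1 * ps r om 0 k - grad (U r) (qs r om) 0 k).
  by apply/funext => r; rewrite /drift_flat !mxE.
move=> x; apply: cvgB; last exact: c1.
by apply: cvgM; [exact: cvg_cst|exact: c2].
Qed.

Definition alf (om : Om) (r : R) : R := beta / m * dotp (grad (U r) (qs r om)) (ps r om).

Lemma within_dotp om : {within `[ti, t], continuous (fun r => dotp (grad (U r) (qs r om)) (ps r om))}.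
Proof.
have cg := @within_grad_path _ _ ti t U hU _ (@cqs om).
apply: continuous_sumr => k; apply: continuous_mulr.
  exact: (@coord_within _ _ ti t _ k cg).
exact: (@coord_within _ _ ti t _ k (@cps om)).
Qed.

Lemma within_alf om : {within `[ti, t], continuous (alf om)}.
Proof.
apply: continuous_mulr; [exact: cst_continuous|exact: within_dotp].
Qed.

Lemma candidateE s om : ti <= s ->
  M s om = expR (- tint s t (alf om)) * wden m beta rho s (qs s om) (ps s om).
Proof.
move=> ts; rewrite /martingale_candidate /wden /mbw mulrA; congr (expR (- _) * _ * _).
rewrite tintZl//; exact: within_sub ts (lexx t) (@within_dotp om).
Qed.

Lemma past_qs k s : ti <= s -> s <= t -> past Gn s (fun om => qs s om 0 k).
Proof.
move=> ts st; have [_ [h _] _ _] := hP => _ A mA; rewrite setTI.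
by apply: h => //; rewrite in_itv/= ts.
Qed.

Lemma past_ps k s : ti <= s -> s <= t -> past Gn s (fun om => ps s om 0 k).
Proof.
move=> ts st; have [_ [_ h] _ _] := hP => _ A mA; rewrite setTI.
by apply: h => //; rewrite in_itv/= ts.
Qed.

Lemma past_le_bgen r s X : r <= s -> past Gn s X -> past Gn r X.
Proof. by move=> rs pX _ A mA; apply: (bgen_mono rs); exact: pX. Qed.

Lemma past_comp s (f : 'rV[R]_d -> 'rV[R]_d -> R) : ti <= s -> s <= t ->
  continuous (fun z : 'rV[R]_d * 'rV[R]_d => f z.1 z.2) ->
  past Gn s (fun om => f (qs s om) (ps s om)).
Proof.
move=> ts st cf.
apply: (@measurable_cont_vec2 R _ (g_sigma_algebraType (Gn s)) d (qs s) (ps s)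
  (fun z => f z.1 z.2)).
- by move=> k; exact: past_qs.
- by move=> k; exact: past_ps.
- by move=> om; exact: cf.
Qed.

(** The integral involves only times r >= s, all of which belong to the past of s. *)
Lemma past_alf s : ti <= s -> s <= t -> past Gn s (fun om => tint s t (alf om)).
Proof.
move=> ts st.
apply: (@measurable_tint R _ (g_sigma_algebraType (Gn s)) s t (fun r om => alf om r)) => //.
  by move=> om; exact: within_sub ts (lexx t) (@within_alf om).
move=> r /andP[sr rt]; have tr := le_trans ts sr; apply: past_le_bgen sr _.
apply: (@past_comp r (fun y z => beta / m * dotp (grad (U r) y) z)) => //.
by apply: continuous_mulr; [exact: cst_continuous|exact: continuous_power hU _ tr].
Qed.

Lemma past_En s : ti <= s -> s <= t -> past Gn s (fun om => expR (- tint s t (alf om))).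
Proof.
move=> ts st; apply: measurableT_comp => //; apply: measurableT_comp => //.
exact: past_alf.
Qed.

Lemma continuous_slice (f : R -> 'rV[R]_d -> 'rV[R]_d -> R) s :
  continuous_after ti f -> ti < s -> continuous (fun z : 'rV[R]_d * 'rV[R]_d => f s z.1 z.2).
Proof.
move=> cf ts z S hS.
have := cf (s, z.1, z.2) ts S hS.
move=> /nbhs_ballP[e /= e0 he]; apply/nbhs_ballP; exists e => //= y [y1 y2].
by apply: (he (s, y.1, y.2)); split=> //=; split=> //=; exact: ballxx.
Qed.

(** Unlike the derivatives, [rho] is continuous up to the initial time, so s = ti is included. *)
Lemma continuous_rho_slice s : ti <= s ->
  continuous (fun z : 'rV[R]_d * 'rV[R]_d => rho s z.1 z.2).
Proof.
move=> ts z S hS; have [_ /subspace_continuousP/(_ (s, z.1, z.2) ts) cr _ _] := hrho.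
have : \forall y \near (s, z.1, z.2), ti <= y.1.1 -> S (rho y.1.1 y.1.2 y.2) := cr S hS.
move=> /nbhs_ballP[e /= e0 he]; apply/nbhs_ballP; exists e => //= y [y1 y2].
by apply: (he (s, y.1, y.2)) => //; split=> //=; split=> //=; exact: ballxx.
Qed.

Lemma past_candidate s : ti <= s -> s <= t -> past Gn s (M s).
Proof.
move=> ts st; rewrite /past (_ : M s = fun om => expR (- tint s t (alf om)) *
    wden m beta rho s (qs s om) (ps s om)); last first.
  by apply/funext => om; exact: candidateE.
apply: measurable_funM; first exact: past_En.
apply: past_comp => //; apply: continuous_mulr; last exact: continuous_rho_slice.
move=> z; apply: (@cvg_comp _ _ _ snd (mbw m beta)); first exact: cvg_snd.
exact: continuous_mbw.
Qed.

Lemma measurable_candidate s : ti <= s -> s <= t -> measurable_fun setT (M s).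
Proof.
move=> ts st _ A mA; apply: (bgen_sub mw ts st); exact: past_candidate.
Qed.

(** The coefficients of [ito_main] for the weighted density, times the exponential weight. The
    factor 1/2 stands on the diagonal only, since each mixed pair is counted once. *)
Definition coef (l : noise_index d) (s : R) (om : Om) : R :=
  expR (- tint s t (alf om)) * match l with
  | inl k => - noise_amplitude m tau beta * wden_p m beta rho k s (qs s om) (ps s om)
  | inr (j, k) =>
     if j == k then 1 / 2 * noise_amplitude m tau beta ^+ 2 * wden_pp m beta rho k k s (qs s om) (ps s om)
     else if (j < k)%N then noise_amplitude m tau beta ^+ 2 * wden_pp m beta rho j k s (qs s om) (ps s om)
     else 0
  end.

(** A stopping time with values in [a, t] is one on [ti, t]: for s < a the event s <= T is
    certain. *)
Lemma class_D_stopping a : ti <= a -> forall e : R, 0 < e -> exists K : R,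
  forall T : Om -> R, stopping a t Gn T ->
  (\int[P]_(om in [set om | (K < `|M (T om) om|)%R]) `|M (T om) om|%:E <= e%:E)%E.
Proof.
move=> tia e e0; have [K hK] := hD e0; exists K => T [hT1 hT2]; apply: hK; split.
  by move=> om; rewrite in_itv/=; have /andP[aT ->] := hT1 om; rewrite (le_trans tia).
move=> s; rewrite in_itv/= => /andP[ts st].
have [as_|sa] := leP a s; first exact: hT2.
rewrite (_ : [set _ | _] = setT); first exact: (@measurableT _ (g_sigma_algebraType (Gn s))).
apply/seteqP; split => // om _ /=; have /andP[aT _] := hT1 om.
exact: le_trans (ltW sa) aT.
Qed.

Section after_initial_time.
Variable a : R.
Hypotheses (ta : ti < a) (at_ : a < t).

Lemma past_coef l s : a <= s -> s <= t -> past Gn s (coef l s).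
Proof.
move=> as_ st; have ts : ti < s by exact: lt_le_trans ta as_.
apply: measurable_funM; first by apply: past_En => //; exact: ltW.
have pp k : past Gn s (fun om => wden_p m beta rho k s (qs s om) (ps s om)).
  apply: past_comp (ltW ts) st _; apply: continuous_slice ts; exact: continuous_wden_p hrho k.
have ppp j k : past Gn s (fun om => wden_pp m beta rho j k s (qs s om) (ps s om)).
  apply: past_comp (ltW ts) st _; apply: continuous_slice ts; exact: continuous_wden_pp hrho j k.
case: l => [k|[j k]]; first by apply: measurable_funM => //; exact: pp.
case: (eqVneq j k) => _; first by apply: measurable_funM => //; exact: ppp.
by case: (ltnP j k) => _ //; apply: measurable_funM => //; exact: ppp.
Qed.

Let cqa om : {within `[a, t], continuous (qs ^~ om)} := within_sub (ltW ta) (lexx t) (@cqs om).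
Let cpa om : {within `[a, t], continuous (ps ^~ om)} := within_sub (ltW ta) (lexx t) (@cps om).
Let caa om : {within `[a, t], continuous (alf om)} := within_sub (ltW ta) (lexx t) (@within_alf om).

Let along f om : continuous_after ti f -> continuous_along a t (qs ^~ om) (ps ^~ om) f.
Proof. by move=> cf s /andP[as_ _]; apply: cf => /=; exact: lt_le_trans ta as_. Qed.

(** Each coefficient is continuous along the path on [a, t], and a > ti matters here: the
    derivatives of [rho] are continuous only after [ti]. *)
Lemma coef_bounded om : exists K, forall l s, a <= s -> s <= t -> `|coef l s om| <= K.
Proof.
have h l : exists K : R, 0 < K /\ forall s, a <= s <= t -> `|coef l s om| <= K.
  suff : {within `[a, t], continuous (fun s => coef l s om)}.
    by move=> /within_bounded[K K0 hK]; exists K.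
  apply: continuous_mulr; first exact: within_En (@caa om).
  have pp k := within_at_path (@cqa om) (@cpa om) (@along _ om (@continuous_wden_p _ _ _ _ _ _ _ _ hrho k)).
  have ppp j k := within_at_path (@cqa om) (@cpa om) (@along _ om (@continuous_wden_pp _ _ _ _ _ _ _ _ hrho j k)).
  case: l => [k|[j k]]; first by apply: continuous_mulr; [exact: cst_continuous|exact: pp].
  case: (eqVneq j k) => _.
    by apply: continuous_mulr; [exact: cst_continuous|exact: ppp].
  case: (ltnP j k) => _; last exact: cst_continuous.
  by apply: continuous_mulr; [exact: cst_continuous|exact: ppp].
have [K hK] := choice h.
exists (\sum_l K l) => l s as_ st.
apply: (le_trans ((hK l).2 s _)); first by rewrite as_.
by rewrite (bigD1 l)//= lerDl sumr_ge0// => i _; apply: ltW; exact: (hK i).1.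
Qed.

Lemma step_small_candidate om : small a t (fun r s => quad wf r s om)
  (fun r s => M r om - M s om - \sum_l coef l s om * noise wf l r s om).
Proof.
pose bf r := drift_flat tau U r (qs r om) (ps r om).
have cwa : {within `[a, t], continuous (wf ^~ om)}.
  by have [[_ _ h _] _ _] := hwf; exact: within_sub (ltW ta) (lexx t) (@h om).
have cbf : {within `[a, t], continuous bf}.
  apply: within_sub (ltW ta) (lexx t) _; have cg := @within_grad_path _ _ ti t U hU _ (@cqs om).
  by move=> x; apply: cvgB; [apply: cvgZr; exact: cps|exact: cg].
have lt_ti s : a <= s <= t -> ti < s by move=> /andP[as_ _]; exact: lt_le_trans ta as_.
have hq k r s : a <= r -> r <= s -> s <= t ->
    qs r om 0 k - qs s om 0 k = - tint r s (fun u => m^-1 * ps u om 0 k).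
  by move=> ar; apply: (pos_increment hP); exact: le_trans (ltW ta) ar.
have hp k r s : a <= r -> r <= s -> s <= t ->
    ps r om 0 k - ps s om 0 k = - tint r s (fun u => bf u 0 k)
    - noise_amplitude m tau beta * (wf s om 0 k - wf r om 0 k).
  move=> ar; apply: (mom_increment hP within_drift_flat); exact: le_trans (ltW ta) ar.
have := @ito_path R d a t m (noise_amplitude m tau beta) (qs ^~ om) (ps ^~ om) (wf ^~ om) bf (alf om)
  (@cqa om) (@cpa om) cwa cbf (@caa om) hq hp (wden m beta rho) (wden_t m beta rho)
  (wden_q m beta rho) (wden_p m beta rho) (wden_pp m beta rho)
  (fun s q p sab => is_derive_wden_t hrho q p (lt_ti s sab))
  (fun k s q p sab => is_derive_wden_q hrho k q p (lt_ti s sab))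
  (fun k s q p sab => is_derive_wden_p hrho k q p (lt_ti s sab))
  (fun j k s q p sab => is_derive_wden_pp hrho j k q p (lt_ti s sab))
  (@along _ om (@continuous_wden _ _ _ _ _ _ _ _ hrho)) (@along _ om (@continuous_wden_t _ _ _ _ _ _ _ _ hrho))
  (fun k => @along _ om (@continuous_wden_q _ _ _ _ _ _ _ _ hrho k))
  (fun k => @along _ om (@continuous_wden_p _ _ _ _ _ _ _ _ hrho k))
  (fun j k => @along _ om (@continuous_wden_pp _ _ _ _ _ _ _ _ hrho j k))
  (fun s sab => wden_pde hm htau hbeta hrho (qs s om) (ps s om) (lt_ti s sab)).
move=> h; apply: (small_ext h) => r s ar rs st.
rewrite !candidateE; [|exact: le_trans (ltW ta) (le_trans ar rs)|exact: le_trans (ltW ta) ar].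
congr (_ - _); rewrite big_sumType/= /ito_main !mulrDr -addrA; congr (_ + _).
  by rewrite mulr_sumr; apply: eq_bigr => k _; rewrite /coef /dwn mulrA.
pose G j k := coef (inr (j, k)) s om * noise wf (inr (j, k)) r s om.
rewrite [RHS](eq_bigr (fun z => G z.1 z.2)); last by case.
(* The larger index k becomes the outer one, as in [ito_main]; the diagonal term is then split
   off. *)
rewrite -(pair_bigA _ G)/= exchange_big/= !mulr_sumr -big_split/=.
apply: eq_bigr => k _; rewrite [in RHS](bigD1 k)//= /G /coef /noise eqxx mulrA; congr (_ + _).
rewrite mulr_sumr big_mkcond [RHS]big_mkcond/=; apply: eq_bigr => j _.
case: (eqVneq j k) => [->|_]/=; first by rewrite ltnn.
by case: (ltnP j k) => _; rewrite ?mulr0// mulrA.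
Qed.

Lemma candidate_mean_after : P.-integrable setT (EFin \o M a) /\ (\int[P]_om M a om)%R = mbw m beta p * rho t q p.
Proof.
have tia := ltW ta.
have mono r s : ti <= r -> r <= s -> s <= t -> <<s Gn s >> `<=` <<s Gn r >>.
  by move=> _ rs _; exact: bgen_mono.
have sub s : ti <= s -> s <= t -> <<s Gn s >> `<=` @measurable _ Om.
  by move=> ts st; exact: (bgen_sub mw ts st).
apply: (@terminal_mean R _ Om P a t (noise_index d) Gn M (mbw m beta p * rho t q p) coef (noise wf)
  (quad wf) _ _ at_).
- by move=> r s ar; apply: mono; exact: le_trans ar.
- by move=> s as_; apply: sub; exact: le_trans as_.
- by move=> s as_; apply: past_candidate; exact: le_trans as_.
- by move=> om; rewrite candidateE// tint_self oppr0 expR0 mul1r (end_pos hP)// (end_mom hP).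
- by move=> l s as_ st; exact: past_coef.
- exact: coef_bounded.
- by move=> l r s ar rs st; apply: (past_noise hwf) => //; exact: le_trans ar.
- move=> l r s ar rs st; apply: (noise_sqr_integrable hwf) => //; exact: le_trans ar.
- move=> l r s ar rs st; apply: (noise_sqr_mean hwf) => //; exact: le_trans ar.
- move=> l r s Z ar rs st; apply: (noise_indep hwf sub) => //; exact: le_trans ar.
- move=> r s ar rs st; apply: (measurable_quad hwf) => //; exact: le_trans ar.
- by move=> r s om ar rs st; exact: quad_ge0.
- move=> r s ar rs st; apply: (quad_mean hwf) => //; exact: le_trans ar.
- exact: step_small_candidate.
exact: class_D_stopping.
Qed.

End after_initial_time.

(** M itself contains [rho] but none of its derivatives, so it is continuous along paths up to [ti].
    Deterministic times are stopping times, hence class (D) gives uniform integrability along a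
    sequence of times decreasing to [ti]. *)
Theorem candidate_mean : P.-integrable setT (EFin \o M ti) /\ (\int[P]_om M ti om)%R = mbw m beta p * rho t q p.
Proof.
have [tit|] := ltP ti t; last first.
  move=> tti; have -> : M ti = cst (mbw m beta p * rho t q p).
    apply/funext => om; have tE : ti = t by apply/le_anti; rewrite tt.
    by rewrite candidateE// {1 2 3}tE tE tint_self oppr0 expR0 mul1r (end_pos hP)// (end_mom hP).
  split; first exact: finite_measure_integrable_cst.
  by rewrite Rintegral_cst// [X in fine X]probability_setT mulr1.
(* The denominator [n.+2] keeps x n strictly below t already for n = 0. *)
pose x n : R := ti + (t - ti) / n.+2%:R.
have d0 : 0 < t - ti by rewrite subr_gt0.
have xti n : ti < x n by rewrite ltrDl divr_gt0.
have xt n : x n < t.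
  by rewrite -ltrBrDl ltr_pdivrMr// ltr_pMr// ltr1n.
have MD := class_D_stopping (lexx ti).
have mM s : ti <= s -> s <= t -> measurable_fun setT (M s) by exact: measurable_candidate.
have ui1 : ui P (fun n => M (x n)).
  apply: (ui_stopped MD (T := fun n _ => x n)) => n; first by apply: stopping_cst; exact: ltW.
  by apply: mM; exact: ltW.
have ui2 : ui P (fun _ : nat => M ti).
  apply: (ui_stopped MD (T := fun n _ => ti)) => n; [exact: stopping_cst|exact: mM].
have i0 : P.-integrable setT (EFin \o M ti).
  by apply: (@ui_integrable _ _ _ P (fun _ => M ti) 0%N); [exact: mM|exact: ui2].
split=> //.
have cvgx : x n @[n --> \oo] --> ti.
  rewrite -[X in _ --> X]addr0; apply: cvgD; first exact: cvg_cst.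
  rewrite -[X in _ --> X](mulr0 (t - ti)); apply: cvgM; first exact: cvg_cst.
  apply/cvgrPdist_lt => e e0; near=> n.
  rewrite sub0r normrN ger0_norm ?invr_ge0// invf_plt ?posrE//.
  have h : (Num.truncn e^-1).+1%:R <= n.+2%:R :> R.
    by rewrite ler_nat ltnS; apply: leqW; near: n; exact: nbhs_infty_ge.
  exact: lt_le_trans (truncnS_gt _) h.
have cvgM om : M (x n) om @[n --> \oo] --> M ti om.
  have cw : {within `[ti, t], continuous (fun s => (s, qs s om, ps s om))}.
    exact: (@cgamma R d ti t _ _ (@cqs om) (@cps om)).
  have [_ cr _ _] := hrho.
  have c1 : {within `[ti, t], continuous (fun s => rho s (qs s om) (ps s om))}.
    have := @within_comp _ _ _ `[ti, t]%classic _ _ _ cw _ cr; apply.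
    by move=> s /=; rewrite in_itv/= => /andP[].
  have c2 : {within `[ti, t], continuous (fun s => mbw m beta (ps s om))}.
    have := @within_comp _ _ _ `[ti, t]%classic setT _ (mbw m beta) (@cps om); apply => //.
    by apply: continuous_subspaceT => y; exact: continuous_mbw.
  have c3 : {within `[ti, t], continuous (fun s => M s om)}.
    have h := continuous_mulr (within_En (@within_alf om)) (continuous_mulr c2 c1).
    have /subspace_continuousP h' := h.
    apply/subspace_continuousP => s /[dup] sin; rewrite /= in_itv/= => /andP[ts s_t] S hS.
    have h1 : \forall y \near s, y \in `[ti, t] ->
       S (expR (- tint y t (alf om)) * (mbw m beta (ps y om) * rho y (qs y om) (ps y om))).
      by apply: (h' s sin S); have hS' : nbhs (M s om) S := hS; rewrite candidateE// in hS'.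
    have : \forall y \near s, y \in `[ti, t] -> S (M y om); last by [].
    apply: filterS h1 => y h1 yin; rewrite candidateE; first exact: h1.
    by move: yin; rewrite in_itv/= => /andP[].
  move=> S hS; have /subspace_continuousP := c3; move=> /(_ ti).
  rewrite /= in_itv/= lexx (ltW tit) => /(_ isT S hS) => h.
  have h1 : \forall y \near ti, y \in `[ti, t] -> S (M y om) := h.
  have h2 : \forall n \near \oo, x n \in `[ti, t] -> S (M (x n) om) := cvgx _ h1.
  have : \forall n \near \oo, S (M (x n) om); last by [].
  by apply: filterS h2 => n; apply; rewrite in_itv/= (ltW (xti n)) (ltW (xt n)).
have c := ui_cvg (fun n => mM _ (ltW (xti n)) (ltW (xt n))) (mM _ (lexx ti) tt) ui1 ui2 cvgM.
have e : (fun n => (\int[P]_om M (x n) om)%R) = (fun=> mbw m beta p * rho t q p).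
  by apply/funext => n; exact: (candidate_mean_after (xti n) (xt n)).2.
rewrite e in c; exact: (norm_cvg_unique c (cvg_cst _)).
Unshelve. all: by end_near.
Qed.

End flat_martingale.

(** * Partitions and limits in probability *)

Section partitions.
Context (R : realType).
Implicit Types (a b : R) (s : seq R).

Lemma itv_partition_nthS a b s i : itv_partition a b s -> (i < size s)%N ->
  nth b (a :: s) i < nth b (a :: s) i.+1.
Proof. by move=> [/(pathP b) h _] si; exact: h. Qed.

Lemma itv_partition_nth_in a b s i : itv_partition a b s -> (i <= size s)%N ->
  a <= nth b (a :: s) i <= b.
Proof. by move=> h si; rewrite itv_partition_nth_ge// itv_partition_nth_le. Qed.

(** Both endpoint values of h are within e1 of h u throughout a fine interval, so their sum counts f
    h twice. *)
Lemma riemann_pair a b (f h : R -> R) (e : R) :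
  {within `[a, b], continuous f} -> {within `[a, b], continuous h} -> 0 < e ->
  exists2 del : R, 0 < del & forall s, itv_partition a b s ->
    (forall i, (i < size s)%N -> nth b (a :: s) i.+1 - nth b (a :: s) i < del) ->
    `|\sum_(0 <= i < size s) tint (nth b (a :: s) i) (nth b (a :: s) i.+1) f *
        (h (nth b (a :: s) i) + h (nth b (a :: s) i.+1))
      - 2 * tint a b (fun u => f u * h u)| <= e.
Proof.
move=> cf ch e0; have [C C0 hC] := within_bounded cf.
have [ab|ba] := leP a b; last first.
  by exists 1 => // s /itv_partition_le; rewrite leNgt ba.
pose e1 := e / (2 * (C * (b - a) + 1)).
have D0 : 0 < 2 * (C * (b - a) + 1) by rewrite mulr_gt0// ltr_wpDl// mulr_ge0 ?subr_ge0// ltW.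
have e10 : 0 < e1 by rewrite divr_gt0.
have [del del0 hd] := ucont_within ch e10.
exists del => // s hs mesh; set x := nth b (a :: s).
have xS i : (i < size s)%N -> x i <= x i.+1 by move=> si; exact/ltW/itv_partition_nthS.
have xin i : (i <= size s)%N -> a <= x i <= b by exact: itv_partition_nth_in.
have xN : x (size s) = b by exact: itv_partition_nth_size hs.
have cfh : {within `[a, b], continuous (fun u => f u * h u)} by exact: continuous_mulr.
have cfh' : {within `[x 0%N, x (size s)], continuous (fun u => f u * h u)} by rewrite xN.
rewrite -[in tint a b _]xN (@tint_sum_mono R x (size s) _ xS cfh') mulr_sumr -sumrB.
apply: (@le_trans _ _ (\sum_(0 <= i < size s) 2 * e1 * C * (x i.+1 - x i))); last first.
  rewrite -mulr_sumr telescope_sumr// xN /x /=.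
  have -> : e = e1 * (2 * (C * (b - a) + 1)) by rewrite /e1 divfK// gt_eqF.
  rewrite -subr_ge0 (_ : _ - _ = 2 * e1); last by ring.
  by rewrite mulr_ge0// ltW.
apply: (le_trans (ler_norm_sum _ _ _)); rewrite !big_nat; apply: ler_sum => i /= si.
have /andP[ax xb] := xin i (ltnW si); have /andP[ax1 xb1] := xin _ si.
have cfi : {within `[x i, x i.+1], continuous f} by exact: within_sub cf.
have cfhi : {within `[x i, x i.+1], continuous (fun u => f u * h u)} by exact: within_sub cfh.
rewrite mulrC -tintZl// -tintZl// -tintB//; last 2 first.
- by apply: continuous_mulr => //; exact: cst_continuous.
- by apply: continuous_mulr => //; exact: cst_continuous.
apply: tint_bound; first exact: xS.
  move=> z; apply: cvgB.
    by apply: cvgM; [exact: cvg_cst|exact: cfi].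
  by apply: cvgM; [exact: cvg_cst|exact: cfhi].
move=> u /andP[xu ux].
have uin : a <= u <= b by rewrite (le_trans ax xu) (le_trans ux xb1).
have -> : (h (x i) + h (x i.+1)) * f u - 2 * (f u * h u) =
  ((h (x i) - h u) + (h (x i.+1) - h u)) * f u by ring.
rewrite normrM ler_pM ?hC//.
have m1 := mesh i si; rewrite -/x in m1.
have n1 : `|h (x i) - h u| < e1.
  apply: hd; rewrite ?ax ?xb// ger0_norm ?subr_ge0//; lra.
have n2 : `|h (x i.+1) - h u| < e1.
  apply: hd; rewrite ?ax1 ?xb1// ler0_norm ?subr_le0//; lra.
apply: (le_trans (ler_normD _ _)); lra.
Qed.

(** Sequences along which the limit of vanishing mesh is tested, so that convergence theorems for
    sequences apply. *)
Definition refining a b (sq : nat -> seq R) := (forall n, itv_partition a b (sq n)) /\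
  forall n i, (i < size (sq n))%N ->
    nth b (a :: sq n) i.+1 - nth b (a :: sq n) i < n.+1%:R^-1.

Lemma riemann_pair_cvg a b (f h : R -> R) (sq : nat -> seq R) : refining a b sq ->
  {within `[a, b], continuous f} -> {within `[a, b], continuous h} ->
  \sum_(0 <= i < size (sq n)) tint (nth b (a :: sq n) i) (nth b (a :: sq n) i.+1) f *
    (h (nth b (a :: sq n) i) + h (nth b (a :: sq n) i.+1)) @[n --> \oo]
  --> 2 * tint a b (fun u => f u * h u).
Proof.
move=> [hp hm] cf ch; apply/cvgrPdist_le => e e0.
have [del del0 hd] := riemann_pair cf ch e0.
near=> n; rewrite distrC; apply: hd => // i si.
apply: (lt_trans (hm n i si)); rewrite invf_plt ?posrE//.
have h1 : (Num.truncn del^-1).+1%:R <= n.+1%:R :> R.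
  by rewrite ler_nat ltnS; near: n; exact: nbhs_infty_ge.
exact: lt_le_trans (truncnS_gt _) h1.
Unshelve. all: by end_near.
Qed.

Lemma fine_partition a b (e : R) : a <= b -> 0 < e -> exists2 s, itv_partition a b s &
  forall i, (i < size s)%N -> nth b (a :: s) i.+1 - nth b (a :: s) i < e.
Proof.
(* For a = b the only partition is the empty one. *)
move=> ab e0; have [->|ne] := eqVneq a b; first by exists [::].
have ltab : a < b by rewrite lt_neqAle ne.
have [N _ /(_ N (leqnn N))[N0 hN]] := mesh_lt a b e0.
have xE i : (i <= N)%N -> nth b (a :: [seq ugrid a b N j.+1 | j <- iota 0 N]) i = ugrid a b N i.
  case: i => [|i] iN /=; first by rewrite ugrid0.
  by rewrite (nth_map 0%N) ?size_iota// nth_iota.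
exists [seq ugrid a b N j.+1 | j <- iota 0 N]; last first.
  by move=> i; rewrite size_map size_iota => iN; rewrite !xE ?ugridS// ltnW.
split.
  apply/(pathP b) => i; rewrite size_map size_iota => iN.
  rewrite (xE i (ltnW iN)) -[nth b _ i]/(nth b (a :: _) i.+1) (xE i.+1 iN).
  by rewrite -subr_gt0 ugridS divr_gt0 ?subr_gt0// ltr0n.
apply/eqP; have := xE N (leqnn N); rewrite ugridN// => {2}<-.
by rewrite (last_nth b) size_map size_iota.
Qed.

End partitions.

(** * Limits in probability over partitions *)

Section limits_in_probability.
Context (R : realType) (disp : measure_display) (Om : measurableType disp).
Variables (P : probability Om R) (a b : R).
Implicit Types (S : seq R -> Om -> R) (L : Om -> R).

Let Smeas S := forall s, itv_partition a b s -> measurable_fun setT (S s).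

Lemma measurable_abs_ge (f : Om -> R) (c : R) : measurable_fun setT f ->
  measurable [set x | c <= `|f x|].
Proof.
move=> mf; rewrite (_ : [set _ | _] = (fun x => `|f x|) @^-1` `[c, +oo[).
  rewrite -[_ @^-1` _]setTI; have : measurable_fun setT (fun x => `|f x|).
    by apply: measurableT_comp => //; exact: normr_measurable.
  exact.
by apply/seteqP; split => x /=; rewrite in_itv/= andbT.
Qed.

Lemma limit_in_probabilityB S S' L L' : Smeas S -> Smeas S' ->
  limit_in_probability P a b S L -> limit_in_probability P a b S' L' ->
  limit_in_probability P a b (fun s om => S s om - S' s om) (fun om => L om - L' om).
Proof.
move=> mS mS' [mL hL] [mL' hL']; split; first exact: measurable_funB.
move=> e del e0 del0.
have e2 : 0 < e / 2 by rewrite divr_gt0.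
have del2 : 0 < del / 2 by rewrite divr_gt0.
have [n1 n10 h1] := hL _ _ e2 del2; have [n2 n20 h2] := hL' _ _ e2 del2.
exists (Num.min n1 n2); first by rewrite lt_min n10.
move=> s hs mesh.
have m1 : (P [set om | (e / 2 <= `|S s om - L om|)%R] <= (del / 2)%:E)%E.
  by apply: h1 => // i si; have := mesh i si; rewrite lt_min => /andP[].
have m2 : (P [set om | (e / 2 <= `|S' s om - L' om|)%R] <= (del / 2)%:E)%E.
  by apply: h2 => // i si; have := mesh i si; rewrite lt_min => /andP[].
have mA : measurable [set om | e / 2 <= `|S s om - L om|].
  by apply: measurable_abs_ge; apply: measurable_funB => //; exact: mS.
have mB : measurable [set om | e / 2 <= `|S' s om - L' om|].
  by apply: measurable_abs_ge; apply: measurable_funB => //; exact: mS'.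
apply: (@le_trans _ _ (P ([set om | e / 2 <= `|S s om - L om|] `|`
    [set om | e / 2 <= `|S' s om - L' om|]))).
  apply: le_measure; rewrite ?inE//.
  - apply: measurable_abs_ge; apply: measurable_funB; last exact: measurable_funB.
    by apply: measurable_funB; [exact: mS|exact: mS'].
  - exact: measurableU.
  move=> om /= he; apply/orP; rewrite leNgt [X in _ || X]leNgt -negb_and.
  apply/negP => /andP[l1 l2]; move: he; rewrite leNgt => /negP; apply.
  have -> : S s om - S' s om - (L om - L' om) = (S s om - L om) - (S' s om - L' om) by ring.
  by apply: (le_lt_trans (ler_normB _ _)); lra.
apply: (le_trans (measureU2 _ _ _)) => //.
by rewrite [del]splitr EFinD leeD.
Qed.

(** The difference of the sums with themselves is 0 and tends to L - L'. Since partitions of any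
    mesh exist, each event |L - L'| >= 1/(n+1) has probability below every positive number. *)
Lemma limit_in_probability_unique S L L' : a <= b -> Smeas S ->
  limit_in_probability P a b S L -> limit_in_probability P a b S L' ->
  {ae P, forall om, L om = L' om}.
Proof.
move=> ab mS hL hL'; have [mD hD] := limit_in_probabilityB mS mS hL hL'.
have h n : P [set om | n.+1%:R^-1 <= `|L om - L' om|] = 0%E.
  apply/eqP; rewrite eq_le measure_ge0 andbT; apply/lee_addgt0Pr => del del0; rewrite add0e.
  have n0 : 0 < (n.+1%:R^-1 : R) by rewrite invr_gt0.
  have [eta eta0 h1] := hD _ _ n0 del0.
  have [s hs mesh] := fine_partition ab eta0.
  have := h1 s hs mesh; congr (P _ <= _)%E.
  by apply/seteqP; split => om /=; rewrite subrr sub0r normrN.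
apply: (@negligibleS _ _ _ P (\bigcup_n [set om | n.+1%:R^-1 <= `|L om - L' om|])); last first.
  apply: negligible_bigcup => n; exists [set om | n.+1%:R^-1 <= `|L om - L' om|].
  by split; [exact: measurable_abs_ge|exact: h|].
move=> om /= /eqP ne.
have d0 : 0 < `|L om - L' om| by rewrite normr_gt0 subr_eq0.
exists (Num.truncn `|L om - L' om|^-1) => //=.
by rewrite invf_ple ?posrE// ltW// truncnS_gt.
Qed.

(** By contradiction: a failure provides, for each n, a bad partition of mesh below 1/(n+1). These
    form a refining sequence along which pointwise convergence implies convergence in
    probability. *)
Lemma limit_in_probability_of_cvg S L : Smeas S -> measurable_fun setT L ->
  (forall sq, refining a b sq -> forall om, S (sq n) om @[n --> \oo] --> L om) ->
  limit_in_probability P a b S L.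
Proof.
move=> mS mL hc; split=> // e del e0 del0; apply: contrapT => hn.
have bad n : exists s, [/\ itv_partition a b s,
    forall i, (i < size s)%N -> nth b (a :: s) i.+1 - nth b (a :: s) i < n.+1%:R^-1 &
    (del%:E < P [set om | (e <= `|S s om - L om|)%R])%E].
  apply: contrapT => hs; apply: hn; exists n.+1%:R^-1; first by rewrite invr_gt0.
  move=> s ps mesh; rewrite leNgt; apply/negP => hlt; apply: hs; by exists s.
have [sq hsq] := choice bad.
have rf : refining a b sq by split=> n; have [] := hsq n.
have mD n : measurable_fun setT (fun om => S (sq n) om - L om).
  by apply: measurable_funB => //; apply: mS; exact: rf.1.
have cD om : (fun n => S (sq n) om - L om) @ \oo --> (0 : R).
  by rewrite -(subrr (L om)); apply: cvgB; [exact: hc|exact: cvg_cst].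
(* One definition uses >= e, the other a strict inequality; halving e passes between them. *)
have e2 : 0 < e / 2 by rewrite divr_gt0.
have [N _ /(_ N (leqnn N)) hN] := pointwise_inprob0 P mD cD e2 del0.
have [_ _] := hsq N; rewrite ltNge => /negP; apply; apply: le_trans hN.
apply: le_measure; rewrite ?inE.
- exact: measurable_abs_ge.
- exact: measurable_abs_gt.
by move=> om /= h; apply: lt_le_trans h; lra.
Qed.

End limits_in_probability.

(** * Pre-point and post-point integrals *)

Lemma tint_sum (R : realType) (I : Type) (r : seq I) (a b : R) (f : I -> R -> R) :
  (forall k, {within `[a, b], continuous (f k)}) ->
  tint a b (fun u => \sum_(k <- r) f k u) = \sum_(k <- r) tint a b (f k).
Proof.
move=> cf; elim: r => [|k r IH].
  by rewrite big_nil /tint /Rintegral integral0_eq// => u _; rewrite big_nil.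
rewrite big_cons -IH -tintD//; last by apply: continuous_sumr => j; exact: cf.
by apply: eq_Rintegral => u _; rewrite big_cons.
Qed.

Section reference_process.
Context (R : realType) (d : nat) (m tau beta ti t : R).
Hypotheses (hm : 0 < m) (htau : 0 < tau) (hbeta : 0 < beta).
Variable U : R -> 'rV[R]_d -> R.
Hypothesis hU : regular_potential ti U.
Hypothesis tt : ti <= t.
Context (disp : measure_display) (Om : measurableType disp) (P : probability Om R).
Variables (w qs ps : R -> Om -> 'rV[R]_d) (q p : 'rV[R]_d).
Hypothesis mw : forall s (k : 'I_d), s \in `[ti, t] -> measurable_fun setT (fun om => w s om 0 k).
Hypothesis hI : backward_process m tau beta ti t (backward_filtration t w)
  (drift_ref U) w q p qs ps.

Notation sg := (noise_amplitude m tau beta).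
Notation Y := (fun s om => tau^-1 *: ps s om).
Notation pre := (prepoint_sum ti t w Y).
Notation post := (postpoint_sum ti t w Y).
Notation work := (fun om r => dotp (grad (U r) (qs r om)) (ps r om)).

Let cqs om : {within `[ti, t], continuous (qs ^~ om)}.
Proof. by have [[h _] _ _ _] := hI; exact: h. Qed.

Let cps om : {within `[ti, t], continuous (ps ^~ om)}.
Proof. by have [[_ h] _ _ _] := hI; exact: h. Qed.

Let cpsk om k : {within `[ti, t], continuous (fun r => ps r om 0 k)}.
Proof. exact: (@coord_within _ _ ti t _ k (@cps om)). Qed.

Let cgk om k : {within `[ti, t], continuous (fun r => grad (U r) (qs r om) 0 k)}.
Proof. exact: (@coord_within _ _ ti t _ k (@within_grad_path _ _ ti t U hU _ (@cqs om))). Qed.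

Let cwork om : {within `[ti, t], continuous (work om)}.
Proof.
apply: continuous_sumr => k; apply: continuous_mulr; [exact: cgk|exact: cpsk].
Qed.

Let mqs s : ti <= s <= t -> rvec (qs s).
Proof.
move=> /andP[ts st] k _ A mA; rewrite setTI; have [_ [h _] _ _] := hI.
by apply: (bgen_sub mw ts st); apply: h => //; rewrite in_itv/= ts.
Qed.

Let mps s : ti <= s <= t -> rvec (ps s).
Proof.
move=> /andP[ts st] k _ A mA; rewrite setTI; have [_ [_ h] _ _] := hI.
by apply: (bgen_sub mw ts st); apply: h => //; rewrite in_itv/= ts.
Qed.

Lemma amplitude_gt0 : 0 < sg.
Proof. by rewrite sqrtr_gt0 divr_gt0// mulr_gt0. Qed.

Lemma noise_increment om k r s : ti <= r -> r <= s -> s <= t ->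
  w s om 0 k - w r om 0 k = sg^-1 * (ps s om 0 k - ps r om 0 k
    + tint r s (fun u => grad (U u) (qs u om) 0 k)).
Proof.
move=> tr rs st.
have cd om' k' : {within `[ti, t], continuous (fun r => drift_ref U r (qs r om') (ps r om') 0 k')}.
  have -> : (fun r => drift_ref U r (qs r om') (ps r om') 0 k') =
     (fun r => (- 1) * grad (U r) (qs r om') 0 k').
    by apply/funext => u; rewrite /drift_ref !mxE mulN1r.
  by apply: continuous_mulr; [exact: cst_continuous|exact: cgk].
have := mom_increment hI cd om k tr rs st.
have -> : tint r s (fun u => drift_ref U u (qs u om) (ps u om) 0 k) =
    - tint r s (fun u => grad (U u) (qs u om) 0 k).
  rewrite -mulN1r -tintZl; last exact: within_sub tr st (@cgk om k).
  by apply: eq_Rintegral => u _; rewrite /drift_ref !mxE mulN1r.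
have s0 := amplitude_gt0; set T := tint _ _ _; set D := w s om 0 k - _ => h.
have -> : ps s om 0 k - ps r om 0 k + T = sg * D by rewrite -opprB h; ring.
by rewrite mulKf// gt_eqF.
Qed.

(** Twice the Stratonovich integral of <dw, p / tau>: by sg dw = dp + dU ds and the ordinary chain
    rule, the integral of <p, dp> is half the increment of |p|^2. *)
Definition stratonovich (om : Om) : R :=
  (sg * tau)^-1 * (normsq p - normsq (ps ti om) + 2 * tint ti t (work om)).

(** On each interval (p' - p)(p' + p) = p'^2 - p^2 telescopes exactly; only the force remains as a
    sum depending on the partition. *)
Lemma pre_post_sumE s om : itv_partition ti t s ->
  pre s om + post s om = (sg * tau)^-1 * (normsq p - normsq (ps ti om) + \sum_k
   \sum_(0 <= i < size s) tint (nth t (ti :: s) i) (nth t (ti :: s) i.+1)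
      (fun u => grad (U u) (qs u om) 0 k) *
      (ps (nth t (ti :: s) i) om 0 k + ps (nth t (ti :: s) i.+1) om 0 k)).
Proof.
move=> hs; rewrite /prepoint_sum /postpoint_sum; set x := nth t (ti :: s); rewrite -big_split/=.
have xN : x (size s) = t by exact: itv_partition_nth_size hs.
have pN : p = ps (x (size s)) om by rewrite xN (end_mom hI om tt).
rewrite exchange_big/= [in normsq p]pN.
rewrite (_ : normsq (ps (x (size s)) om) - normsq (ps ti om) =
  \sum_(0 <= i < size s) (normsq (ps (x i.+1) om) - normsq (ps (x i) om))); last first.
  by rewrite (telescope_sumr (fun i => normsq (ps (x i) om))).
rewrite -big_split/= mulr_sumr !big_nat; apply: eq_bigr => i /= si.
have /andP[ax xb] := itv_partition_nth_in hs (ltnW si).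
have /andP[ax1 xb1] := itv_partition_nth_in hs si.
have xx := ltW (itv_partition_nthS hs si).
rewrite /dotp /normsq /dotp -sumrB -!big_split/= mulr_sumr; apply: eq_bigr => k _.
rewrite !mxE (@noise_increment om k _ _ ax xx xb1) invfM; ring.
Qed.

Lemma measurable_work : measurable_fun setT (fun om => tint ti t (work om)).
Proof.
apply: (@measurable_tint R _ Om ti t (fun r om => work om r)) => // r tr.
apply: (@measurable_cont_vec2 R _ Om d (qs r) (ps r) (fun z => dotp (grad (U r) z.1) z.2)).
- exact: mqs.
- exact: mps.
by have /andP[tr0 _] := tr; move=> om; exact: (continuous_power hU tr0).
Qed.

Lemma measurable_normsq_mom s : ti <= s <= t -> measurable_fun setT (fun om => normsq (ps s om)).
Proof.
by move=> hs; apply: measurable_sum => k; apply: measurable_funM; exact: mps.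
Qed.

Lemma measurable_stratonovich : measurable_fun setT stratonovich.
Proof.
apply: measurable_funM => //; apply: measurable_funD.
  by apply: measurable_funB => //; apply: measurable_normsq_mom; rewrite lexx.
by apply: measurable_funM => //; exact: measurable_work.
Qed.

Let measurable_dotp_increment r s u : ti <= r <= t -> ti <= s <= t -> ti <= u <= t ->
  measurable_fun setT (fun om => dotp (w s om - w r om) (tau^-1 *: ps u om)).
Proof.
move=> hr hs hu; apply: measurable_sum => k.
rewrite (_ : (fun _ => _) = fun om => (w s om 0 k - w r om 0 k) * (tau^-1 * ps u om 0 k)).
  apply: measurable_funM; first by apply: measurable_funB; apply: mw; rewrite in_itv.
  by apply: measurable_funM => //; exact: mps.
by apply/funext => om; rewrite !mxE.
Qed.

Lemma measurable_prepoint_sum s : itv_partition ti t s -> measurable_fun setT (pre s).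
Proof.
move=> hs; rewrite /prepoint_sum; under eq_fun do rewrite big_mkord.
apply: measurable_sum => i.
apply: measurable_dotp_increment; apply: itv_partition_nth_in => //; exact: ltnW.
Qed.

Lemma measurable_postpoint_sum s : itv_partition ti t s -> measurable_fun setT (post s).
Proof.
move=> hs; rewrite /postpoint_sum; under eq_fun do rewrite big_mkord.
apply: measurable_sum => i.
apply: measurable_dotp_increment; apply: itv_partition_nth_in => //; exact: ltnW.
Qed.

(* The Ito corrections of the two discretizations cancel in the sum, so that it
   converges path by path. *)
Lemma pre_post_limit :
  limit_in_probability P ti t (fun s om => pre s om + post s om) stratonovich.
Proof.
apply: limit_in_probability_of_cvg => [s hs||sq rf om].
- by apply: measurable_funD; [exact: measurable_prepoint_sum|exact: measurable_postpoint_sum].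
- exact: measurable_stratonovich.
under eq_fun do rewrite (pre_post_sumE _ (rf.1 _)).
rewrite /stratonovich; apply: cvgM; first exact: cvg_cst.
apply: cvgD; first exact: cvg_cst.
rewrite (_ : tint ti t (work om) =
    \sum_k tint ti t (fun u => grad (U u) (qs u om) 0 k * ps u om 0 k)); last first.
  by rewrite -tint_sum// => k; apply: continuous_mulr; [exact: cgk|exact: cpsk].
rewrite mulr_sumr; apply: cvg_big => [|k _]; first exact: add_continuous.
exact: riemann_pair_cvg rf (@cgk om k) (@cpsk om k).
Qed.

Lemma prepoint_of_postpoint L : postpoint_integral P ti t w Y L ->
  prepoint_integral P ti t w Y (fun om => stratonovich om - L om).
Proof.
move=> hL; have mD s : itv_partition ti t s -> measurable_fun setT (fun om => pre s om + post s om).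
  by move=> hs; apply: measurable_funD; [exact: measurable_prepoint_sum|exact: measurable_postpoint_sum].
have := limit_in_probabilityB mD measurable_postpoint_sum pre_post_limit hL.
by congr (limit_in_probability _ _ _ _ _); apply/funext => s; apply/funext => om; rewrite addrK.
Qed.

Lemma prepoint_unique L L' : prepoint_integral P ti t w Y L ->
  prepoint_integral P ti t w Y L' -> {ae P, forall om, L om = L' om}.
Proof. exact: (limit_in_probability_unique tt measurable_prepoint_sum). Qed.

Lemma measurable_kinetic (c : R) : measurable_fun setT
  (fun om => tint ti t (fun s => c * normsq (tau^-1 *: ps s om))).
Proof.
have E s om : c * normsq (tau^-1 *: ps s om) = c * tau^-1 ^+ 2 * normsq (ps s om).
  rewrite /normsq /dotp !mulr_sumr; apply: eq_bigr => k _; rewrite !mxE; ring.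
apply: (@measurable_tint R _ Om ti t (fun s om => c * normsq (tau^-1 *: ps s om))) => //.
  move=> om; rewrite (_ : (fun s => _) = fun s => c * tau^-1 ^+ 2 * normsq (ps s om)); last first.
    by apply/funext => s; exact: E.
  apply: continuous_mulr; first exact: cst_continuous.
  by apply: continuous_sumr => k; apply: continuous_mulr; exact: cpsk.
move=> s hs; under eq_fun do rewrite E.
by apply: measurable_funM => //; exact: measurable_normsq_mom.
Qed.

Lemma measurable_end_density (f : 'rV[R]_d -> 'rV[R]_d -> R) :
  continuous (fun z : 'rV[R]_d * 'rV[R]_d => f z.1 z.2) ->
  measurable_fun setT (fun om => f (qs ti om) (ps ti om)).
Proof.
move=> cf.
apply: (@measurable_cont_vec2 R _ Om d (qs ti) (ps ti) (fun z => f z.1 z.2)).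
- by apply: mqs; rewrite lexx.
- by apply: mps; rewrite lexx.
by move=> om; exact: cf.
Qed.

End reference_process.

(** * Change of measure *)

Lemma amplitude_inv (R : realType) (m tau beta : R) : 0 < m -> 0 < tau -> 0 < beta ->
  Num.sqrt (beta * tau / (2 * m)) = (noise_amplitude m tau beta)^-1.
Proof.
move=> m0 t0 b0; rewrite /noise_amplitude -sqrtrV ?invf_div ?[tau * beta]mulrC//.
by rewrite divr_ge0 ?mulr_ge0 ?ltW.
Qed.

Theorem mainTheorem4 (R : realType) (d : nat) (hd : (1 <= d)%N)
  (m tau beta ti : R) (hm : 0 < m) (htau : 0 < tau) (hbeta : 0 < beta)
  (U : R -> 'rV[R]_d -> R) (hU : regular_potential ti U)
  (Uini : 'rV[R]_d -> R)
  (hZ : (partition_function m beta Uini < +oo)%E)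
  (rho : R -> 'rV[R]_d -> 'rV[R]_d -> R)
  (hrho : fokker_planck_solution m tau beta ti U rho)
  (hini : forall q p : 'rV[R]_d,
     rho ti q p = (fine (partition_function m beta Uini))^-1
       * expR (- (beta * normsq p / (2 * m)) - beta * Uini q))
  (t : R) (ht : ti <= t) (q p : 'rV[R]_d)
  (disp : measure_display) (Omega : measurableType disp)
  (I : probability Omega R)
  (w : R -> Omega -> 'rV[R]_d) (hw : wiener I ti t w)
  (qs ps : R -> Omega -> 'rV[R]_d)
  (hI : backward_process m tau beta ti t (backward_filtration t w)
          (drift_ref U) w q p qs ps)
  (Pflat : probability Omega R) (wflat : R -> Omega -> 'rV[R]_d)
  (hwflat : backward_wiener Pflat ti t (backward_filtration t w) wflat)
  (hPflat : backward_process m tau beta ti t (backward_filtration t w)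
              (drift_flat tau U) wflat q p qs ps)
  (hgirsanov : girsanov_formula I Pflat m tau beta ti t w ps)
  (hint : class_D Pflat ti t (backward_filtration t w)
            (martingale_candidate m beta t U rho qs ps)) :
  let Z := fine (partition_function m beta Uini) in
  let prepoint :=
    prepoint_integral I ti t w (fun s omega => tau^-1 *: ps s omega) in
  (exists L : Omega -> R, prepoint L) /\
  forall L : Omega -> R, prepoint L ->
    ((rho t q p)%:E =
    'E_I[fun omega => (Z^-1 * expR (
        - (beta * Uini (qs ti omega))
        - beta * normsq (ps ti omega) / (2 * m)
        - (Num.sqrt (beta * tau / (2 * m)) * L omega
           + \int[@lebesgue_measure R]_(s in `[ti, t])
               (tau * beta / (4 * m) * normsq (tau^-1 *: ps s omega)))))%R])%E.
Proof.
move=> Z prepoint; have [mw _ _ _] := hw; have [dom [Lpost hpost hRN]] := hgirsanov.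
have hpre := prepoint_of_postpoint hm htau hbeta hU ht mw hI hpost.
split=> [|L hL]; first by exists (fun om => stratonovich m tau beta ti t U qs ps p om - Lpost om).
have hLae := prepoint_unique ht mw hI hL hpre.
have [iM EM] := @candidate_mean R d m tau beta ti t hm htau hbeta U rho hU hrho ht _ _ Pflat
  w wflat qs ps q p mw hwflat hPflat hint.
set M := martingale_candidate _ _ _ _ _ _ _ in iM EM.
pose kin om := tint ti t (fun s => tau * beta / (4 * m) * normsq (tau^-1 *: ps s om)).
pose c := Num.sqrt (beta * tau / (2 * m)).
(* The integrand of the theorem with the initial datum folded back into [rho ti], the form in which
   it appears in M at [ti]. *)
pose X om := rho ti (qs ti om) (ps ti om) * expR (- (c * L om + kin om)).
rewrite unlock.
have mX : measurable_fun setT X.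
  apply: measurable_funM.
    by apply: (measurable_end_density ht mw hI) => //; exact: continuous_rho_slice hrho _ (lexx ti).
  apply: measurableT_comp => //; apply: measurableT_comp => //; apply: measurable_funD.
    by apply: measurable_funM => //; exact: hL.1.
  exact: (measurable_kinetic ht mw hI).
have B0 : mbw m beta p != 0 by rewrite gt_eqF ?expR_gt0.
transitivity (\int[I]_om (X om)%:E)%E; last first.
  have XE om : X om = Z^-1 * expR (- (beta * normsq (ps ti om) / (2 * m))
      - beta * Uini (qs ti om) - (c * L om + kin om)).
    by rewrite /X hini [in RHS]expRD mulrA.
  apply: eq_integral => om _; rewrite XE; congr ((_ * expR _)%:E).
  by rewrite /kin /tint /c; ring.
have /integrableP[mRN _] :=
  Radon_Nikodym_integrable (nu := charge_of_finite_measure Pflat) (mu := I) dom.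
(* c is the inverse amplitude and amplitude^2 tau = 2m / beta. With this constant the kinetic
   energies in [stratonovich] become the Maxwell exponents at both ends, and its work term becomes
   (beta / m) times the work. *)
have hc : c * (noise_amplitude m tau beta * tau)^-1 = beta / (2 * m).
  rewrite invfM mulrA /c -amplitude_inv// -expr2 sqr_sqrtr; last first.
    by rewrite divr_ge0 ?mulr_ge0 ?ltW.
  by field; rewrite (gt_eqF htau) (gt_eqF hm).
have key : ae_eq I setT (fun om => (X om)%:E) (fun om => (((mbw m beta p)^-1 * M ti om)%:E *
    Radon_Nikodym (charge_of_finite_measure Pflat) I om)%E).
  apply: filterS2 hLae hRN => om hLom h2 _; rewrite (h2 Logic.I) -EFinM; congr (_%:E).
  (* With L replaced by [stratonovich] minus [Lpost], the exponential splits into the Girsanov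
     density and exp(- c stratonovich), which is the weight in M at [ti] divided by the Maxwell
     weight of p. *)
  rewrite /M /martingale_candidate /X hLom -!/(tint _ _ _).
  set D := tint _ _ _; rewrite -/(kin om) -/c /mbw /stratonovich -/D.
  rewrite -expRN mulrBr [c * (_ * _)]mulrA hc.
  set r := rho _ _ _; rewrite [RHS](_ : _ = r * (expR (- (beta * normsq p / (2 * m))) *
    expR (- (beta / m * D)) * expR (beta * normsq (ps ti om) / (2 * m)) *
    expR (c * Lpost om - kin om))); last by ring.
  by rewrite -!expRD; congr (_ * expR _); field; rewrite (gt_eqF hm).
have iM' : Pflat.-integrable setT (fun om => ((mbw m beta p)^-1 * M ti om)%:E).
  by have := integrableZl measurableT (mbw m beta p)^-1 iM.
have mMRN : measurable_fun setT (fun om => (((mbw m beta p)^-1 * M ti om)%:E *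
    Radon_Nikodym (charge_of_finite_measure Pflat) I om)%E).
  by apply: emeasurable_funM => //; have /integrableP[] := iM'.
have /measurable_EFinP mXE := mX.
rewrite (ae_eq_integral _ _ measurableT mXE mMRN key).
(* The mean under I becomes one under [Pflat], where the mean of M at [ti] is known; the Maxwell
   weight of p then cancels. *)
rewrite (Radon_Nikodym_change_of_variables dom measurableT iM').
have fi : (\int[Pflat]_om ((mbw m beta p)^-1 * M ti om)%:E)%E \is a fin_num.
  exact: integrable_fin_num.
rewrite -(fineK fi) -/(Rintegral _ _ _) RintegralZl//.
by rewrite EM mulKf.
Qed.
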